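(* Let $(R,\mathfrak{m}_R,k)$, $(S,\mathfrak{m}_S,k)$ and $(T,\mathfrak{m}_T,k)$ be local rings of prime characteristic $p>0$ with the same residue field $k$, let $\epsilon_R:R\to T$ and $\epsilon_S:S\to T$ be surjective ring homomorphisms, assume $\dim R>0$, and let $s>0$ be a real number. Then, with $h_s$ of each ring computed over that ring itself with respect to its own maximal ideal: (i) if $\dim(R)=\dim(S)=\dim(T)$, then $h_s(R\times_T S)=h_s(R)+h_s(S)-h_s(T)$; (ii) if $\dim(R)=\dim(S)>\dim(T)$, then $h_s(R\times_T S)=h_s(R)+h_s(S)$; (iii) if $\dim(R)>\dim(S)>\dim(T)$, then $h_s(R\times_T S)=h_s(R)$.
   Context: All rings are commutative, Noetherian, local, with identity. The fiber product is $R\times_T S=\{(r,s)\in R\times S:\epsilon_R(r)=\epsilon_S(s)\}$; it is a Noetherian local ring with maximal ideal $\mathfrak{m}=\mathfrak{m}_R\times_{\mathfrak{m}_T}\mathfrak{m}_S$ and residue field $k$, of characteristic $p$, with $\dim(R\times_T S)=\max\{\dim R,\dim S\}$. $h$-function: for a local ring $(A,\mathfrak{n})$ of prime characteristic $p>0$ and dimension $d>0$, and real $s>0$, $$h_s(A)=\lim_{e\to\infty}\frac{\ell_A\big(A/(\mathfrak{n}^{\lceil sp^e\rceil}+\mathfrak{n}^{[p^e]})\big)}{p^{ed}},\qquad d=\dim A,$$ where $\ell_A$ is length and $\mathfrak{n}^{[p^e]}$ is the ideal generated by the $p^e$-th powers of elements of $\mathfrak{n}$ (the limit is known to exist). *)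

(* Defs.v *)
From HB Require Import structures.
From mathcomp Require Import all_boot all_order all_algebra.
From mathcomp Require Import all_classical all_reals all_analysis.

Set Implicit Arguments.
Unset Strict Implicit.
Unset Printing Implicit Defensive.

Import Order.TTheory GRing.Theory Num.Theory.
Import numFieldNormedType.Exports.

Local Open Scope classical_set_scope.
Local Open Scope ring_scope.

Section Ideals.
Variable A : comNzRingType.
Implicit Types (I J M P : set A) (F : set (set A)).

(* The unit ideal is allowed, unlike in [idealr_closed]: chains of submodules
   of [A / I] end at [A]. *)
Definition ideal I : Prop :=
  [/\ I 0, (forall x y, I x -> I y -> I (x + y)) &
      (forall a x, I x -> I (a * x))].

Definition ideal_proper I : Prop := ideal I /\ ~ I 1.

Definition prime_ideal P : Prop :=
  ideal_proper P /\ (forall x y, P (x * y) -> P x \/ P y).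

Definition maximal_ideal M : Prop :=
  ideal_proper M /\ (forall J, ideal_proper J -> M `<=` J -> J = M).

Definition ideal_gen (G : set A) : set A := smallest ideal G.

Definition ideal_add I J : set A := [set z | exists x y, [/\ I x, J y & z = x + y]].

(* [I ^ n]; for [n = 0] the only generator is the empty product [1]. *)
Definition ideal_pow I (n : nat) : set A :=
  ideal_gen [set z | exists x : 'I_n -> A, (forall i, I (x i)) /\ z = \prod_i x i].

(* [I^[q]] *)
Definition frob_pow I (q : nat) : set A := ideal_gen [set x ^+ q | x in I].

Definition noetherian : Prop :=
  forall I, ideal I -> exists s : seq A, I = ideal_gen [set` s].

Definition noetherian_local : Prop :=
  noetherian /\ (exists! M, maximal_ideal M).

(* Meaningful when [A] has exactly one maximal ideal, as in [noetherian_local]. *)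
Definition max_ideal : set A := xget set0 maximal_ideal.

(* Supremum of the [n] for which there is a strict chain
   [c 0 < c 1 < ... < c n] in [F]; the supremum of an unbounded set of naturals
   is [0] by convention, which is not reached below: Noetherian local rings
   have finite Krull dimension and [A / I] has finite length when [I]
   contains a power of the maximal ideal. *)
Definition chain_sup F : nat :=
  supremum 0%N [set n : nat | exists c : nat -> set A,
    (forall i, (i <= n)%N -> F (c i)) /\
    (forall i, (i < n)%N -> c i `<` c i.+1)].

Definition krull_dim : nat := chain_sup prime_ideal.

(* Length of the [A]-module [A / I], whose submodules correspond to the ideals
   of [A] containing [I]. *)
Definition quot_length I : nat := chain_sup [set J | ideal J /\ I `<=` J].

End Ideals.

Arguments noetherian : clear implicits.
Arguments noetherian_local : clear implicits.
Arguments max_ideal : clear implicits.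
Arguments krull_dim : clear implicits.

Definition residue_map (A : comNzRingType) (k : fieldType) (pi : {rmorphism A -> k})
  : Prop := set_surj setT setT pi /\ pi @^-1` [set 0] = max_ideal A.

(* [s] is positive in use, so the absolute value only turns the
   ceiling into a natural number. *)
Definition h_seq (K : realType) (p : nat) (s : K) (A : comNzRingType) (e : nat) : K :=
  let n := max_ideal A in
  (quot_length (ideal_add (ideal_pow n `|Num.ceil (s * p%:R ^+ e)|%N)
                          (frob_pow n (p ^ e))))%:R
  / p%:R ^+ (e * krull_dim A).

Definition h_fun (K : realType) (p : nat) (s : K) (A : comNzRingType) : K :=
  lim (h_seq p s A @ \oo).

Section FiberProduct.
Variables (R S T : comNzRingType).
Variables (f : {rmorphism R -> T}) (g : {rmorphism S -> T}).

Definition fiber_pred : {pred R * S} := [pred x | f x.1 == g x.2].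

Lemma fiber_pred_subring : subring_closed fiber_pred.
Proof.
split=> [|x y|x y]; rewrite !inE /= ?rmorph1 // => /eqP hx /eqP hy.
  by rewrite !rmorphB hx hy.
by rewrite !rmorphM hx hy.
Qed.

HB.instance Definition _ :=
  GRing.isSubringClosed.Build (R * S)%type fiber_pred fiber_pred_subring.

Record fiber_prod := FiberProd {
  fiber_val :> (R * S)%type;
  _ : fiber_val \in fiber_pred }.

HB.instance Definition _ := [isSub for fiber_val].
HB.instance Definition _ := [Choice of fiber_prod by <:].
HB.instance Definition _ := [SubChoice_isSubComNzRing of fiber_prod by <:].

End FiberProduct.

(* Main.v *)
(** Write [q = p ^ e] and let [len(A / I_q)] be the length whose normalization converges
    to [h_s]. If [K1] and [K2] are the kernels of [R x_T S -> R] and [R x_T S -> S],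
    then [K1 * K2 = 0], [K1] and [K2] meet in [0] and [K1 + K2] is the kernel of
    [R x_T S -> T]. So it suffices that
    [len(A / I_q) + len(A / (I_q + K1 + K2)) - len(A / (I_q + K1)) - len(A / (I_q + K2))]
    is [O(q ^ (d - 1))] whenever [K1] and [K2] meet in [0], and that the limits exist.

    Both follow from a replacement for reducedness. The completion of [A] is finite over a
    power series ring [B] in [d] variables over a coefficient field. The [B]-spans [D_n] of
    the [p ^ n]-th powers decrease, so their generic ranks stabilize; then [D = D_n] is
    generically reduced and generically spanned over [B] by its own [p]-th powers. Hence,
    up to a nonzero factor [b] of [B], every [D]-submodule splits off [D]-linearly, and
    there is a [p]-linear operator [P] whose image generates the completion over [B].
    Replacing [I_(q p^n)] by the ideal [V_q] generated by the [p ^ n]-th powers of elements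
    of [I_q] costs [O(q ^ (d - 1))] and makes everything [D]-linear: [P] maps [V_q] into
    [V_(p q)], so that [len(A / V_(p q)) <= p ^ d * len(A / V_q) + O(q ^ (d - 1))], which
    gives convergence, while a splitting of [K1 + K2] shows that [b] kills the error term
    [(V_q + K1) :&: (V_q + K2) / V_q] of the modular law. All error terms are bounded by
    the length of [A / (b, V_q)], which is [O(q ^ (d - 1))] since [b] is a nonzero power
    series. *)

Require Import Defs.
From HB Require Import structures.
From mathcomp Require Import all_boot all_order all_algebra.
From mathcomp Require Import all_classical all_reals all_analysis.
From mathcomp Require mpoly.
From mathcomp Require Import ring lra zify.

Import -(notations) mpoly.
Import Order.TTheory GRing.Theory Num.Theory.
Import numFieldNormedType.Exports.
Local Open Scope classical_set_scope.
Local Open Scope ring_scope.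

Set Implicit Arguments.
Unset Strict Implicit.
Unset Printing Implicit Defensive.

(** * Lengths relative to an operator ring *)

(** The rings need not be reduced and [k] need not be finite over its subfield of [p]-th powers, so
    generic separability and finiteness of the Frobenius are both missing. [B]-spans of [p ^ n]-th
    powers meet both obstacles: they lie in a finite [B]-module, so their generic ranks are finite
    whatever [k] is, and raising to [p ^ n]-th powers eventually kills nilpotents. Every generic
    statement carries an explicit nonzero factor [b], because that factor is what is finally turned
    into a length. The splitting and [P] respect only [p ^ n]-th powers; this forces the passage to
    ideals generated by such powers, and the shift from [e] to [e + n] in the estimates, which a
    change of normalization absorbs. The power series ring requires a coefficient field, hence the
    completion; lengths over [A] and over [B] agree because both have residue field [k], and the
    factor [p ^ d] counts the monomials with exponents below [p] in the [d] parameters. All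
    densities are normalized by the dimension of [R], so that the three cases are one identity in
    which the terms of smaller dimension tend to [0]. *)

Lemma supremum_natP (X : set nat) (N : nat) :
  X !=set0 -> (forall n, X n -> (n <= N)%N) ->
  X (supremum 0%N X) /\ (forall n, X n -> (n <= supremum 0%N X)%N).
Proof.
move=> [n0 Xn0] ubX.
have exX : exists n, `[< X n >] by exists n0; apply/asboolP.
have ubX' n : `[< X n >] -> (n <= N)%N by move/asboolP; exact: ubX.
have [M /asboolP XM maxM] := ex_maxnP exX ubX'.
have supM : supremums X M.
  split=> [n Xn|n ubn]; first by rewrite leEnat; apply: maxM; apply/asboolP.
  exact: ubn.
suff -> : supremum 0%N X = M by split=> // n /asboolP; exact: maxM.
rewrite /supremum; case: ifPn => [/eqP X0|_]; first by rewrite X0 in Xn0.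
by case: xgetP => [y -> supy|/(_ M)//]; apply: is_subset1_supremums supy supM.
Qed.

Section Length.
Variables (O A : comNzRingType) (phi : {rmorphism O -> A}).
Implicit Types (U V W : set A).

(** The operator ring is kept apart from [A] because the same subsets are measured over [A], over
    its completion and over the power series ring; ideals are the case [phi = idfun]. *)
Definition submod U : Prop :=
  [/\ U 0, (forall x y, U x -> U y -> U (x + y)) &
      (forall o x, U x -> U (phi o * x))].

Definition cyc (y : A) : set A := [set phi o * y | o in setT].

Lemma submod0 U : submod U -> U 0. Proof. by case. Qed.
Lemma submodD U x y : submod U -> U x -> U y -> U (x + y).
Proof. by case=> _ h _; apply: h. Qed.
Lemma submodM U o x : submod U -> U x -> U (phi o * x).
Proof. by case=> _ _; apply. Qed.
Lemma submodN U x : submod U -> U x -> U (- x).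
Proof. by move=> sU Ux; rewrite -mulN1r -(rmorph1 phi) -rmorphN; apply: submodM. Qed.
Lemma submodB U x y : submod U -> U x -> U y -> U (x - y).
Proof. by move=> sU Ux Uy; apply: submodD => //; apply: submodN. Qed.
Lemma submod_sum {I : Type} {r : seq I} {P : pred I} {F : I -> A} {U} :
  submod U -> (forall i, P i -> U (F i)) -> U (\sum_(i <- r | P i) F i).
Proof.
by move=> sU h; elim/big_ind: _ => // [|x y]; [apply: submod0|apply: submodD].
Qed.

Lemma submodT : submod setT. Proof. by []. Qed.

Lemma submod_setI U V : submod U -> submod V -> submod (U `&` V).
Proof.
move=> sU sV; split=> [|x y [Ux Vx] [Uy Vy]|o x [Ux Vx]]; split;
  by [apply: submod0|apply: submodD|apply: submodM].
Qed.

Lemma submod_add U V : submod U -> submod V -> submod (ideal_add U V).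
Proof.
move=> sU sV; split.
- by exists 0, 0; rewrite addr0; split=> //; apply: submod0.
- move=> _ _ [x [y [Ux Vy ->]]] [x' [y' [Ux' Vy' ->]]].
  by exists (x + x'), (y + y'); rewrite addrACA; split=> //; apply: submodD.
- move=> o _ [x [y [Ux Vy ->]]]; exists (phi o * x), (phi o * y).
  by rewrite mulrDr; split=> //; apply: submodM.
Qed.

Lemma submod_cyc y : submod (cyc y).
Proof.
split; [|move=> _ _ [t _ <-] [t1 _ <-]|move=> o _ [t1 _ <-]].
- by exists 0 => //; rewrite rmorph0 mul0r.
- by exists (t + t1) => //; rewrite rmorphD mulrDl.
- by exists (o * t1) => //; rewrite rmorphM mulrA.
Qed.

Lemma cyc0 y : cyc y 0.
Proof. exact: submod0 (submod_cyc y). Qed.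

Lemma cyc_id y : cyc y y.
Proof. by exists 1 => //; rewrite rmorph1 mul1r. Qed.

Lemma ideal_addl U V : V 0 -> U `<=` ideal_add U V.
Proof. by move=> V0 x Ux; exists x, 0; rewrite addr0. Qed.

Lemma ideal_addr U V : U 0 -> V `<=` ideal_add U V.
Proof. by move=> U0 x Vx; exists 0, x; rewrite add0r. Qed.

Lemma ideal_add_sub U V W :
  submod W -> U `<=` W -> V `<=` W -> ideal_add U V `<=` W.
Proof.
by move=> sW UW VW _ [x [y [Ux Vy ->]]]; apply: submodD => //; [apply: UW|apply: VW].
Qed.

Lemma cyc_sub y W : submod W -> W y -> cyc y `<=` W.
Proof. by move=> sW Wy _ [t _ <-]; apply: submodM. Qed.

Definition has_chain V U n : Prop := exists c : nat -> set A,
  (forall i, (i <= n)%N -> [/\ submod (c i), V `<=` c i & c i `<=` U]) /\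
  (forall i, (i < n)%N -> c i `<` c i.+1).

Definition len V U : nat :=
  chain_sup [set J | [/\ submod J, V `<=` J & J `<=` U]].

(** Bounding chains is meaningful also when their lengths are unbounded, where [len] takes its
    default value [0]. *)
Definition len_le V U n : Prop := forall k, has_chain V U k -> (k <= n)%N.

Definition len_fin V U : Prop := exists n, len_le V U n.

Lemma len_spec V U : submod V -> V `<=` U -> len_fin V U ->
  forall n, has_chain V U n <-> (n <= len V U)%N.
Proof.
move=> sV VU [N leN].
have -> : len V U = supremum 0%N [set n | has_chain V U n] by [].
have [||hs ms] := @supremum_natP [set n | has_chain V U n] N.
- exists 0%N; exists (fun=> V); split=> // i _; split=> //.
- exact: leN.
move=> n; split; first exact: ms.
move=> len; have [c [c1 c2]] := hs; exists c; split=> i ilt.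
  by apply: c1; apply: leq_trans ilt _.
by apply: c2; apply: leq_trans ilt _.
Qed.

Lemma len_leP V U n : submod V -> V `<=` U -> len_fin V U ->
  len_le V U n <-> (len V U <= n)%N.
Proof.
move=> sV VU fVU; have sp := len_spec sV VU fVU; split=> [le|le k].
  by apply: le; apply/sp.
by move/sp => h; apply: leq_trans h le.
Qed.

Lemma len_le_len V U n : submod V -> V `<=` U -> len_le V U n -> (len V U <= n)%N.
Proof. by move=> sV VU h; apply/len_leP => //; exists n. Qed.

Lemma has_chain_ext V W U n : submod U -> V `<=` U -> W `<` U ->
  has_chain V W n -> has_chain V U n.+1.
Proof.
move=> sU VU [WU UW] [c [c1 c2]].
exists (fun i => if (i <= n)%N then c i else U); split=> i.
  case: (leqP i n) => [ilt _|_ _]; last by split.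
  by have [sc Vc cW] := c1 _ ilt; split=> //; apply: subset_trans WU.
rewrite ltnS => ilen; rewrite ilen; case: ltnP => [|h]; first exact: c2.
have [_ _ cW] := c1 _ ilen; split; first exact: subset_trans WU.
by move=> Uc; apply: UW; apply: subset_trans cW.
Qed.

Lemma has_chain_widen V V' U U' n : V' `<=` V -> U `<=` U' ->
  has_chain V U n -> has_chain V' U' n.
Proof.
move=> hV hU [c [c1 c2]]; exists c; split=> // i ilt; have [sc Vc cU] := c1 _ ilt.
by split=> //; [apply: subset_trans Vc|apply: subset_trans hU].
Qed.

Lemma has_chain0 V : submod V -> has_chain V V 0.
Proof. by move=> sV; exists (fun=> V); split=> // i _; split. Qed.

Lemma has_chain_cat V W U m n : V `<=` W -> W `<=` U ->
  has_chain V W m -> has_chain W U n -> has_chain V U (m + n).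
Proof.
move=> VW WU hVW [c [c1 c2]].
suff h k : (k <= n)%N -> has_chain V (c k) (m + k).
  have [_ _ cU] := c1 _ (leqnn n).
  exact: has_chain_widen (@subset_refl _ V) cU (h _ (leqnn n)).
elim: k => [_|k IH klt].
  rewrite addn0; have [_ Wc _] := c1 _ (leq0n n).
  exact: has_chain_widen (@subset_refl _ V) Wc hVW.
rewrite addnS; have [sc Wc _] := c1 _ klt.
by apply: (has_chain_ext (W := c k)); [|apply: subset_trans Wc|apply: c2|apply: IH (ltnW _)].
Qed.

Lemma modular_eq U U' W : submod U -> submod U' -> U `<=` U' ->
  U' `&` W `<=` U -> U' `<=` ideal_add U W -> U' `<=` U.
Proof.
move=> sU sU' UU' hI hA x U'x; have [u [w [Uu Ww xE]]] := hA _ U'x.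
rewrite xE; apply: submodD => //; apply: hI; split=> //.
have -> : w = x - u by rewrite xE addrC addKr.
by apply: submodB => //; apply: UU'.
Qed.

(** Intersecting with [W] and adding [W] turn one chain into a chain below [W] and a chain above it.
    By the modular law a strict step stays strict in at least one of the two. *)
Lemma has_chain_split V W U n : submod V -> submod W -> V `<=` W -> W `<=` U -> submod U ->
  has_chain V U n ->
  exists m1 m2, [/\ (n <= m1 + m2)%N, has_chain V W m1 & has_chain W U m2].
Proof.
move=> sV sW VW WU sU [c [c1 c2]].
suff h k : (k <= n)%N -> exists m1 m2, [/\ (k <= m1 + m2)%N,
    has_chain V (c k `&` W) m1 & has_chain W (ideal_add (c k) W) m2].
  have [m1 [m2 [le h1 h2]]] := h _ (leqnn n); exists m1, m2; split=> //.
    exact: has_chain_widen h1.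
  apply: has_chain_widen h2 => //; apply: ideal_add_sub => //.
  by have [] := c1 _ (leqnn n).
elim: k => [_|k IH klt].
  have [sc Vc cU] := c1 _ (leq0n n); exists 0%N, 0%N; split=> //.
    apply: has_chain_widen (has_chain0 sV) => // x Vx; split; [exact: Vc|exact: VW].
  apply: has_chain_widen (has_chain0 sW) => //; apply: ideal_addr; exact: submod0.
have [m1 [m2 [le h1 h2]]] := IH (ltnW klt).
have [sc Vc cU] := c1 _ (ltnW klt); have [sc' Vc' cU'] := c1 _ klt.
have [cc' c'c] := c2 _ klt.
have subI : c k `&` W `<=` c k.+1 `&` W by move=> x [/cc' ? ?].
have subA : ideal_add (c k) W `<=` ideal_add (c k.+1) W.
  by move=> _ [x [y [cx Wy ->]]]; exists x, y; split=> //; apply: cc'.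
have [eqI|neI] := pselect (c k.+1 `&` W `<=` c k `&` W); last first.
  exists m1.+1, m2; split=> //; last exact: has_chain_widen h2.
  apply: has_chain_ext h1 => //; first exact: submod_setI.
  by move=> x Vx; split; [exact: Vc'|exact: VW].
exists m1, m2.+1; split.
- by rewrite addnS.
- exact: has_chain_widen h1.
apply: has_chain_ext h2; first exact: submod_add.
  by apply: ideal_addr; apply: submod0.
split=> // eqA; apply: c'c; apply: (@modular_eq _ _ W) => //.
  by move=> x /eqI [].
by apply: subset_trans eqA; apply: ideal_addl; apply: submod0.
Qed.

Lemma len_le_add V W U a b : submod V -> submod W -> submod U -> V `<=` W -> W `<=` U ->
  len_le V W a -> len_le W U b -> len_le V U (a + b).
Proof.
move=> sV sW sU VW WU la lb k /(has_chain_split sV sW VW WU sU).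
by move=> [m1 [m2 [le /la h1 /lb h2]]]; apply: leq_trans le (leq_add h1 h2).
Qed.

Lemma len_le_sub V V' U U' a : V `<=` V' -> U' `<=` U -> len_le V U a -> len_le V' U' a.
Proof. by move=> hV hU l k h; apply: l; apply: has_chain_widen h. Qed.

Lemma len_fin_sub V V' U U' : V `<=` V' -> U' `<=` U -> len_fin V U -> len_fin V' U'.
Proof. by move=> hV hU [n l]; exists n; apply: len_le_sub l. Qed.

Lemma len_fin_add V W U : submod V -> submod W -> submod U -> V `<=` W -> W `<=` U ->
  len_fin V W -> len_fin W U -> len_fin V U.
Proof. by move=> ? ? ? ? ? [a ha] [b hb]; exists (a + b)%N; apply: len_le_add ha hb. Qed.

Lemma lenD V W U : submod V -> submod W -> submod U -> V `<=` W -> W `<=` U ->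
  len_fin V U -> len V U = (len V W + len W U)%N.
Proof.
move=> sV sW sU VW WU fVU.
have VU := subset_trans VW WU.
have fVW : len_fin V W by apply: len_fin_sub fVU.
have fWU : len_fin W U by apply: len_fin_sub fVU.
apply/eqP; rewrite eqn_leq; apply/andP; split.
  apply/(len_leP _ sV VU fVU); apply: (len_le_add sV sW sU VW WU).
    exact/(len_leP _ sV VW fVW).
  exact/(len_leP _ sW WU fWU).
apply/(len_spec sV VU fVU); apply: (has_chain_cat VW WU).
  exact/(len_spec sV VW fVW).
exact/(len_spec sW WU fWU).
Qed.

Lemma len_le0 V : len_le V V 0.
Proof.
move=> -[|k] // [c [c1 c2]]; have [_ Vc _] := c1 _ (leq0n _).
have [_ _ cV] := c1 _ (ltn0Sn k); have [_ h] := c2 _ (ltn0Sn k).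
by case: h; apply: subset_trans Vc.
Qed.

Lemma len_eq0 V : submod V -> len V V = 0%N.
Proof. by move=> sV; apply/eqP; rewrite -leqn0; apply: len_le_len (@len_le0 V). Qed.

Lemma len_mono V V' U U' : submod V -> submod V' -> submod U -> submod U' ->
  V `<=` V' -> V' `<=` U' -> U' `<=` U -> len_fin V U ->
  (len V' U' <= len V U)%N.
Proof.
move=> *; apply/len_leP => //; first exact: len_fin_sub (_ : len_fin V U).
apply: (@len_le_sub V _ U) => //; apply/len_leP => //.
by apply: subset_trans; first eassumption; apply: subset_trans; eassumption.
Qed.

End Length.

Section LengthMaps.
Variables (O1 O2 A1 A2 : comNzRingType).
Variables (phi1 : {rmorphism O1 -> A1}) (phi2 : {rmorphism O2 -> A2}).
Variables (f : A1 -> A2).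

(** Preimages of a chain stay strict because [f] is onto modulo [V2]. Here [f] is a bare function:
    it will be a ring morphism, a multiplication, or the identity combined with a change of base.
    [has_chain_push] is the dual statement for maps that are injective modulo [V2]. *)
Lemma has_chain_pull (V1 U1 : set A1) (V2 U2 : set A2) n :
  (forall J, submod phi2 J -> submod phi1 (U1 `&` f @^-1` J)) ->
  V1 `<=` U1 -> (forall x, V1 x -> V2 (f x)) ->
  (forall y, U2 y -> exists2 u, U1 u & V2 (y - f u)) ->
  has_chain phi2 V2 U2 n -> has_chain phi1 V1 U1 n.
Proof.
move=> hJ VU hV hU [c [c1 c2]]; exists (fun i => U1 `&` f @^-1` (c i)); split=> i ilt.
  have [sc Vc cU] := c1 _ ilt; split; [exact: hJ| |by move=> x []].
  by move=> x Vx; split; [exact: VU|apply: Vc; apply: hV].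
have [sc Vc cU] := c1 _ (ltnW ilt); have [sc' Vc' cU'] := c1 _ ilt.
have [cc' c'c] := c2 _ ilt; split; first by move=> x [? /cc' ?].
move=> h; apply: c'c => y c'y; have [u Uu yu] := hU _ (cU' _ c'y).
have c'u : c i.+1 (f u).
  have -> : f u = y - (y - f u) by rewrite opprB addrC subrK.
  by apply: (submodB sc') => //; apply: Vc'.
have [_ cu] := h u (conj Uu c'u).
have -> : y = (y - f u) + f u by rewrite subrK.
by apply: (submodD sc) => //; apply: Vc.
Qed.

Lemma has_chain_push (V1 U1 : set A1) (V2 U2 : set A2) n :
  {morph f : x y / x - y} ->
  (forall J, submod phi1 J -> V1 `<=` J -> submod phi2 (ideal_add (f @` J) V2)) ->
  submod phi1 V1 -> submod phi2 V2 -> submod phi2 U2 ->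
  V2 `<=` U2 -> (forall x, U1 x -> U2 (f x)) ->
  submod phi1 U1 ->
  (forall u, U1 u -> V2 (f u) -> V1 u) ->
  has_chain phi1 V1 U1 n -> has_chain phi2 V2 U2 n.
Proof.
move=> fB hJ sV1 sV2 sU2 VU hU sU1 hV [c [c1 c2]].
exists (fun i => ideal_add (f @` c i) V2); split=> i ilt.
  have [sc Vc cU] := c1 _ ilt; split; first exact: hJ.
    apply: ideal_addr; exists 0; first exact: submod0 sc.
    by have := fB 0 0; rewrite !subrr.
  by apply: (ideal_add_sub sU2) => // _ [x cx <-]; apply: hU; apply: cU.
have [sc Vc cU] := c1 _ (ltnW ilt); have [sc' Vc' cU'] := c1 _ ilt.
have [cc' c'c] := c2 _ ilt; split.
  by move=> _ [_ [y [[x cx <-] Vy ->]]]; exists (f x), y; split=> //; exists x => //; apply: cc'.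
move=> h; apply: c'c => y c'y.
have : ideal_add (f @` c i.+1) V2 (f y).
  by apply: ideal_addl; [exact: submod0 sV2|exists y].
move=> /h [_ [v [[x cx <-] Vv e]]].
have -> : y = (y - x) + x by rewrite subrK.
apply: (submodD sc) => //; apply: Vc; apply: hV.
  by apply: (submodB sU1); [apply: cU'|apply: cU].
by rewrite fB e addrC addKr.
Qed.

End LengthMaps.

Section Steps.
Variables (O A : comNzRingType) (phi : {rmorphism O -> A}) (m : set O).
Hypothesis m_inv : forall t, ~ m t -> exists t', m (1 - t' * t).
Local Notation cyc := (cyc phi).

(** [m] acts as a maximal ideal through [m_inv] alone: a coefficient outside [m] is invertible
    modulo [m], and [m] kills [y] modulo [V], so that any element outside [V] gives back [y]. *)
Lemma len_le1_step V y : submod phi V -> (forall t, m t -> V (phi t * y)) ->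
  len_le phi V (ideal_add V (cyc y)) 1.
Proof.
move=> sV my [|[|k]] // [c [c1 c2]].
have [s0 V0 _] := c1 _ (leq0n _); have [s1 V1 U1] := c1 1%N isT.
have [s2 V2 U2] := c1 2%N isT.
have [_ n10] := c2 0%N isT; have [_ n21] := c2 1%N isT.
case: n21; apply: (subset_trans U2); apply: (ideal_add_sub s1) => //.
apply: (cyc_sub s1).
move/existsNP: n10 => [z /not_implyP[z1 z0]].
have [v [_ [Vv [t _ <-] zE]]] := U1 _ z1.
have [mt|/m_inv[t' mt']] := pselect (m t).
  by case: z0; rewrite zE; apply: V0; apply: (submodD sV) => //; apply: my.
have -> : y = phi t' * z - phi t' * v + phi (1 - t' * t) * y.
  by rewrite zE rmorphB rmorph1 rmorphM; ring.
apply: (submodD s1); last by apply: V1; apply: my.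
by apply: (submodB s1); apply: (submodM _ s1) => //; apply: V1.
Qed.

(** Steps are allowed to be trivial, so the index only bounds the length from above. The filtration
    itself can be reread over another operator ring with the same residue field, which is how
    lengths are compared. *)
Inductive tower (V : set A) : nat -> set A -> Prop :=
| Tower0 : tower V 0 V
| TowerS k W y : tower V k W -> (forall t, m t -> W (phi t * y)) ->
    tower V k.+1 (ideal_add W (cyc y)).

Lemma tower_cat V W U k l : tower V k W -> tower W l U -> tower V (l + k) U.
Proof. by move=> tVW; elim=> // n W' y _ IH my; apply: TowerS. Qed.

Lemma tower_fin V k U : submod phi V -> tower V k U ->
  [/\ submod phi U, V `<=` U & len_le phi V U k].
Proof.
move=> sV; elim=> [|n W y tVW [sW VW fVW] my].
  by split=> //; apply: len_le0.
have sU : submod phi (ideal_add W (cyc y)).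
  by apply: submod_add => //; apply: submod_cyc.
have WU : W `<=` ideal_add W (cyc y) by apply: ideal_addl; apply: cyc0.
split=> //; first exact: subset_trans WU.
by rewrite -addn1; apply: (len_le_add sV sW sU) => //; apply: len_le1_step.
Qed.

(** The bound counts the monomials with exponents below [n] in the variables of [s]: filter by the
    powers of one variable and treat the others inside each layer. *)
Lemma tower_cyc (I : eqType) (x : I -> O) (n : nat) (s : seq I) V y :
  (forall t, m t -> exists c : I -> O, exists r : seq I, t = \sum_(i <- r) c i * x i) ->
  submod phi V ->
  (forall i, i \notin s -> V (phi (x i) * y)) ->
  (forall i, i \in s -> V (phi (x i ^+ n) * y)) ->
  exists2 k, (k <= n ^ size s)%N & tower V k (ideal_add V (cyc y)).
Proof.
move=> mx; elim: s V y => [|j s IH] V y sV hn hs.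
  exists 1%N; rewrite ?expn0 //; apply: TowerS; first exact: Tower0.
  move=> t /mx [c [r ->]].
  rewrite rmorph_sum mulr_suml; apply: (submod_sum sV) => i _.
  by rewrite rmorphM -mulrA; apply: submodM => //; apply: hn.
(* The exponent runs downwards: [W 0] is [V] and [W n] contains [y]. *)
pose W i := ideal_add V (cyc (phi (x j ^+ (n - i)) * y)).
have sW i : submod phi (W i) by apply: submod_add => //; apply: submod_cyc.
have VW i : V `<=` W i by apply: ideal_addl; apply: cyc0.
have Wi i : W i (phi (x j ^+ (n - i)) * y).
  by apply: ideal_addr; [exact: submod0 sV|exact: cyc_id].
have WW i : W i `<=` W i.+1.
  apply: (ideal_add_sub (sW _)) => //; apply: cyc_sub => //.
  case: (ltnP i n) => lt; last first.
    by rewrite (_ : n - i = n - i.+1)%N //; lia.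
  by rewrite (_ : n - i = (n - i.+1).+1)%N; [rewrite exprS rmorphM -mulrA; exact: submodM|lia].
have h i : (i <= n)%N -> exists2 k, (k <= i * n ^ size s)%N & tower V k (W i).
  elim: i => [_|i IHi lt].
    exists 0%N => //; have -> : W 0%N = V; last exact: Tower0.
    apply/seteqP; split=> //; apply: (ideal_add_sub sV) => //; apply: cyc_sub => //.
    by rewrite subn0; apply: hs; rewrite mem_head.
  have [k le tk] := IHi (ltnW lt).
  have [||k' le' tk'] := IH (W i) (phi (x j ^+ (n - i.+1)) * y) (sW i).
  - move=> i0; rewrite mulrCA => i0s; case: (eqVneq i0 j) => [->|ne].
      by rewrite mulrCA mulrA -rmorphM -exprS (_ : (n - i.+1).+1 = n - i)%N //; lia.
    by apply: submodM => //; apply: VW; apply: hn; rewrite inE negb_or ne.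
  - move=> i0 i0s; rewrite mulrCA; apply: submodM => //; apply: VW; apply: hs.
    by rewrite inE i0s orbT.
  exists (k' + k)%N; first by rewrite mulSn leq_add.
  apply: tower_cat tk _; suff <- : ideal_add (W i) (cyc (phi (x j ^+ (n - i.+1)) * y)) = W i.+1.
    exact: tk'.
  apply/seteqP; split; last first.
    apply: (@ideal_add_sub _ _ phi).
    - by apply: submod_add => //; apply: submod_cyc.
    - by move=> v Vv; apply: ideal_addl; [exact: cyc0|apply: VW].
    - by apply: ideal_addr; apply: (submod0 (sW i)).
  by apply: (ideal_add_sub (sW _)) => //; apply: cyc_sub.
have [k le tk] := h n (leqnn n); exists k; first by rewrite /= expnS.
by move: tk; rewrite /W subnn expr0 rmorph1 mul1r.
Qed.

End Steps.

Section LengthCompare.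
Variables (O O' A : comNzRingType) (phi : {rmorphism O -> A}) (psi : {rmorphism O' -> A}).
Variables (m : set O) (m' : set O').
Hypothesis m_inv : forall t, ~ m t -> exists t', m (1 - t' * t).
Hypothesis m'_inv : forall t, ~ m' t -> exists t', m' (1 - t' * t).
Hypothesis psi_phi : forall t', exists t, psi t' = phi t.
Hypothesis psi_m : forall t', m' t' -> exists2 t, m t & psi t' = phi t.
Hypothesis phi_psi : forall t, exists t' t1, m t1 /\ phi t = psi t' + phi t1.

Lemma submod_compare U : submod phi U -> submod psi U.
Proof. by case=> U0 UD UM; split=> // t' x; have [t ->] := psi_phi t'; apply: UM. Qed.

Lemma step_compare W y : submod phi W -> (forall t, m t -> W (phi t * y)) ->
  ideal_add W (cyc phi y) = ideal_add W (cyc psi y).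
Proof.
move=> sW my; have sW' := submod_compare sW; apply/seteqP; split.
  move=> _ [w [_ [Ww [t _ <-] ->]]]; have [t' [t1 [mt1 ->]]] := phi_psi t.
  exists (w + phi t1 * y), (psi t' * y); split; [|by exists t'|by ring].
  by apply: (submodD sW) => //; apply: my.
move=> _ [w [_ [Ww [t _ <-] ->]]]; exists w, (psi t * y); split=> //.
by have [t1 ->] := psi_phi t; exists t1.
Qed.

(** Each step is trivial or simple, and which of the two occurs does not depend on the operator
    ring, since the rings differ only by elements of [m], which kill the step. *)
Lemma tower_len V k U : submod phi V -> tower phi m V k U ->
  [/\ submod phi U, V `<=` U, len_fin psi V U & len phi V U = len psi V U].
Proof.
move=> sV tVU; elim: tVU => [|n W y tVW [sW VW fVW eVW] my].
  by split=> //; [exists 0%N; apply: len_le0|rewrite !len_eq0 //; apply: submod_compare].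
have sV' := submod_compare sV; have sW' := submod_compare sW.
have tVU : tower phi m V n.+1 (ideal_add W (cyc phi y)) by apply: TowerS.
have [sU VU lVU] := tower_fin m_inv sV tVU; have sU' := submod_compare sU.
have fVU : len_fin phi V (ideal_add W (cyc phi y)) by exists n.+1.
have WU : W `<=` ideal_add W (cyc phi y).
  by apply: ideal_addl; apply: cyc0.
have l1 : len_le phi W (ideal_add W (cyc phi y)) 1 by apply: (len_le1_step m_inv).
have l2 : len_le psi W (ideal_add W (cyc phi y)) 1.
  rewrite step_compare //; apply: (len_le1_step m'_inv) => // t' /psi_m [t mt ->].
  exact: my.
have fVU' : len_fin psi V (ideal_add W (cyc phi y)).
  by apply: (len_fin_add sV' sW' sU') => //; exists 1%N.
split=> //; rewrite (lenD sV sW sU) // (lenD sV' sW' sU') // eVW; congr addn.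
have [UW|nUW] := pselect (ideal_add W (cyc phi y) `<=` W).
  by have -> : ideal_add W (cyc phi y) = W; [exact/seteqP|rewrite !len_eq0].
have l3 (P : comNzRingType) (chi : {rmorphism P -> A}) : submod chi W ->
    submod chi (ideal_add W (cyc phi y)) -> len_le chi W (ideal_add W (cyc phi y)) 1 ->
    len chi W (ideal_add W (cyc phi y)) = 1%N.
  move=> sWc sUc lc; apply/eqP; rewrite eqn_leq (len_le_len sWc WU lc) /=.
  apply/(len_spec sWc WU); first by exists 1%N.
  exact: has_chain_ext (has_chain0 sWc).
by rewrite !l3.
Qed.

End LengthCompare.

(** * Generic rank and generic splitting *)

Section PrimeCharacteristic.
Variables (A : comNzRingType) (p : nat).
Hypothesis pA : p \in [pchar A].

Lemma pchar_gt0 : (0 < p)%N. Proof. exact: prime_gt0 (pcharf_prime pA). Qed.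

Lemma expD_p (x y : A) n : (x + y) ^+ (p ^ n) = x ^+ (p ^ n) + y ^+ (p ^ n).
Proof. by apply: exprDn_pchar; rewrite pnatX pnatE ?(pcharf_prime pA) ?pA. Qed.

Lemma expD1_p (x y : A) : (x + y) ^+ p = x ^+ p + y ^+ p.
Proof. by have := expD_p x y 1; rewrite expn1. Qed.

Lemma expB1_p (x y : A) : (x - y) ^+ p = x ^+ p - y ^+ p.
Proof. by apply/eqP; rewrite eq_sym subr_eq -expD1_p subrK. Qed.

End PrimeCharacteristic.

Section GenericRank.
Variables (B A : comNzRingType) (phi : {rmorphism B -> A}).
Hypothesis B_dom : forall a b : B, a * b = 0 -> a = 0 \/ b = 0.
Implicit Types (U V : set A) (l : seq A).

Lemma nz_mul (a b : B) : a <> 0 -> b <> 0 -> a * b <> 0.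
Proof. by move=> a0 b0 /B_dom []. Qed.

Lemma nz_exp (a : B) n : a <> 0 -> a ^+ n <> 0.
Proof.
by move=> a0; elim: n => [|n IH]; [apply/eqP/oner_neq0|rewrite exprS; apply: nz_mul].
Qed.

Lemma nz1 : (1 : B) <> 0. Proof. exact/eqP/oner_neq0. Qed.

Fixpoint span l : set A :=
  if l is x :: l' then ideal_add (cyc phi x) (span l') else [set 0].

Lemma submod_span l : submod phi (span l).
Proof.
elim: l => [|x l IH] /=; last by apply: submod_add => //; apply: submod_cyc.
by split=> [//|_ _ -> ->|t _ ->]; rewrite ?addr0 ?mulr0.
Qed.

Lemma mem_span l x : x \in l -> span l x.
Proof.
elim: l => [//|y l IH]; rewrite inE => /orP[/eqP ->|/IH h].
  by apply: ideal_addl; [exact: submod0 (submod_span l)|exact: cyc_id].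
by apply: ideal_addr => //; apply: cyc0.
Qed.

Lemma span_sub l U : submod phi U -> (forall x, x \in l -> U x) -> span l `<=` U.
Proof.
move=> sU; elim: l => [|x l IH] h /=; first by move=> _ ->; apply: submod0 sU.
apply: (ideal_add_sub sU).
  by apply: cyc_sub => //; apply: h; rewrite mem_head.
by apply: IH => y yl; apply: h; rewrite inE yl orbT.
Qed.

Lemma span_mono l l' : {subset l <= l'} -> span l `<=` span l'.
Proof. by move=> h; apply: span_sub (submod_span _) _ => x /h; apply: mem_span. Qed.

Lemma span_mid l1 l2 x a : span (l1 ++ x :: l2) a ->
  exists c, span (l1 ++ l2) (a - phi c * x).
Proof.
move=> h; have : span (x :: l1 ++ l2) a.
  by apply: span_mono h => y; rewrite !(inE, mem_cat) orbCA.
by move=> /= [_ [y [[c _ <-] sy ->]]]; exists c; rewrite addrC addKr.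
Qed.

(** The elements that fall into [U] after tensoring with the fraction field of [B]. *)
Definition gsat U : set A := [set a | exists2 b, b <> 0 & U (phi b * a)].

Lemma submod_gsat U : submod phi U -> submod phi (gsat U).
Proof.
move=> sU; split.
- by exists 1; [exact: nz1|rewrite mulr0; apply: submod0 sU].
- move=> x y [b b0 Ub] [c c0 Uc]; exists (b * c); first exact: nz_mul.
  have -> : phi (b * c) * (x + y) = phi c * (phi b * x) + phi b * (phi c * y).
    by rewrite rmorphM; ring.
  by apply: (submodD sU); apply: (submodM _ sU).
- by move=> t x [b b0 Ub]; exists b => //; rewrite mulrCA; apply: (submodM _ sU).
Qed.

Lemma sub_gsat U : U `<=` gsat U.
Proof. by move=> x Ux; exists 1; [exact: nz1|rewrite rmorph1 mul1r]. Qed.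

Lemma gsat_mono U V : U `<=` V -> gsat U `<=` gsat V.
Proof. by move=> UV x [b b0 Ub]; exists b => //; apply: UV. Qed.

Lemma gsat_gsat U : gsat (gsat U) `<=` gsat U.
Proof.
move=> x [b b0 [c c0 Uc]]; exists (c * b); first exact: nz_mul.
by rewrite rmorphM -mulrA.
Qed.

Lemma gsat_sub U V : U `<=` gsat V -> gsat U `<=` gsat V.
Proof. by move=> h; apply: (subset_trans (gsat_mono h)); apply: gsat_gsat. Qed.

Lemma gsat_unif l U : submod phi U -> (forall x, x \in l -> gsat U x) ->
  exists2 b, b <> 0 & forall a, span l a -> U (phi b * a).
Proof.
move=> sU; elim: l => [|x l IH] h.
  by exists 1; [exact: nz1|move=> _ ->; rewrite mulr0; apply: submod0 sU].
have [|b b0 hb] := IH; first by move=> y yl; apply: h; rewrite inE yl orbT.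
have [|c c0 hc] := h x; first by rewrite mem_head.
exists (b * c); first exact: nz_mul.
move=> _ [_ [y [[t _ <-] /hb Uy ->]]].
have -> : phi (b * c) * (phi t * x + y) = phi (b * t) * (phi c * x) + phi c * (phi b * y).
  by rewrite !rmorphM; ring.
by apply: (submodD sU); apply: (submodM _ sU).
Qed.

Variable e : seq A.
Hypothesis span_e : forall a, span e a.

Definition gen_by U n : Prop := exists2 l, size l = n & U `<=` gsat (span l).

Lemma gen_by_ex U : exists n, `[< gen_by U n >].
Proof. by exists (size e); apply/asboolP; exists e => // a _; apply: sub_gsat. Qed.

(** For a submodule this is the dimension of [U] over the fraction field of [B]; the generators may
    lie outside [U]. *)
Definition rk U : nat := ex_minn (gen_by_ex U).

Lemma rk_gen U : exists2 l, size l = rk U & U `<=` gsat (span l).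
Proof. by rewrite /rk; case: ex_minnP => n /asboolP. Qed.

Lemma rk_min U l : U `<=` gsat (span l) -> (rk U <= size l)%N.
Proof. by rewrite /rk; case: ex_minnP => n _ h hl; apply: h; apply/asboolP; exists l. Qed.

(** Steinitz exchange: a relation for a multiple of [w] involves some entry of [l2] with a nonzero
    coefficient, and that entry is traded for [w]. The list [l1] holds the vectors exchanged
    before. *)
Lemma exchange l1 l2 w : gsat (span (l1 ++ l2)) w -> ~ gsat (span l1) w ->
  exists2 l, (size l).+1 = size l2 & span (l1 ++ l2) `<=` gsat (span (w :: l1 ++ l)).
Proof.
move=> [b b0 hb] nw; elim: l2 hb => [|x l2 IH] hb.
  by case: nw; exists b => //; rewrite cats0 in hb.
have [c hc] := span_mid hb.
have [c0|/eqP c0] := eqVneq c 0.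
  move: hc; rewrite c0 rmorph0 mul0r subr0 => /IH [l sl hl].
  exists (x :: l); first by rewrite /= sl.
  have mono : gsat (span (w :: l1 ++ l)) `<=` gsat (span (w :: l1 ++ x :: l)).
    apply: gsat_mono; apply: span_mono => y; rewrite !(inE, mem_cat).
    by case/or3P=> ->; rewrite ?orbT.
  apply: span_sub; first by apply: submod_gsat; apply: submod_span.
  move=> y; rewrite mem_cat inE => /or3P[yl|/eqP ->|yl].
  - by apply: mono; apply: hl; apply: mem_span; rewrite mem_cat yl.
  - by apply: sub_gsat; apply: mem_span; rewrite inE mem_cat mem_head !orbT.
  - by apply: mono; apply: hl; apply: mem_span; rewrite mem_cat yl orbT.
exists l2 => //.
apply: span_sub; first by apply: submod_gsat; apply: submod_span.
move=> y; rewrite mem_cat inE => /or3P[yl|/eqP ->|yl].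
- by apply: sub_gsat; apply: mem_span; rewrite inE mem_cat yl orbT.
- exists c => //.
  have -> : phi c * x = phi b * w - (phi b * w - phi c * x) by ring.
  apply: (submodB (submod_span _)).
    by apply: (submodM _ (submod_span _)); apply: mem_span; rewrite mem_head.
  by apply: span_mono hc => y'; rewrite inE => ->; rewrite orbT.
- by apply: sub_gsat; apply: mem_span; rewrite inE mem_cat yl !orbT.
Qed.

(** Nested spaces of equal dimension coincide. Generators of [U] are exchanged one at a time for
    elements of [U']; the inequality of ranks ensures that [U'] still has an element outside the
    span of those already inserted. *)
Lemma rk_eq_gsat U' U : submod phi U' -> U' `<=` U -> (rk U <= rk U')%N -> U `<=` gsat U'.
Proof.
move=> sU' U'U le.
suff h i : (i <= rk U)%N -> exists l1 l2, [/\ (forall x, x \in l1 -> U' x), size l1 = i,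
    size (l1 ++ l2) = rk U & U `<=` gsat (span (l1 ++ l2))].
  have [l1 [l2 [h1 s1 s2 h2]]] := h _ (leqnn _).
  have l20 : l2 = [::].
    apply/eqP; rewrite -size_eq0; move/eqP: s2.
    by rewrite size_cat s1 -[X in _ == X]addn0 eqn_add2l.
  move: h2; rewrite l20 cats0 => h2; apply: (subset_trans h2).
  by apply: gsat_mono; apply: span_sub.
elim: i => [_|i IH lt].
  by have [l sl hl] := rk_gen U; exists [::], l; split.
have [l1 [l2 [h1 s1 s2 h2]]] := IH (ltnW lt).
have /existsNP[w /not_implyP[U'w nw]] : ~ (U' `<=` gsat (span l1)).
  by move=> /rk_min; rewrite s1 => /(leq_trans le)/(leq_trans lt); rewrite ltnn.
have [l sl hl] := exchange (h2 _ (U'U _ U'w)) nw.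
exists (w :: l1), l; split.
- by move=> x; rewrite inE => /orP[/eqP ->//|/h1].
- by rewrite /= s1.
- by rewrite -s2 /= !size_cat -sl addnS.
- by apply: (subset_trans h2); apply: gsat_sub.
Qed.

Lemma rk_stable (U : nat -> set A) : (forall n, U n.+1 `<=` U n) ->
  exists n, (rk (U n) <= rk (U n.+1))%N.
Proof.
move=> hU.
have ex : exists v, `[< exists n, rk (U n) = v >] by exists (rk (U 0%N)); apply/asboolP; exists 0%N.
have [v /asboolP[n vE] minv] := ex_minnP ex.
by exists n; rewrite vE; apply: minv; apply/asboolP; exists n.+1.
Qed.

(** Some coefficient of [a] along [l] is nonzero, and the torsion relation then makes that generator
    generically redundant. *)
Lemma span_shrink l a c : span l a -> a <> 0 -> c <> 0 -> phi c * a = 0 ->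
  exists2 l', (size l').+1 = size l & span l `<=` gsat (span l').
Proof.
move=> + a0 c0; elim: l a a0 => [|x l IH] a a0 /=; first by move=> /a0.
move=> [_ [y [[t _ <-] ly aE]]] ca.
have [t0|/eqP t0] := eqVneq t 0.
  have ay : a = y by rewrite aE t0 rmorph0 mul0r add0r.
  have [|l' sl hl] := IH a a0 _ ca; first by rewrite ay.
  exists (x :: l'); first by rewrite /= sl.
  apply: ideal_add_sub; first by apply: submod_gsat; apply: submod_span.
    apply: cyc_sub; first by apply: submod_gsat; apply: submod_span.
    by apply: sub_gsat; apply: mem_span; rewrite mem_head.
  apply: (subset_trans hl); apply: gsat_mono; apply: span_mono => z.
  by rewrite inE => ->; rewrite orbT.
exists l => //; apply: ideal_add_sub; first by apply: submod_gsat; apply: submod_span.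
  apply: cyc_sub; first by apply: submod_gsat; apply: submod_span.
  exists (c * t); first exact: nz_mul.
  have -> : phi (c * t) * x = phi (- c) * y.
    by apply/eqP; rewrite -subr_eq0 -ca aE rmorphM rmorphN; apply/eqP; ring.
  exact: (submodM _ (submod_span _)).
exact: sub_gsat.
Qed.

(** Some [b] maps all of [A] into the span of a generic generating list of minimal size. This span
    has no nonzero torsion, since otherwise the list could be shortened. *)
Lemma torsion_unif : exists2 b, b <> 0 &
  forall c z, c <> 0 -> phi c * z = 0 -> phi b * z = 0.
Proof.
have [l sl hl] := rk_gen setT.
have [|b b0 hb] := @gsat_unif e (span l) (submod_span l); first by move=> x _; apply: hl.
exists b => // c z c0 cz; have bz := hb z (span_e z).
have [//|nz] := pselect (phi b * z = 0).
have [|l' sl' hl'] := span_shrink bz nz c0; first by rewrite mulrCA cz mulr0.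
have : (rk setT <= size l')%N by apply: rk_min; apply: (subset_trans hl); apply: gsat_sub.
by rewrite -sl -sl' ltnn.
Qed.

Variable p : nat.
Hypotheses (pA : p \in [pchar A]) (pB : p \in [pchar B]).

(** For [q = p ^ n] and [l = e] this is the subring generated by the image of [B] and all [q]-th
    powers, because the Frobenius is additive. *)
Definition pspan q l := span [seq x ^+ q | x <- l].

Lemma span_frob l n a : span l a -> pspan (p ^ n) l (a ^+ (p ^ n)).
Proof.
elim: l a => [|x l IH] a /=; first by move->; rewrite /pspan /= expr0n expn_eq0 -leqn0 leqNgt (pchar_gt0 pA).
move=> [_ [y [[t _ <-] ly ->]]]; rewrite (expD_p pA) exprMn -rmorphXn.
exists (phi (t ^+ (p ^ n)) * x ^+ (p ^ n)), (y ^+ (p ^ n)); split=> //; first by exists (t ^+ (p ^ n)).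
exact: IH.
Qed.

Lemma span_frob1 l a : span l a -> pspan p l (a ^+ p).
Proof. by move/(@span_frob _ 1); rewrite expn1. Qed.

Lemma pspan_mul n a b : pspan (p ^ n) e a -> pspan (p ^ n) e b -> pspan (p ^ n) e (a * b).
Proof.
move=> ha hb; have sb : submod phi [set x | pspan (p ^ n) e (x * b)].
  split; first by rewrite /= mul0r; apply: submod0 (submod_span _).
    by move=> x y /= hx hy; rewrite mulrDl; apply: (submodD (submod_span _)).
  by move=> t x /= hx; rewrite -mulrA; apply: (submodM _ (submod_span _)).
apply: (span_sub sb) ha => _ /mapP[x _ ->] /=.
have sx : submod phi [set y | pspan (p ^ n) e (x ^+ (p ^ n) * y)].
  split; first by rewrite /= mulr0; apply: submod0 (submod_span _).
    by move=> y z /= hy hz; rewrite mulrDr; apply: (submodD (submod_span _)).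
  by move=> t y /= hy; rewrite mulrCA; apply: (submodM _ (submod_span _)).
apply: (span_sub sx) hb => _ /mapP[y _ ->] /=.
by rewrite -exprMn; apply: span_frob.
Qed.

Lemma pspan_exp n a : pspan (p ^ n) e (a ^+ (p ^ n)).
Proof. exact: span_frob. Qed.

Lemma pspan_next n : pspan (p ^ n.+1) e `<=` pspan (p ^ n) e.
Proof.
apply: (span_sub (submod_span _)) => _ /mapP[x _ ->].
by rewrite expnS exprM; apply: pspan_exp.
Qed.

End GenericRank.

(** * The stable ring of powers: generic reducedness, splittings and a Frobenius operator *)

Section GenericEtale.
Variables (B A : comNzRingType) (phi : {rmorphism B -> A}).
Hypothesis B_dom : forall a b : B, a * b = 0 -> a = 0 \/ b = 0.
Variable e : seq A.
Hypothesis span_e : forall a, span phi e a.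
Variable p : nat.
Hypothesis pA : p \in [pchar A].
Variable n : nat.
Local Notation D := (pspan phi (p ^ n) e).
Local Notation D' := (pspan phi (p ^ n.+1) e).
Hypothesis rkD : (rk span_e D <= rk span_e D')%N.
Implicit Types (U V N : set A).

Local Lemma sD : submod phi D. Proof. exact: submod_span. Qed.
Local Lemma D_mul a b : D a -> D b -> D (a * b). Proof. exact: (pspan_mul span_e pA). Qed.
Local Lemma D_pow a : D (a ^+ (p ^ n)). Proof. exact: (pspan_exp span_e pA). Qed.
Local Lemma D1 : D 1. Proof. by have := D_pow 1; rewrite expr1n. Qed.
Local Lemma D_phi c : D (phi c). Proof. by rewrite -[phi c]mulr1; apply: (submodM _ sD D1). Qed.
Local Lemma D_exp a k : D a -> D (a ^+ k).
Proof. by move=> Da; elim: k => [|k IH]; [exact: D1|rewrite exprS; apply: D_mul]. Qed.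

Lemma D'_gen V : submod phi V -> (forall d, D d -> V (d ^+ p)) -> D' `<=` V.
Proof.
move=> sV h; apply: (span_sub sV) => _ /mapP[x _ ->].
by rewrite expnSr exprM; apply: h; apply: D_pow.
Qed.

Lemma D'D : exists2 b, b <> 0 & forall d, D d -> D' (phi b * d).
Proof.
have gD : D `<=` gsat phi D'.
  apply: (rk_eq_gsat B_dom (span_e := span_e)) rkD; first exact: submod_span.
  exact: (pspan_next span_e pA).
have [|b b0 hb] := @gsat_unif _ _ phi B_dom [seq x ^+ (p ^ n) | x <- e] D' (submod_span _ _).
  by move=> x xe; apply: gD; apply: mem_span.
by exists b.
Qed.

(** Were [z] generically nonzero, it could be exchanged into a minimal generic generating list of
    [D]. The [p]-th powers of that list generically span [D'], and the one of [z] vanishes, so [D']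
    would have smaller rank than [D]. *)
Lemma D_red1 z : D z -> z ^+ p = 0 -> exists2 b, b <> 0 & phi b * z = 0.
Proof.
move=> Dz zp; apply: contrapT => nz.
have [l sl hl] := rk_gen span_e D.
have [||l' sl' hl'] := @exchange _ _ phi B_dom [::] l z; first exact: hl.
  by move=> [b b0 bz]; apply: nz; exists b.
suff : (rk span_e D' <= size l')%N by move=> /(leq_trans rkD); rewrite -sl -sl' ltnn.
rewrite -(size_map (fun x => x ^+ p) l'); apply: rk_min.
apply: D'_gen; first by apply: submod_gsat => //; apply: submod_span.
move=> d Dd; have [b b0] := gsat_sub B_dom hl' (hl _ Dd).
move=> [_ [y [[c _ <-] sy bd]]]; exists (b ^+ p); first exact: nz_exp.
rewrite rmorphXn -exprMn bd (expD1_p pA) exprMn zp mulr0 add0r.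
exact: (span_frob1 pA sy).
Qed.

Local Definition bt_spec := torsion_unif B_dom span_e.
Local Definition bt := sval (cid2 bt_spec).
Local Lemma bt0 : bt <> 0. Proof. by rewrite /bt; case: cid2. Qed.
Local Lemma btP c z : c <> 0 -> phi c * z = 0 -> phi bt * z = 0.
Proof. by rewrite /bt; case: cid2 => b b0 h; apply: h. Qed.

(** After raising the exponent to a power of [p], one Frobenius is removed at a time: if [bt] kills
    [z ^+ p], then [bt * z] has vanishing [p]-th power, hence is torsion. *)
Lemma D_red z k : D z -> z ^+ k = 0 -> phi bt * z = 0.
Proof.
move=> Dz zk; have : z ^+ (p ^ k) = 0.
  have kp : (k <= p ^ k)%N by apply/ltnW/ltn_expl/prime_gt1/(pcharf_prime pA).
  by rewrite -(subnK kp) exprD zk mulr0.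
elim: k z Dz {zk} => [|k IH] z Dz.
  by rewrite expn0 expr1 => ->; rewrite mulr0.
rewrite expnS exprM => /IH h; have {}h := h (D_exp _ Dz).
have [||b b0 hb] := @D_red1 (phi bt * z); first by apply: (submodM _ sD).
  by rewrite exprMn -(prednK (pchar_gt0 pA)) exprSr -mulrA prednK ?(pchar_gt0 pA) // h mulr0.
by apply: (@btP (b * bt)); [apply: (nz_mul B_dom) => //; exact: bt0|rewrite rmorphM -mulrA].
Qed.

(** Von Neumann regularity up to a scalar. The ranks of the ideals [z ^+ j * D] stabilize, so
    [b * z ^+ j = z ^+ j.+1 * w] for some [j]; then [z * (b - z * w)] is nilpotent, and [bt] kills
    it. *)
Lemma D_regular z : D z -> exists b w, [/\ b <> 0, D w & phi b * z = z ^+ 2 * w].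
Proof.
move=> Dz; pose U j := [set x | exists2 d, D d & x = z ^+ j * d].
have sU j : submod phi (U j).
  split.
  - by exists 0; [exact: submod0 sD|rewrite mulr0].
  - move=> _ _ [d Dd ->] [d' Dd' ->]; exists (d + d'); first exact: (submodD sD).
    by rewrite mulrDr.
  - by move=> t _ [d Dd ->]; exists (phi t * d); [exact: (submodM _ sD)|rewrite mulrCA].
have UU j : U j.+1 `<=` U j.
  move=> _ [d Dd ->]; exists (z * d); first exact: D_mul.
  by rewrite exprSr mulrA.
have [j le] := rk_stable span_e UU.
have : gsat phi (U j.+1) (z ^+ j).
  apply: (rk_eq_gsat B_dom (sU _) (UU _) le); exists 1; first exact: D1.
  by rewrite mulr1.
move=> [b b0 [w Dw bw]].
have y0 : (z * (phi b - z * w)) ^+ j.+1 = 0.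
  have : z ^+ j * (phi b - z * w) = 0.
    by rewrite mulrBr mulrC bw mulrA exprSr subrr.
  by move=> h; rewrite exprMn exprSr [_ ^+ j.+1]exprS [z ^+ j * z]mulrC
    -mulrA [X in _ * X]mulrA h mul0r mulr0.
have /D_red h : D (z * (phi b - z * w)).
  by apply: D_mul => //; apply: (submodB sD); [exact: D_phi|exact: D_mul].
exists (bt * b), (phi bt * w); split.
- by apply: (nz_mul B_dom) => //; exact: bt0.
- exact: (submodM _ sD).
apply/eqP; rewrite -subr_eq0 -(h _ y0) rmorphM; apply/eqP; ring.
Qed.

Definition Dmod U : Prop :=
  [/\ U 0, (forall x y, U x -> U y -> U (x + y)) & (forall d x, D d -> U x -> U (d * x))].

Lemma Dmod_submod U : Dmod U -> submod phi U.
Proof. by move=> [U0 UD UM]; split=> // t x Ux; apply: UM => //; apply: D_phi. Qed.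

(** Generically [f / b] is the idempotent that generates [I]. It is found by making the rank of
    [(b - f) * I] minimal: an element [z] of it that is not torsion would allow [f] to be enlarged
    by the idempotent of [z]. *)
Lemma Dmod_idempotent (I : set A) : Dmod I -> I `<=` D ->
  exists b f, [/\ b <> 0, I f & forall a, I a -> (phi b - f) * a = 0].
Proof.
move=> dI ID; have sI := Dmod_submod dI; have [I0 IA IM] := dI.
pose U b f := [set x | exists2 a, I a & x = (phi b - f) * a].
have sU b f : submod phi (U b f).
  split.
  - by exists 0 => //; rewrite mulr0.
  - by move=> _ _ [d Id ->] [d' Id' ->]; exists (d + d'); [exact: IA|rewrite mulrDr].
  - by move=> t _ [d Id ->]; exists (phi t * d); [exact: (submodM _ sI)|rewrite mulrCA].
have ex : exists v, `[< exists b f, [/\ b <> 0, I f & rk span_e (U b f) = v] >].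
  exists (rk span_e (U 1 0)); apply/asboolP; exists 1, 0; split=> //; exact: nz1.
have [v /asboolP[b [f [b0 If vE]]] minv] := ex_minnP ex.
suff tors a : I a -> phi bt * ((phi b - f) * a) = 0.
  exists (bt * b), (phi bt * f); split.
  - by apply: (nz_mul B_dom) => //; exact: bt0.
  - exact: (submodM _ sI).
  - by move=> a Ia; rewrite rmorphM -mulrBr -mulrA tors.
move=> Ia; apply: contrapT => nt.
set z := (phi b - f) * a in nt.
have Df := ID _ If.
have Dbf : D (phi b - f) by apply: (submodB sD); [exact: D_phi|].
have Iz : I z by apply: IM.
have [b' [w [b'0 Dw zE]]] := D_regular (ID _ Iz).
(* Chosen so that [b * b' - f'] is the product of the complements [b' - z * w] and [b - f]. *)
pose f' := phi b' * f + z * w * (phi b - f).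
have ff : phi (b * b') - f' = (phi b' - z * w) * (phi b - f).
  by rewrite /f' rmorphM; ring.
have If' : I f'.
  apply: IA; first exact: (submodM _ sI).
  by rewrite -mulrA mulrC; apply: IM => //; apply: D_mul.
have UU : U (b * b') f' `<=` U b f.
  move=> _ [c Ic ->]; exists ((phi b' - z * w) * c).
    apply: IM => //; apply: (submodB sD); [exact: D_phi|apply: D_mul => //].
    exact: ID.
  by rewrite ff; ring.
have le : (rk span_e (U b f) <= rk span_e (U (b * b')%R f'))%N.
  by rewrite vE; apply: minv; apply/asboolP; exists (b * b'), f'; split=> //; apply: (nz_mul B_dom).
have [c c0 [u Iu cz]] : gsat phi (U (b * b') f') z.
  by apply: (rk_eq_gsat B_dom (sU _ _) UU le); exists a.
have : (phi c * z) ^+ 2 = 0.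
  rewrite expr2 {1}cz ff.
  have -> : (phi b' - z * w) * (phi b - f) * u * (phi c * z) =
    (phi b' * z - z ^+ 2 * w) * ((phi b - f) * u * phi c) by ring.
  by rewrite zE subrr mul0r.
move/D_red; rewrite mulrA -rmorphM => h; apply: nt.
apply: (@btP (bt * c)); first by apply: (nz_mul B_dom) => //; exact: bt0.
by apply: h; apply: D_mul => //; [exact: D_phi|exact: ID].
Qed.

Definition Dadd N x : set A := [set m | exists2 d, D d & N (m - d * x)].

Lemma Dmod_add N x : Dmod N -> Dmod (Dadd N x).
Proof.
move=> [N0 NA NM]; split.
- by exists 0; [exact: submod0 sD|rewrite mul0r subrr].
- move=> y z [d Dd Ny] [d' Dd' Nz]; exists (d + d'); first exact: (submodD sD).
  have -> : y + z - (d + d') * x = (y - d * x) + (z - d' * x) by ring.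
  by apply: NA.
- move=> t y Dt [d Dd Ny]; exists (t * d); first exact: D_mul.
  by rewrite -mulrA -mulrBr; apply: NM.
Qed.

Lemma Dadd_sub N x : N `<=` Dadd N x.
Proof. by move=> y Ny; exists 0; [exact: submod0 sD|rewrite mul0r subr0]. Qed.

Lemma Dadd_id N x : Dmod N -> Dadd N x x.
Proof. by move=> [N0 _ _]; exists 1; [exact: D1|rewrite mul1r subrr]. Qed.

(* Generically a D-module is projective: the coordinate along [x] splits off [N]. *)
Lemma Dadd_coord N x : Dmod N -> exists b f (P : A -> A),
  [/\ b <> 0, D f, N (f * x) &
    forall m d, D d -> N (m - d * x) -> P m = (phi b - f) * d].
Proof.
move=> dN; have [N0 NA NM] := dN; have sN := Dmod_submod dN.
have [|y [Dy _]|b [f [b0 [Df Nf] hf]]] := @Dmod_idempotent [set d | D d /\ N (d * x)].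
- split.
  + by split; [exact: submod0 sD|rewrite mul0r].
  + move=> y z [Dy Ny] [Dz Nz]; split; first exact: (submodD sD).
    by rewrite mulrDl; apply: NA.
  + by move=> d y Dd [Dy Ny]; split; [exact: D_mul|rewrite -mulrA; apply: NM].
- by [].
(* Two coordinates of the same [m] differ by an element annihilating [x] modulo [N], and [phi b - f]
   kills these, so the arbitrary choice is harmless. *)
exists b, f, (fun m => (phi b - f) * xget 0 [set d | D d /\ N (m - d * x)]); split=> //.
move=> m d Dd Nd; case: xgetP => [d' _ [Dd' Nd']|/(_ d)[] //].
apply/eqP; rewrite -subr_eq0 -mulrBr; apply/eqP; apply: hf; split.
  exact: (submodB sD).
have -> : (d' - d) * x = (m - d * x) - (m - d' * x) by ring.
exact: (submodB sN).
Qed.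

Fixpoint Daddl N (l : seq A) : set A := if l is x :: l' then Dadd (Daddl N l') x else N.

Lemma Dmod_addl N l : Dmod N -> Dmod (Daddl N l).
Proof. by move=> dN; elim: l => //= x l IH; apply: Dmod_add. Qed.

Lemma Daddl_span N l : Dmod N -> span phi l `<=` Daddl N l.
Proof.
move=> dN; elim: l => [|x l IH] /=; first by move=> _ ->; case: dN.
have dl := Dmod_addl l dN; have sl := Dmod_submod (Dmod_add x dl).
apply: (ideal_add_sub sl); first by apply: (cyc_sub sl); apply: Dadd_id.
by apply: (subset_trans IH); apply: Dadd_sub.
Qed.

Definition Dlin_on U (s : A -> A) : Prop :=
  (forall x y, U x -> U y -> s (x + y) = s x + s y) /\
  (forall d x, D d -> U x -> s (d * x) = d * s x).

(** Generators of [A] are adjoined to [N] one at a time. A retraction is extended across a new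
    generator [x] by first scaling [m] by [c] and removing its coordinate along [x], which lands in
    the previous module. *)
Lemma Dretract N : Dmod N -> exists b (r : A -> A),
  [/\ b <> 0, Dlin_on setT r, (forall m, N (r m)) & (forall u, N u -> r u = phi b * u)].
Proof.
move=> dN; suff [b [r [b0 [rD rM] rN rE]]] : exists b (r : A -> A),
    [/\ b <> 0, Dlin_on (Daddl N e) r, (forall m, Daddl N e m -> N (r m)) &
      (forall u, N u -> r u = phi b * u)].
  have eT m : Daddl N e m by apply: Daddl_span.
  exists b, r; split=> //; first by split=> [x y _ _|d x Dd _]; [apply: rD|apply: rM].
  by move=> m; apply: rN.
elim: e => [|x l [b [r [b0 [rD rM] rN rE]]]] /=.
  exists 1, id; split=> //; first exact: nz1.
  by move=> u _; rewrite rmorph1 mul1r.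
have dl := Dmod_addl l dN; have [l0 lA lM] := dl; have sl := Dmod_submod dl.
have [c [f [P [c0 Df lf hP]]]] := Dadd_coord x dl.
have PM m d : D d -> Daddl N l (m - d * x) -> phi c * m - P m * x =
    phi c * (m - d * x) + d * (f * x).
  by move=> Dd h; rewrite (hP _ _ Dd h); ring.
have lP m d : D d -> Daddl N l (m - d * x) -> Daddl N l (phi c * m - P m * x).
  move=> Dd h; rewrite (PM _ _ Dd h); apply: lA; first exact: (submodM _ sl).
  exact: lM.
exists (c * b), (fun m => r (phi c * m - P m * x)); split.
- exact: (nz_mul B_dom).
- split.
    move=> y z [d Dd hy] [d' Dd' hz].
    have hyz : Daddl N l (y + z - (d + d') * x).
      have -> : y + z - (d + d') * x = (y - d * x) + (z - d' * x) by ring.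
      by apply: lA.
    rewrite -rD; [|exact: lP hy|exact: lP hz]; congr r.
    by rewrite (hP _ _ Dd hy) (hP _ _ Dd' hz) (hP _ _ (submodD sD Dd Dd') hyz); ring.
  move=> d y Dd [d' Dd' hy].
  have hdy : Daddl N l (d * y - (d * d') * x) by rewrite -mulrA -mulrBr; apply: lM.
  rewrite -rM //; last exact: lP hy.
  by congr r; rewrite (hP _ _ Dd' hy) (hP _ _ (D_mul Dd Dd') hdy); ring.
- by move=> m [d Dd h]; apply: rN; apply: lP h.
- move=> u Nu.
  have lu : Daddl N l u.
    by elim: l {x dl l0 lA lM sl c f P c0 Df lf hP PM lP rD rM rN rE} => //= y l IH; apply: Dadd_sub.
  have h0 : Daddl N l (u - 0 * x) by rewrite mul0r subr0.
  rewrite (hP _ _ (submod0 sD) h0) mulr0 mul0r subr0 rM //; last exact: D_phi.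
  by rewrite rE // rmorphM mulrA.
Qed.

(** [P] imitates the map that raises coordinates in a basis to their [p]-th powers. The span of its
    image generically contains [d ^+ p * x] for every generator [x] and every [d] in [D], hence [D']
    times [x]; [D'D] then gives [D] times [x]. *)
Lemma Dfrobenius : exists b (P : A -> A),
  [/\ b <> 0, {morph P : x y / x + y}, (forall d x, D d -> P (d * x) = d ^+ p * P x) &
    forall V, submod phi V -> (forall m, V (P m)) -> forall m, V (phi b * m)].
Proof.
have dN : Dmod [set 0].
  by split=> [//|_ _ -> ->|d _ _ ->]; rewrite ?addr0 ?mulr0.
suff /(_ e)[b [P [b0 PA PM PV]]] : forall l, exists b (P : A -> A),
    let M := Daddl [set 0] l in
    [/\ b <> 0, (forall x y, M x -> M y -> P (x + y) = P x + P y),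
     (forall d x, D d -> M x -> P (d * x) = d ^+ p * P x) &
     forall V, submod phi V -> (forall m, M m -> V (P m)) -> forall m, M m -> V (phi b * m)].
  have eT m : Daddl [set 0] e m by apply: Daddl_span.
  exists b, P; split=> //.
  - by move=> x y; apply: PA.
  - by move=> d x Dd; apply: PM.
  - by move=> V sV h m; apply: PV.
have [b1 b10 hb1] := D'D.
elim=> [|x l /= [b [P [b0 PA PM PV]]]] /=.
  exists 1, id; split=> //; first exact: nz1.
    by move=> d _ _ ->; rewrite !mulr0.
  by move=> V [V0 _ _] _ _ ->; rewrite mulr0.
have dl := Dmod_addl l dN; have [l0 lA lM] := dl; have sl := Dmod_submod dl.
have [c [f [Q [c0 Df lf hQ]]]] := Dadd_coord x dl.
have QM m d : D d -> Daddl [set 0] l (m - d * x) -> phi c * m - Q m * x =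
    phi c * (m - d * x) + d * (f * x).
  by move=> Dd h; rewrite (hQ _ _ Dd h); ring.
have lQ m d : D d -> Daddl [set 0] l (m - d * x) -> Daddl [set 0] l (phi c * m - Q m * x).
  move=> Dd h; rewrite (QM _ _ Dd h); apply: lA; first exact: (submodM _ sl).
  exact: lM.
(* The factor [c ^+ p * b] reaches the previous module, a further [c ^+ p] the multiples of [x] by
   [p]-th powers, and [b1] passes from [D'] to [D]. *)
pose k := c ^+ p * c ^+ p * b * b1.
exists k, (fun m => P (phi c * m - Q m * x) + Q m ^+ p * x); split.
- have cp := nz_exp B_dom (n := p) c0.
  exact: (nz_mul B_dom (nz_mul B_dom (nz_mul B_dom cp cp) b0) b10).
- move=> y z [d Dd hy] [d' Dd' hz].
  have hyz : Daddl [set 0] l (y + z - (d + d') * x).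
    have -> : y + z - (d + d') * x = (y - d * x) + (z - d' * x) by ring.
    by apply: lA.
  have QD : Q (y + z) = Q y + Q z.
    by rewrite (hQ _ _ Dd hy) (hQ _ _ Dd' hz) (hQ _ _ (submodD sD Dd Dd') hyz) mulrDr.
  rewrite QD (expD1_p pA).
  have -> : phi c * (y + z) - (Q y + Q z) * x =
    (phi c * y - Q y * x) + (phi c * z - Q z * x) by ring.
  by rewrite PA; [ring|exact: lQ hy|exact: lQ hz].
- move=> d y Dd [d' Dd' hy].
  have hdy : Daddl [set 0] l (d * y - (d * d') * x) by rewrite -mulrA -mulrBr; apply: lM.
  have QD : Q (d * y) = d * Q y.
    by rewrite (hQ _ _ Dd' hy) (hQ _ _ (D_mul Dd Dd') hdy) mulrCA.
  rewrite QD exprMn.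
  have -> : phi c * (d * y) - d * Q y * x = d * (phi c * y - Q y * x) by ring.
  by rewrite PM; [ring| |exact: lQ hy].
move=> V sV hV.
have hl u : Daddl [set 0] l u -> V (phi (c ^+ p * b) * u).
  move=> lu; pose V' := [set v | V (phi (c ^+ p) * v)].
  have sV' : submod phi V'.
    split; first by rewrite /V' /= mulr0; apply: submod0 sV.
      by move=> y z; rewrite /V' /= => Vy Vz; rewrite mulrDr; apply: (submodD sV).
    by move=> t y; rewrite /V' /= => Vy; rewrite mulrCA; apply: (submodM _ sV).
  have := PV V' sV' _ u lu; rewrite /V' /= mulrA -rmorphM; apply=> {}u {}lu.
  have h0 : Daddl [set 0] l (u - 0 * x) by rewrite mul0r subr0.
  have := hV u (Dadd_sub x lu).
  rewrite (hQ _ _ (submod0 sD) h0) mulr0 expr0n (gtn_eqF (pchar_gt0 pA)) !mul0r addr0 subr0.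
  by rewrite PM //; [rewrite rmorphXn|exact: D_phi].
have hx d : D d -> V (phi (c ^+ p * c ^+ p * b) * (d ^+ p * x)).
  move=> Dd; have h0 : Daddl [set 0] l (d * x - d * x) by rewrite subrr.
  have hdx : Dadd (Daddl [set 0] l) x (d * x) by exists d.
  have := hV _ hdx; rewrite (QM _ _ Dd h0) subrr mulr0 add0r (hQ _ _ Dd h0) => V1.
  have V2 : V (phi (c ^+ p) * P (d * (f * x))).
    have lu : Daddl [set 0] l (d * (f * x)) by apply: lM.
    have h1 : Daddl [set 0] l (d * (f * x) - 0 * x) by rewrite mul0r subr0.
    have := hV _ (Dadd_sub x lu).
    rewrite (hQ _ _ (submod0 sD) h1) mulr0 expr0n (gtn_eqF (pchar_gt0 pA)) !mul0r addr0 subr0.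
    by rewrite PM //; [rewrite rmorphXn|exact: D_phi].
  have V3 : V (phi (c ^+ p * b) * (d ^+ p * f ^+ p.-1 * (f * x))).
    by apply: hl; apply: lM => //; apply: D_mul; exact: D_exp.
  (* The extra [c ^+ p] is split by [c ^+ p = (c - f) ^+ p + f ^+ p]; the last term falls into the
     previous module since [f * x] does. *)
  have -> : phi (c ^+ p * c ^+ p * b) * (d ^+ p * x) =
      phi (c ^+ p * b) * (P (d * (f * x)) + ((phi c - f) * d) ^+ p * x)
      - phi b * (phi (c ^+ p) * P (d * (f * x)))
      + phi (c ^+ p * b) * (d ^+ p * f ^+ p.-1 * (f * x)).
    rewrite exprMn (expB1_p pA) -[in (f ^+ p)](prednK (pchar_gt0 pA)) exprS.
    by rewrite !rmorphM !rmorphXn; ring.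
  apply: (submodD sV) => //.
  by apply: (submodB sV); apply: (submodM _ sV).
move=> m [d Dd lu].
have Wd : V (phi (c ^+ p * c ^+ p * b) * ((phi b1 * d) * x)).
  pose W := [set t | V (phi (c ^+ p * c ^+ p * b) * (t * x))].
  have sW : submod phi W.
    split; first by rewrite /W /= mul0r mulr0; apply: submod0 sV.
      by move=> y z; rewrite /W /= => Vy Vz; rewrite mulrDl mulrDr; apply: (submodD sV).
    by move=> t y; rewrite /W /= => Vy; rewrite -[phi t * y * x]mulrA mulrCA; apply: (submodM _ sV).
  by apply: (D'_gen sW hx); apply: hb1.
have -> : phi k * m = phi (c ^+ p * b1) * (phi (c ^+ p * b) * (m - d * x)) +
    phi (c ^+ p * c ^+ p * b) * ((phi b1 * d) * x).
  by rewrite /k !rmorphM; ring.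
by apply: (submodD sV) => //; apply: (submodM _ sV); apply: hl.
Qed.

End GenericEtale.

Section GenericMaps.
Variables (B A : comNzRingType) (phi : {rmorphism B -> A}) (p q : nat).

(** Stability under [B] and under [q]-th powers is stability under the ring that they span, so this
    form hides the ring [D] from what follows. *)
Definition generic_splitting : Prop := forall W, submod phi W ->
  (forall a x, W x -> W (a ^+ q * x)) ->
  exists b (r : A -> A), [/\ b <> 0, {morph r : x y / x + y},
    (forall c y, r (phi c * y) = phi c * r y) /\
    (forall a y, r (a ^+ q * y) = a ^+ q * r y),
    (forall y, W (r y)) & (forall u, W u -> r u = phi b * u)].

(** The last clause says that [phi b] carries everything into the [B]-span of the image of [P],
    which is only spanned by a subset since [P] is not linear. *)
Definition generic_frobenius : Prop := exists b (P : A -> A),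
  [/\ b <> 0, {morph P : x y / x + y},
    (forall c y, P (phi c * y) = phi (c ^+ p) * P y),
    (forall a y, P (a ^+ q * y) = (a ^+ p) ^+ q * P y) &
    forall V, submod phi V -> (forall y, V (P y)) -> forall y, V (phi b * y)].

End GenericMaps.

Section GenericStructure.
Variables (B A : comNzRingType) (phi : {rmorphism B -> A}).
Hypothesis B_dom : forall a b : B, a * b = 0 -> a = 0 \/ b = 0.
Variable e : seq A.
Hypothesis span_e : forall a, span phi e a.
Variable p : nat.
Hypothesis pA : p \in [pchar A].

Lemma generic_structure : exists2 n, generic_splitting phi (p ^ n) & generic_frobenius phi p (p ^ n).
Proof.
have [n rkD] := rk_stable span_e (pspan_next span_e pA).
have Dphi c : pspan phi (p ^ n) e (phi c).
  rewrite -[phi c]mulr1; apply: (submodM _ (submod_span _ _)).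
  by rewrite -(expr1n _ (p ^ n)); apply: pspan_exp.
have Dpow a : pspan phi (p ^ n) e (a ^+ (p ^ n)) by apply: pspan_exp.
exists n.
  move=> N sN hN; have dN : Dmod phi e p n N.
    have [N0 NA _] := sN; split=> // d x Dd Nx.
    have sV : submod phi [set t | N (t * x)].
      split; first by rewrite /= mul0r.
        by move=> y z /= Ny Nz; rewrite mulrDl; apply: NA.
      by move=> t y /= Ny; rewrite -mulrA; apply: (submodM _ sN).
    by apply: (span_sub sV) Dd => _ /mapP[y _ ->]; apply: hN.
  have [b [r [b0 [rD rM] rN rE]]] := Dretract B_dom pA rkD dN.
  exists b, r; split=> //; first by move=> x y; apply: rD.
  by split=> [c m|a m]; apply: rM.
have [b [P [b0 PD PM PV]]] := Dfrobenius B_dom pA rkD.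
exists b, P; split=> // [c m|a m].
  by rewrite PM // rmorphXn.
by rewrite PM // -!exprM mulnC.
Qed.

End GenericStructure.

(** * Colons, multiples and the modular law *)

Section Scaling.
Variables (B A : comNzRingType) (phi : {rmorphism B -> A}).
Implicit Types (V K : set A).

Definition colon V b : set A := [set z | V (phi b * z)].
Definition scaled b : set A := [set phi b * z | z in setT].

Lemma submod_colon V b : submod phi V -> submod phi (colon V b).
Proof.
move=> sV; split; first by rewrite /colon /= mulr0; apply: submod0 sV.
  by move=> x y; rewrite /colon /= mulrDr; apply: (submodD sV).
by move=> t x; rewrite /colon /= mulrCA; apply: (submodM _ sV).
Qed.

Lemma submod_scaled b : submod phi (scaled b).
Proof.
split; first by exists 0 => //; rewrite mulr0.
  by move=> _ _ [x _ <-] [y _ <-]; exists (x + y) => //; rewrite mulrDr.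
by move=> t _ [x _ <-]; exists (phi t * x) => //; rewrite mulrCA.
Qed.

Lemma sub_addl V K : submod phi K -> V `<=` ideal_add V K.
Proof. by move=> sK; apply: ideal_addl; apply: submod0 sK. Qed.

Lemma sub_addr V K : submod phi V -> K `<=` ideal_add V K.
Proof. by move=> sV; apply: ideal_addr; apply: submod0 sV. Qed.

(** Multiplication by [b] maps [A] modulo the colon onto [V + b A] modulo [V]; both lengths are then
    completed to that of [A / V]. *)
Lemma len_colon V b : submod phi V -> len_fin phi V setT ->
  (len phi V (colon V b) <= len phi (ideal_add V (scaled b)) setT)%N.
Proof.
move=> sV fV; have sC := submod_colon b sV; have sS := submod_scaled b.
have sA := submod_add sV sS; have VA := sub_addl (V := V) sS.
have VC : V `<=` colon V b by move=> v Vv; apply: (submodM _ sV).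
have sT := submodT phi.
have fC : len_fin phi (colon V b) setT by apply: len_fin_sub fV.
have fVA : len_fin phi V (ideal_add V (scaled b)) by apply: len_fin_sub fV.
have le : (len phi V (ideal_add V (scaled b)) <= len phi (colon V b) setT)%N.
  apply/(len_spec sC _ fC) => //.
  apply: (has_chain_pull (f := fun z => phi b * z) (V2 := V) (U2 := ideal_add V (scaled b))).
  - by move=> J sJ; apply: (submod_setI sT); exact: (submod_colon b sJ).
  - by [].
  - by [].
  - move=> _ [v [_ [Vv [z _ <-] ->]]]; exists z => //; by rewrite addrK.
  - exact/(len_spec sV VA fVA).
have e1 := lenD sV sC sT VC (@subsetT _ _) fV.
have e2 := lenD sV sA sT VA (@subsetT _ _) fV.
by lia.
Qed.

Lemma cyc_kill (I : set B) V y n : submod phi V -> (forall t, I t -> V (phi t * y)) ->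
  len_le idfun I setT n -> len_le phi V (ideal_add V (cyc phi y)) n.
Proof.
move=> sV hI hn k hk; apply: hn.
apply: (has_chain_pull (f := fun c => phi c * y) _ _ _ _ hk) => //.
  move=> J sJ; split; first by split=> //=; rewrite rmorph0 mul0r; apply: submod0 sJ.
    by move=> a b [_ Ja] [_ Jb]; split=> //=; rewrite rmorphD mulrDl; apply: (submodD sJ).
  by move=> t a [_ Ja]; split=> //=; rewrite rmorphM -mulrA; apply: (submodM _ sJ).
by move=> _ [v [_ [Vv [c _ <-] ->]]]; exists c => //; rewrite addrK.
Qed.

Lemma span_kill (I : set B) V (e : seq A) n : submod phi V ->
  (forall t y, I t -> V (phi t * y)) ->
  len_le idfun I setT n -> len_le phi V (ideal_add V (span phi e)) (size e * n).
Proof.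
move=> sV hI hn; elim: e => [|x l IH].
  apply: (@len_le_sub _ _ _ V V V) => //; last exact: (len_le_sub _ _ (@len_le0 _ _ _ V)).
  by apply: (ideal_add_sub sV) => // _ ->; apply: submod0 sV.
have sl := submod_span phi l; have sW := submod_add sV sl.
have sU := submod_add sV (submod_span phi (x :: l)).
have VU : ideal_add V (span phi l) `<=` ideal_add V (span phi (x :: l)).
  apply: (ideal_add_sub sU); first exact: sub_addl (submod_span phi (x :: l)).
  move=> z lz; apply: sub_addr => //; apply: sub_addr lz; exact: submod_cyc.
rewrite /= mulSn addnC; apply: (len_le_add sV sW sU) => //; first exact: sub_addl.
apply: (@len_le_sub _ _ phi (ideal_add V (span phi l)) _
  (ideal_add (ideal_add V (span phi l)) (cyc phi x))) => //.
  apply: (@ideal_add_sub _ _ phi).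
  - by apply: submod_add => //; apply: submod_cyc.
  - move=> v Vv; apply: sub_addl; first exact: submod_cyc.
    exact: sub_addl sl _ Vv.
  - move=> _ [y [z [cy lz ->]]]; rewrite addrC; exists z, y; split=> //.
    exact: sub_addr sV _ lz.
by apply: (cyc_kill (I := I)) => // t It; apply: sub_addl (hI _ _ It).
Qed.

(** This is the isomorphism of [K / (V + K1)] with [(V + K2) / W]. The quotient [W / V] is the whole
    error term of additivity. *)
Lemma len_modular V K1 K2 : submod phi V -> submod phi K1 -> submod phi K2 ->
  len_fin phi V setT ->
  let K := ideal_add V (ideal_add K1 K2) in
  let W := ideal_add V K1 `&` ideal_add V K2 in
  (len phi V setT + len phi K setT =
   len phi (ideal_add V K1) setT + len phi (ideal_add V K2) setT + len phi V W)%N.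
Proof.
move=> sV s1 s2 fV K W.
have sT := submodT phi.
have sK : submod phi K by do !apply: submod_add.
have sV1 := submod_add sV s1; have sV2 := submod_add sV s2.
have sW : submod phi W by apply: submod_setI.
have VW : V `<=` W by move=> v Vv; split; apply: sub_addl Vv.
have V1K : ideal_add V K1 `<=` K.
  by move=> _ [v [k [Vv Kk ->]]]; exists v, k; split=> //; apply: sub_addl Kk.
have V2K : ideal_add V K2 `<=` K.
  by move=> _ [v [k [Vv Kk ->]]]; exists v, k; split=> //; apply: sub_addr Kk.
have WV2 : W `<=` ideal_add V K2 by move=> x [].
have fV1 : len_fin phi (ideal_add V K1) setT by apply: len_fin_sub fV => //; apply: sub_addl.
have fV2 : len_fin phi (ideal_add V K2) setT by apply: len_fin_sub fV => //; apply: sub_addl.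
have fW2 : len_fin phi W (ideal_add V K2) by apply: len_fin_sub fV.
have f1K : len_fin phi (ideal_add V K1) K by apply: len_fin_sub fV1.
have e1 := lenD sV1 sK sT V1K (@subsetT _ _) fV1.
have e2 := lenD sV sW sT VW (@subsetT _ _) fV.
have fW : len_fin phi W setT by apply: len_fin_sub fV.
have e3 := lenD sW sV2 sT WV2 (@subsetT _ _) fW.
suff : len phi (ideal_add V K1) K = len phi W (ideal_add V K2) by lia.
apply/eqP; rewrite eqn_leq; apply/andP; split.
  apply/(len_spec sW WV2 fW2).
  apply: (has_chain_pull (f := idfun) (V2 := ideal_add V K1) (U2 := K)) => //.
  - by move=> J sJ; apply: (submod_setI sV2 sJ).
  - by move=> x [].
  - move=> _ [v [_ [Vv [k1 [k2 [K1k K2k ->]]] ->]]]; exists k2; first exact: sub_addr K2k.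
    by exists v, k1; split=> //=; ring.
  - exact/(len_spec sV1 V1K f1K).
apply/(len_spec sV1 V1K f1K).
apply: (has_chain_push (phi1 := phi) (f := idfun) (V1 := W) (U1 := ideal_add V K2)) => //.
- move=> J sJ _; have -> : idfun @` J = J by exact: image_id.
  exact: (submod_add sJ sV1).
- exact/(len_spec sW WV2 fW2).
Qed.

End Scaling.

Section Additivity.
Variables (B A : comNzRingType) (phi : {rmorphism B -> A}) (q : nat).
Variables (K1 K2 V : set A) (Z : set A) (b : B) (r : A -> A).
Hypotheses (sK1 : submod idfun K1) (sK2 : submod idfun K2).
Hypothesis K12 : forall x, K1 x -> K2 x -> x = 0.
Hypothesis sV : submod idfun V.
Hypothesis V_gen : forall z a, Z z -> V (z ^+ q * a).
Hypothesis V_min : forall W, submod phi W -> (forall z a, Z z -> W (z ^+ q * a)) -> V `<=` W.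
Hypothesis rD : {morph r : x y / x + y}.
Hypothesis rB : forall c m, r (phi c * m) = phi c * r m.
Hypothesis rq : forall a m, r (a ^+ q * m) = a ^+ q * r m.
Hypothesis rN : forall m, ideal_add K1 K2 (r m).
Hypothesis rE : forall u, ideal_add K1 K2 u -> r u = phi b * u.

Lemma submod_id_phi U : submod idfun U -> submod phi U.
Proof. by case=> U0 UD UM; split=> // t x; apply: (UM (phi t)). Qed.

(** Since [r] commutes with the [q]-th powers that generate [V], it maps [V] into the sum of [K1]
    and [K2] intersected with [V]. For [z = v1 + k1 = v2 + k2], apply [r] to [v2 - v1 = k1 - k2]:
    the sum of [K1] and [K2] being direct, comparing components puts [b * k1] into [V]. *)
Lemma corr_sub : ideal_add V K1 `&` ideal_add V K2 `<=` colon phi V b.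
Proof.
have sKV1 := submod_setI sK1 sV; have sKV2 := submod_setI sK2 sV.
have sS := submod_id_phi (submod_add sKV1 sKV2).
have rV : V `<=` [set x | ideal_add (K1 `&` V) (K2 `&` V) (r x)].
  apply: V_min.
    split; first by rewrite /= -[0](mul0r 0) -(rmorph0 phi) rB rmorph0 mul0r; apply: submod0 sS.
      by move=> x y /= hx hy; rewrite rD; apply: (submodD sS).
    by move=> t x /= hx; rewrite rB; apply: (submodM _ sS).
  move=> z a Zz /=; rewrite rq; have [l1 [l2 [Kl1 Kl2 ->]]] := rN a.
  exists (z ^+ q * l1), (z ^+ q * l2); rewrite mulrDr; split=> //; split.
  - exact: (submodM (z ^+ q) sK1).
  - exact: V_gen.
  - exact: (submodM (z ^+ q) sK2).
  - exact: V_gen.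
move=> z [[v1 [k1 [Vv1 Kk1 zE]]] [v2 [k2 [Vv2 Kk2 zE']]]].
have Vd : V (v2 - v1) by apply: (submodB sV).
have dE : v2 - v1 = k1 - k2.
  by rewrite -(addKr v1 k1) -zE zE'; ring.
have [m1 [m2 [[K1m Vm1] [K2m Vm2] mE]]] := rV _ Vd.
have h : phi b * k1 - m1 = phi b * k2 + m2.
  have : r (v2 - v1) = phi b * (k1 - k2).
    rewrite dE; apply: rE; exists k1, (- k2); split=> //; exact: (submodN sK2).
  rewrite mE mulrBr => e; apply/eqP; rewrite subr_eq -addrA [m2 + m1]addrC e.
  by rewrite addrC subrK.
have h0 : phi b * k1 - m1 = 0.
  apply: K12.
    by apply: (submodB sK1) => //; apply: (submodM (phi b) sK1).
  by rewrite h; apply: (submodD sK2) => //; apply: (submodM (phi b) sK2).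
rewrite /colon /= zE mulrDr; apply: (submodD sV); first exact: (submodM (phi b) sV).
by move/eqP: h0; rewrite subr_eq0 => /eqP ->.
Qed.

Lemma len_additive : len_fin phi V setT ->
  (len phi V setT + len phi (ideal_add V (ideal_add K1 K2)) setT <=
   len phi (ideal_add V K1) setT + len phi (ideal_add V K2) setT +
   len phi (ideal_add V (scaled phi b)) setT)%N.
Proof.
move=> fV; have sV' := submod_id_phi sV.
rewrite (len_modular sV' (submod_id_phi sK1) (submod_id_phi sK2) fV) leq_add2l.
apply: (leq_trans _ (len_colon b sV' fV)).
have sC := submod_colon b sV'.
have sW : submod phi (ideal_add V K1 `&` ideal_add V K2).
  by apply: submod_setI; apply: submod_add => //; apply: submod_id_phi.
apply: len_mono => //; last 2 first.
- exact: corr_sub.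
- by apply: len_fin_sub fV.
by move=> v Vv; split; [exact: sub_addl sK1 _ Vv|exact: sub_addl sK2 _ Vv].
Qed.

End Additivity.

(** * Growth of lengths over a power series ring *)

Section Growth.
Variables (B : comNzRingType) (d : nat) (x : 'I_d -> B) (m : set B) (G : nat -> set B).
Hypothesis m_inv : forall t, ~ m t -> exists t', m (1 - t' * t).
Hypothesis m_gen : forall t, m t ->
  exists c : 'I_d -> B, exists r : seq 'I_d, t = \sum_(i <- r) c i * x i.
Hypothesis G_ideal : forall n, submod idfun (G n).
Hypothesis G_mono : forall n n', (n <= n')%N -> G n' `<=` G n.
Hypothesis G_x : forall i n, G n (x i ^+ n).
Hypothesis G_val : forall b, b <> 0 -> exists v, forall n c, G (n + v)%N (b * c) -> G n c.
Hypothesis G_pig : forall n V, submod idfun V -> (forall i, V (x i ^+ n)) -> G (d * n)%N `<=` V.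
Hypothesis d_gt0 : (0 < d)%N.

Lemma len_G n : len_le idfun (G n) setT (n ^ d).
Proof.
have [||k le tk] := @tower_cyc _ _ idfun m _ x n (enum 'I_d) (G n) 1 m_gen (G_ideal n).
- by move=> i; rewrite mem_enum.
- by move=> i _; rewrite mulr1; apply: G_x.
have [sU GU lU] := tower_fin m_inv (G_ideal n) tk.
move=> j hj; rewrite size_enum_ord in le; apply: leq_trans le; apply: lU.
apply: has_chain_widen hj => // b _; apply: ideal_addr; first exact: submod0 (G_ideal n).
by exists b => //; rewrite mulr1.
Qed.

(** Multiplication by [b ^+ i] embeds [B / (b, G n)] into the layer [V i / V i.+1]. So [n] copies
    fit into a quotient of length at most [M ^ d], and dividing by [n] lowers the degree of growth
    by one. *)
Lemma len_hypersurface b : b <> 0 -> exists C, forall n, (0 < n)%N ->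
  len_le idfun (ideal_add (scaled idfun b) (G n)) setT (C * n ^ d.-1).
Proof.
move=> b0; have [v hv] := G_val b0; exists (v.+1 ^ d)%N => n n0 k hk.
(* Cancelling [b ^+ i] with [i < n] costs at most [n * v] orders, and [n] must be left over. *)
pose M := (n * v.+1)%N.
pose V i := ideal_add (scaled idfun (b ^+ i)) (G M).
have sb i : submod idfun (scaled idfun (b ^+ i)) by apply: submod_scaled.
have sV i : submod idfun (V i) by apply: submod_add.
have hvi i c l : G (l + i * v)%N (b ^+ i * c) -> G l c.
  elim: i c => [|i IH] c; first by rewrite mul0n addn0 expr0 mul1r.
  by rewrite mulSn addnCA exprS -mulrA addnC => /hv; apply: IH.
have GV i : G M `<=` V i by apply: sub_addr (sb i).
have VV i : V i.+1 `<=` V i.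
  apply: (ideal_add_sub (sV i)) => // _ [z _ <-]; apply: sub_addl => //.
  by exists (b * z) => //; rewrite exprSr mulrA.
have hch i : (i < n)%N -> has_chain idfun (V i.+1) (V i) k.
  move=> lt; apply: (has_chain_push (phi1 := idfun) (f := fun c => b ^+ i * c) _ _ _ _ _ _ _ _ _ hk) => //.
  - by move=> y z; rewrite mulrBr.
  - move=> J sJ _; apply: submod_add => //; split.
    + by exists 0; [exact: submod0 sJ|rewrite mulr0].
    + move=> _ _ [y Jy <-] [z Jz <-]; exists (y + z); first exact: (submodD sJ).
      by rewrite mulrDr.
    + move=> t _ [y Jy <-]; exists (t * y); first exact: (submodM t sJ).
      by rewrite mulrCA.
  - by apply: submod_add => //; apply: submod_scaled.
  - by move=> c _; apply: sub_addl => //; exists c.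
  - move=> u _ [_ [g [[c _ <-] Gg e]]].
    exists (b * c), (u - b * c); split; [by exists c| |by rewrite addrC subrK].
    apply: (hvi i); apply: (@G_mono _ M); last first.
      have -> : b ^+ i * (u - b * c) = g by rewrite mulrBr e /= exprSr; ring.
      exact: Gg.
    by rewrite /M mulnS leq_add2l leq_mul2r ltnW ?orbT.
have tot i : (i <= n)%N -> has_chain idfun (V i) (V 0%N) (i * k).
  elim: i => [_|i IH lt]; first by rewrite mul0n; apply: has_chain0.
  have V0 j : V j `<=` V 0%N by elim: j => // j IHj; apply: subset_trans IHj.
  rewrite mulSn; apply: (has_chain_cat (W := V i)) => //; first exact: hch.
  exact: IH (ltnW lt).
have : (n * k <= M ^ d)%N.
  by apply: (@len_G M); apply: has_chain_widen (tot n (leqnn n)).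
have -> : (M ^ d = n * (v.+1 ^ d * n ^ d.-1))%N.
  by rewrite /M expnMn -[X in (n ^ X * _)%N](prednK d_gt0) expnS -mulnA [(n ^ _ * _)%N]mulnC.
by rewrite leq_pmul2l.
Qed.

Variables (A : comNzRingType) (phi : {rmorphism B -> A}) (e : seq A).
Hypothesis span_e : forall a, span phi e a.

Lemma len_generic_torsion b : b <> 0 -> exists C, forall n V, (0 < n)%N -> submod phi V ->
  (forall a, V (phi b * a)) -> (forall i a, V (phi (x i ^+ n) * a)) ->
  len_le phi V setT (C * n ^ d.-1).
Proof.
move=> b0; have [C hC] := len_hypersurface b0.
exists (size e * (C * d ^ d.-1))%N => n V n0 sV Vb Vx.
have dn0 : (0 < d * n)%N by rewrite muln_gt0 d_gt0.
have := @span_kill _ _ phi (ideal_add (scaled idfun b) (G (d * n))) V e _ sV _ (hC _ dn0).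
rewrite expnMn !mulnA => h j hj; apply: h.
  move=> _ y [_ [g [[c _ <-] Gg ->]]] /=.
  rewrite rmorphD rmorphM mulrDl; apply: (submodD sV).
    by rewrite /= -mulrA mulrCA; apply: (submodM _ sV).
  pose W := [set t | forall z, V (phi t * z)].
  have sW : submod idfun W.
    split; first by move=> z; rewrite rmorph0 mul0r; apply: submod0 sV.
      by move=> s t hs ht z; rewrite rmorphD mulrDl; apply: (submodD sV).
    by move=> s t ht z; rewrite /= rmorphM -mulrA; apply: (submodM _ sV).
  by apply: (G_pig (n := n) sW) Gg _ => i z; apply: Vx.
apply: has_chain_widen hj => // a _; apply: sub_addr sV _ (span_e a).
Qed.

Lemma tower_full n V : submod phi V -> (forall i a, V (phi (x i ^+ n) * a)) ->
  exists k, tower phi m V k setT.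
Proof.
move=> sV Vx; suff [k tk] : exists k, tower phi m V k (ideal_add V (span phi e)).
  exists k; have <- : ideal_add V (span phi e) = setT => //.
  by apply/seteqP; split=> // a _; apply: sub_addr sV _ (span_e a).
elim: e => [|y l [k tk]].
  exists 0%N; have -> : ideal_add V (span phi [::]) = V; last exact: Tower0.
  apply/seteqP; split; first by apply: (ideal_add_sub sV) => // _ ->; apply: submod0 sV.
  exact: sub_addl (submod_span _ _).
have sl := submod_span phi l; have sW := submod_add sV sl.
have [||k' _ tk'] := @tower_cyc _ _ phi m _ x n (enum 'I_d) (ideal_add V (span phi l)) y m_gen sW.
- by move=> i; rewrite mem_enum.
- by move=> i _; apply: (sub_addl sl).
exists (k' + k)%N; apply: tower_cat tk _.
suff <- : ideal_add (ideal_add V (span phi l)) (cyc phi y) = ideal_add V (span phi (y :: l)) by [].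
apply/seteqP; split.
  move=> _ [_ [z [[v [w [Vv lw ->]]] cz ->]]]; exists v, (z + w).
  by rewrite -addrA [w + z]addrC; split=> //; exists z, w.
move=> _ [v [_ [Vv [z [w [cz lw ->]]] ->]]]; exists (v + w), z.
by rewrite -addrA [w + z]addrC; split=> //; exists v, w.
Qed.

Variable p : nat.
Variables (b : B) (P : A -> A).
Hypothesis PD : {morph P : y z / y + z}.
Hypothesis PM : forall c a, P (phi c * a) = phi (c ^+ p) * P a.
Hypothesis P_gen : forall V, submod phi V -> (forall a, V (P a)) -> forall a, V (phi b * a).

(** A simple step generated by [y] is carried to a step generated by [P y], and [x i ^+ p] kills it
    because [x i ^+ p * P y = P (x i * y)]; hence its length is at most [p ^ d]. What the image of
    [P] misses is a quotient of [A / (V' + b A)]. *)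
Lemma len_frobenius V V' n : submod phi V -> submod phi V' ->
  (forall i a, V (phi (x i ^+ n) * a)) ->
  (forall v, V v -> V' (P v)) -> len_fin phi V' setT ->
  (len phi V' setT <= p ^ d * len phi V setT + len phi (ideal_add V' (scaled phi b)) setT)%N.
Proof.
move=> sV sV' Vx PV fV'; have [k tk] := tower_full sV Vx.
pose im U : set A := [set a | forall W, submod phi W -> (forall u, U u -> W (P u)) -> W a].
have sim U : submod phi (im U).
  split=> [W sW _|y z hy hz W sW hW|t y hy W sW hW]; first exact: submod0 sW.
    by apply: (submodD sW); [apply: hy|apply: hz].
  by apply: (submodM _ sW); apply: hy.
have im_mono U U' : U `<=` U' -> im U `<=` im U'.
  by move=> UU y hy W sW hW; apply: hy => // u Uu; apply: hW; apply: UU.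
have imP U u : U u -> im U (P u) by move=> Uu W sW; apply.
have key : len_le phi (im V) (im setT) (p ^ d * len phi V setT).
  have [sT VT lVT] := tower_fin m_inv sV tk.
  elim: tk sT VT lVT => [_ _ _|l W y tW IH my sU VU lU].
    by rewrite len_eq0 // muln0; apply: len_le0.
  have [sW VW lW] := tower_fin m_inv sV tW.
  have {}IH := IH sW VW lW.
  have WU : W `<=` ideal_add W (cyc phi y) by apply: ideal_addl; apply: cyc0.
  have fU : len_fin phi V (ideal_add W (cyc phi y)) by exists l.+1.
  rewrite (lenD sV sW sU VW WU fU) mulnDr.
  apply: (len_le_add (sim _) (sim W) (sim _) (im_mono _ _ VW) (im_mono _ _ WU)) => //.
  have [UW|nUW] := pselect (ideal_add W (cyc phi y) `<=` W).
    have -> : ideal_add W (cyc phi y) = W by apply/seteqP.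
    by rewrite len_eq0 // muln0; apply: len_le0.
  have -> : len phi W (ideal_add W (cyc phi y)) = 1%N.
    apply/eqP; rewrite eqn_leq (len_le_len sW WU (len_le1_step m_inv sW my)) /=.
    apply/(len_spec sW WU); first by exists 1%N; apply: (len_le1_step m_inv sW my).
    exact: has_chain_ext (has_chain0 sW).
  rewrite muln1 -[d in (p ^ d)%N]size_enum_ord.
  (* If [x i] were outside [m], it would be invertible modulo [m]; as [x i ^+ n * y] lies in [V],
     descending on the exponent would put [y] into [W], against the step being proper. *)
  have mx i : m (x i).
    apply: contrapT => /m_inv[t' mt']; apply: nUW.
    suff Wy : W y by apply: (ideal_add_sub sW) => //; apply: cyc_sub.
    suff h j : W (phi (x i ^+ (n - j)) * y).
      by have := h n; rewrite subnn expr0 rmorph1 mul1r.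
    elim: j => [|j IHj]; first by rewrite subn0; apply: VW; apply: Vx.
    case: (ltnP j n) => lt; last by rewrite (_ : n - j.+1 = n - j)%N //; lia.
    have -> : x i ^+ (n - j.+1) = t' * x i ^+ (n - j) + (1 - t' * x i) * x i ^+ (n - j.+1).
      by rewrite (_ : n - j = (n - j.+1).+1)%N; [rewrite exprS; ring|lia].
    rewrite rmorphD mulrDl !rmorphM -!mulrA; apply: (submodD sW).
      exact: (submodM _ sW).
    by rewrite mulrCA; apply: (submodM _ sW); apply: (my _ mt').
  have [||k' le tk'] := @tower_cyc _ _ phi m _ x p (enum 'I_d) (im W) (P y) m_gen (sim W).
  - by move=> i; rewrite mem_enum.
  - by move=> i _; rewrite -PM; apply: imP; apply: my.
  have [_ _ lk'] := tower_fin m_inv (sim W) tk'.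
  move=> j hj; apply: leq_trans le; apply: lk'; apply: has_chain_widen hj => //.
  have sC : submod phi (ideal_add (im W) (cyc phi (P y))) by apply: submod_add => //; apply: submod_cyc.
  move=> z hz; apply: hz => // _ [w [_ [Ww [t _ <-] ->]]]; rewrite PD PM.
  by exists (P w), (phi (t ^+ p) * P y); split=> //; [exact: imP|exists (t ^+ p)].
have sI := sim setT; have sVI := submod_add sV' sI; have sT := submodT phi.
have sS := submod_scaled phi b; have sVb := submod_add sV' sS.
have V'I := sub_addl (V := V') sI.
have subVI : ideal_add V' (scaled phi b) `<=` ideal_add V' (im setT).
  apply: (ideal_add_sub sVI) => // _ [a _ <-]; apply: P_gen => // u.
  by apply: sub_addr sV' _ _; apply: imP.
rewrite (lenD sV' sVI sT V'I (@subsetT _ _) fV'); apply: leq_add.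
  apply: len_le_len => // j hj; apply: key.
  apply: (has_chain_pull (f := idfun) _ _ _ _ hj).
  - by move=> J sJ; apply: (submod_setI sI sJ).
  - exact: im_mono.
  - by move=> z hz; apply: hz.
  - by move=> _ [v [i [Vv Ii ->]]]; exists i => //=; rewrite addrK.
apply: len_mono => //; apply: len_fin_sub fV' => //; exact: sub_addl sS.
Qed.

End Growth.

(** * Coefficient fields and completions *)

Section InseparableDegree.
Variables (k : fieldType) (p : nat) (l : set k) (c : k).
Hypothesis pk : p \in [pchar k].
Hypothesis l1 : l 1.
Hypothesis lB : forall x y, l x -> l y -> l (x - y).
Hypothesis lM : forall x y, l x -> l y -> l (x * y).
Hypothesis lV : forall x, l x -> l x^-1.
Hypothesis lp : forall x, l (x ^+ p).
Hypothesis lc : ~ l c.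

Let over (f : {poly k}) := forall i, l f`_i.

Lemma sub0 : l 0. Proof. by rewrite -(subrr 1); apply: lB. Qed.
Lemma subD x y : l x -> l y -> l (x + y).
Proof. by move=> lx ly; rewrite -[y]opprK; apply: lB => //; rewrite -sub0r; apply: lB => //; apply: sub0. Qed.

Lemma coef_XsubC_exp m : (('X - c%:P) ^+ m.+1)`_m = - (c *+ m.+1) /\ (('X - c%:P) ^+ m.+1)`_m.+1 = 1.
Proof.
elim: m => [|m [IH1 IH2]].
  by rewrite expr1 !coefE /= sub0r subr0 mulr1n.
split; last first.
  have := monic_exp m.+2 (monicXsubC c); rewrite monicE lead_coefE size_exp_XsubC => /eqP; exact.
by rewrite exprSr mulrBr coefB coefMX coefMC /= IH1 IH2 mul1r [in RHS]mulrSr opprD.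
Qed.

(** The minimal polynomial of [c] over [l] divides [X ^ p - c ^ p], a power of [X - c], so it is
    itself such a power. If its degree [j] is below [p], the subleading coefficient [- j * c] forces
    [c] into [l]. *)
Lemma insep_degree f : over f -> (size f <= p)%N -> f.[c] = 0 -> f = 0.
Proof.
move=> of_ sf fc; apply/eqP; apply: contrapT => /negP f0.
have ex : exists n, `[< exists g, [/\ over g, g != 0, g.[c] = 0 & size g = n] >].
  by exists (size f); apply/asboolP; exists f.
have [n /asboolP[g0 [og0 g00 g0c sg0]] minn] := ex_minnP ex.
pose g := (lead_coef g0)^-1 *: g0.
have lg0 : lead_coef g0 != 0 by rewrite lead_coef_eq0.
have og : over g by move=> i; rewrite coefZ; apply: lM => //; apply: lV; apply: og0.
have gc : g.[c] = 0 by rewrite hornerZ g0c mulr0.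
have gm : g \is monic by rewrite monicE lead_coefZ mulVf.
have sg : size g = n by rewrite size_scale ?invr_eq0.
have np : (n <= p)%N.
  by apply: leq_trans sf; apply: minn; apply/asboolP; exists f; split.
have div h : over h -> h.[c] = 0 -> g %| h.
  move: {2}(size h) (leqnn (size h)) => N; elim: N h => [|N IH] h.
    by rewrite leqn0 size_poly_eq0 => /eqP ->; rewrite dvdp0.
  move=> sh oh hc; have [->|h0] := eqVneq h 0; first exact: dvdp0.
  have nh : (n <= size h)%N by apply: minn; apply/asboolP; exists h.
  pose t := (lead_coef h) *: 'X^(size h - n) * g.
  have ot : over t.
    move=> i; rewrite /t -scalerAl coefZ coefXnM; apply: lM; first exact: oh.
    by case: ifP => _; [exact: sub0|exact: og].
  have st : size t = size h.
    rewrite /t -scalerAl size_scale ?lead_coef_eq0 // mulrC size_mulXn ?monic_neq0 //.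
    by rewrite sg subnK.
  have lt : lead_coef t = lead_coef h.
    by rewrite /t lead_coefM lead_coefZ lead_coefXn mulr1 (monicP gm) mulr1.
  have -> : h = (h - t) + t by rewrite subrK.
  apply: dvdp_add; last by rewrite dvdp_mull.
  apply: IH; first 2 last.
  - by rewrite hornerD hornerN hc /t hornerM gc mulr0 subr0.
  - rewrite -ltnS; apply: leq_trans sh; rewrite ltn_neqAle.
    have le : (size (h - t)%R <= size h)%N.
      by apply: leq_trans (size_polyD _ _) _; rewrite size_polyN st maxnn.
    rewrite le andbT; apply/eqP => e; have : lead_coef (h - t) = 0.
      by rewrite lead_coefE e coefB -lead_coefE -{1}lt lead_coefE st subrr.
    move/eqP; rewrite lead_coef_eq0 -size_poly_eq0 e size_poly_eq0 => h0'.
    by rewrite h0' in h0.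
  - by move=> i; rewrite coefB; apply: lB.
have pkp : p \in [pchar {poly k}] by rewrite pchar_poly.
have : g %| ('X - c%:P) ^+ p.
  rewrite (expB1_p pkp) -polyC_exp; apply: div; last first.
    by rewrite hornerD hornerN hornerC hornerXn subrr.
  move=> i; rewrite coefB coefXn coefC; apply: lB.
    by case: eqP => _; [exact: l1|exact: sub0].
  by case: eqP => _; [exact: lp|exact: sub0].
case/dvdp_exp_XsubCP => m mp; rewrite eqp_monic ?monic_exp ?monicXsubC // => /eqP gE.
have sgm : n = m.+1 by rewrite -sg gE size_exp_XsubC.
case: m mp gE sgm => [|m] mp gE sgm.
  by move: gc; rewrite gE expr0 hornerC => /eqP; rewrite oner_eq0.
have lcm : l (c *+ m.+1).
  have [h _] := coef_XsubC_exp m; have := og m; rewrite gE h => lcm.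
  by rewrite -[_ *+ _]opprK -[- _]sub0r; apply: lB => //; exact: sub0.
have lnat i : l i%:R by elim: i => [|i IH]; [exact: sub0|rewrite mulrSr; apply: subD].
have m0 : (m.+1)%:R != 0 :> k.
  rewrite -(dvdn_pcharf pk); apply/negP => /dvdn_leq h; have := h isT.
  by move: np; rewrite sgm; lia.
apply: lc; have -> : c = c *+ m.+1 * (m.+1)%:R^-1 by rewrite -[c *+ _]mulr_natr mulfK.
by apply: lM => //; apply: lV.
Qed.

End InseparableDegree.

Section CoefficientRings.
Variables (A : comNzRingType) (k : fieldType) (pi : {rmorphism A -> k}) (p : nat).
Hypotheses (pA : p \in [pchar A]) (pk : p \in [pchar k]).
Implicit Types (C X H : set A).

Definition subring C : Prop :=
  [/\ C 1, (forall x y, C x -> C y -> C (x - y)) & (forall x y, C x -> C y -> C (x * y))].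

Definition pi_onto C : Prop := forall c, exists2 a, C a & pi a = c.

Lemma subring0 C : subring C -> C 0.
Proof. by move=> [C1 CB _]; rewrite -(subrr 1); apply: CB. Qed.

Lemma subringD C x y : subring C -> C x -> C y -> C (x + y).
Proof.
move=> sC Cx Cy; have [C1 CB _] := sC; rewrite -[y]opprK; apply: (CB) => //.
by rewrite -sub0r; apply: CB => //; apply: subring0.
Qed.

Lemma subring_exp C x n : subring C -> C x -> C (x ^+ n).
Proof.
by move=> [C1 _ CM] Cx; elim: n => [//|n IH]; rewrite exprS; apply: CM.
Qed.

Lemma subring_sum C (I : Type) (r : seq I) (P : pred I) (F : I -> A) :
  subring C -> (forall i, P i -> C (F i)) -> C (\sum_(i <- r | P i) F i).
Proof.
by move=> sC h; elim/big_ind: _ => // [|x y]; [exact: subring0|exact: subringD].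
Qed.

(* The subrings [X] below play the role of a coefficient field modulo [H]; a
   maximal one surjects onto [k], since an element [c] outside [pi X] has degree
   [p] over [pi X], so that a lift of [c] can be adjoined to [X]. *)
Lemma coeff_step C H : subring C -> pi_onto C -> submod idfun H ->
  (forall z, C z -> pi z = 0 -> H (z ^+ p)) ->
  exists X, [/\ subring X, X `<=` C, pi_onto X & forall z, X z -> pi z = 0 -> H z].
Proof.
move=> sC oC sH hH; have [C1 CB CM] := sC.
pose nice X := [/\ subring X, (forall z, C z -> X (z ^+ p)), X `<=` C &
                   forall z, X z -> pi z = 0 -> H z].
have [F FP Ftot|X [PX maxX]] := @Zorn_bigcup A (fun X => X = set0 \/ nice X).
  have [[X0 FX0 [x X0x]]|noX] := pselect (exists2 X, F X & X !=set0); last first.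
    left; apply/seteqP; split=> // x [X FX Xx]; exfalso; apply: noX; exists X => //.
    by exists x.
  have niceF X y : F X -> X y -> nice X.
    by move=> FX Xy; case: (FP _ FX) => // X_0; rewrite X_0 in Xy.
  have [[X01 _ _] X0p _ _] := niceF _ _ FX0 X0x.
  have two x1 x2 : (\bigcup_(X in F) X) x1 -> (\bigcup_(X in F) X) x2 ->
      exists X, [/\ F X, X x1 & X x2].
    move=> [X1 F1 h1] [X2 F2 h2]; have [s|s] := Ftot _ _ F1 F2.
      by exists X2; split=> //; apply: s.
    by exists X1; split=> //; apply: s.
  right; split.
  - split; first by exists X0.
      move=> x1 x2 h1 h2; have [X [FX Xx1 Xx2]] := two _ _ h1 h2.
      by have [[_ XB _] _ _ _] := niceF _ _ FX Xx1; exists X => //; apply: XB.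
    move=> x1 x2 h1 h2; have [X [FX Xx1 Xx2]] := two _ _ h1 h2.
    by have [[_ _ XM] _ _ _] := niceF _ _ FX Xx1; exists X => //; apply: XM.
  - by move=> z Cz; exists X0 => //; apply: X0p.
  - by move=> z [X FX Xz]; have [_ _ h _] := niceF _ _ FX Xz; apply: h.
  - by move=> z [X FX Xz]; have [_ _ _ h] := niceF _ _ FX Xz; apply: h.
have {PX} niceX : nice X.
  case: PX => // X0; exfalso.
  have [C0 _] : C 0 /\ True by split=> //; apply: subring0.
  apply: (maxX [set z ^+ p | z in C]).
    by rewrite X0; split=> [//|/(_ 1)]; apply; exists 1 => //; rewrite expr1n.
  right; split.
  - split; first by exists 1 => //; rewrite expr1n.
      by move=> _ _ [x Cx <-] [y Cy <-]; exists (x - y); [exact: CB|rewrite (expB1_p pA)].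
    by move=> _ _ [x Cx <-] [y Cy <-]; exists (x * y); [exact: CM|rewrite exprMn].
  - by move=> z Cz; exists z.
  - by move=> _ [z Cz <-]; apply: subring_exp.
  - move=> _ [z Cz <-]; rewrite rmorphXn => /eqP; rewrite expf_eq0 => /andP[_ /eqP z0].
    exact: hH.
have [sX Xp XC XH] := niceX; have [X1 XB XM] := sX; have X_0 := subring0 sX.
exists X; split=> // c; apply: contrapT => nc.
have [a Ca ac] := oC c.
pose over (g : {poly A}) := forall i, X g`_i.
pose Y := [set g.[a] | g in [set g | over g]].
have XY : X `<=` Y.
  move=> x Xx; exists x%:P; last by rewrite hornerC.
  by move=> i; rewrite coefC; case: eqP.
have Ya : Y a.
  by exists 'X; [move=> i; rewrite coefX; case: eqP|rewrite hornerX].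
have sY : subring Y.
  split; first exact: XY.
    move=> _ _ [g og <-] [h oh <-]; exists (g - h); last by rewrite hornerD hornerN.
    by move=> i; rewrite coefB; apply: XB.
  move=> _ _ [g og <-] [h oh <-]; exists (g * h); last by rewrite hornerM.
  by move=> i; rewrite coefM; apply: subring_sum => // j _; apply: XM.
apply: (maxX Y); first by split=> // YX; apply: nc; exists a => //; apply: YX.
right; split=> //.
- by move=> z Cz; apply: XY; apply: Xp.
- move=> _ [g og <-]; rewrite horner_coef; apply: subring_sum => // i _.
  by apply: CM; [apply: XC|apply: subring_exp].
have p0 := pchar_gt0 pA.
move=> _ [g og <-].
(* As [a ^+ p] lies in [X], an expression in [a] reduces to degree below [p], the range where
   [insep_degree] applies. *)
have [h [oh sh ->]] : exists h, [/\ over h, (size h <= p)%N & g.[a] = h.[a]].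
  move: {2}(size g) (leqnn (size g)) => N; elim: N g og => [|N IH] g og sg.
    by exists g; split=> //; apply: leq_trans sg _.
  have [le|lt] := leqP (size g) p; first by exists g.
  have [||h [oh sh hE]] := IH (take_poly p g + (a ^+ p) *: drop_poly p g).
  - move=> i; rewrite coefD coefZ coef_take_poly coef_drop_poly; apply: subringD => //.
      by case: ifP.
    by apply: XM => //; apply: Xp.
  - rewrite -ltnS; apply: leq_trans sg.
    apply: leq_ltn_trans (size_polyD _ _) _; rewrite gtn_max.
    rewrite (leq_ltn_trans (size_take_poly _ _) lt) /=.
    apply: leq_ltn_trans (size_scale_leq _ _) _; rewrite size_drop_poly.
    by rewrite -{2}(subn0 (size g)); apply: ltn_sub2l => //; apply: leq_ltn_trans lt.
  exists h; split=> //; rewrite -hE -{1}(poly_take_drop p g) !(hornerD, hornerM, hornerZ, hornerXn).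
  by rewrite mulrC.
move=> pih.
have h0 : map_poly pi h = 0.
  apply: (@insep_degree k p [set pi x | x in X] c) => //.
  - by exists 1 => //; rewrite rmorph1.
  - by move=> _ _ [x Xx <-] [y Xy <-]; exists (x - y); [exact: XB|rewrite rmorphB].
  - by move=> _ _ [x Xx <-] [y Xy <-]; exists (x * y); [exact: XM|rewrite rmorphM].
  - move=> _ [x Xx <-]; have [y Cy yE] := oC (pi x)^-1.
    exists (x ^+ p.-1 * y ^+ p); first by apply: XM; [exact: subring_exp|exact: Xp].
    rewrite rmorphM !rmorphXn yE exprVn.
    have [->|x0] := eqVneq (pi x) 0; first by rewrite [0 ^+ p]expr0n (gtn_eqF p0) invr0 mulr0.
    have -> : pi x ^+ p = pi x * pi x ^+ p.-1 by rewrite -exprS prednK.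
    by rewrite invfM mulrCA mulfV ?mulr1 // expf_neq0.
  - by move=> x; have [y Cy <-] := oC x; exists (y ^+ p); [exact: Xp|rewrite rmorphXn].
  - by move=> i; rewrite coef_map; exists h`_i.
  - exact: leq_trans (size_poly _ _) sh.
  - by rewrite -ac horner_map pih.
rewrite horner_coef; apply: (submod_sum sH) => i _; rewrite mulrC.
apply: (submodM _ sH); apply: XH => //.
by have := congr1 (fun f : {poly k} => f`_i) h0; rewrite coef_map coef0.
Qed.

(** A coefficient field is only guaranteed in the completion, so it is approximated by decreasing
    subrings: [C n] represents [k] modulo [m n.+1]. Each stage gains one index because [p]-th powers
    do. *)
Lemma coeff_rings (m : nat -> set A) :
  (forall z, pi z = 0 -> m 1%N z) ->
  (forall n, submod idfun (m n)) -> (forall n z, m n.+1 z -> m n.+2 (z ^+ p)) ->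
  pi_onto setT ->
  exists C : nat -> set A, [/\ forall n, subring (C n), forall n, C n.+1 `<=` C n,
     forall n, pi_onto (C n) & forall n z, C n z -> pi z = 0 -> m n.+1 z].
Proof.
move=> m1 sm mp oT.
pose good n C := [/\ subring C, pi_onto C & forall z, C z -> pi z = 0 -> m n.+1 z].
have step n C : good n C -> exists2 X, X `<=` C & good n.+1 X.
  move=> [sC oC hC]; have [z Cz z0|X [sX XC oX hX]] := coeff_step sC oC (sm n.+2).
    by apply: mp; apply: hC.
  by exists X.
pose next n C := xget set0 [set X | X `<=` C /\ good n.+1 X].
pose Cs := fix F n := if n is n'.+1 then next n' (F n') else setT.
have gCs n : good n (Cs n).
  elim: n => [|n IH] /=; first by split=> // z _; exact: m1.
  by rewrite /next; case: xgetP => [X _ []//|]; have [X XC gX] := step _ _ IH; move/(_ X); case.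
exists Cs; split=> n; try by case: (gCs n).
by rewrite /= /next; case: xgetP => [X _ []//|]; have [X XC gX] := step _ _ (gCs n); move/(_ X); case.
Qed.

End CoefficientRings.

(** * Completion along a filtration by ideals *)

Record filtration (A : comNzRingType) := Filtration {
  fil :> nat -> set A;
  fil_ideal : forall n, submod idfun (fil n);
  fil_mono : forall n, fil n.+1 `<=` fil n;
  fil_proper : ~ fil 1%N 1 }.

Lemma fil_le (A : comNzRingType) (F : filtration A) m n : (m <= n)%N -> F n `<=` F m.
Proof.
elim: n => [|n IH]; first by rewrite leqn0 => /eqP ->.
rewrite leq_eqVlt => /orP[/eqP ->//|lt]; apply: (subset_trans (@fil_mono _ F n)); exact: IH.
Qed.

Section Completion.
Variables (A : comNzRingType) (F : filtration A).

(** The rate of convergence is built in, so that [u n] already determines the limit modulo [F n] and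
    membership in the completed filtration is read off at a single index. *)
Definition cauchy_pred : {pred nat -> A} :=
  [pred u : nat -> A | `[< forall n, F n (u n.+1 - u n) >]].

Lemma cauchy_predP (u : nat -> A) :
  reflect (forall n, F n (u n.+1 - u n)) (u \in cauchy_pred).
Proof. by rewrite inE; apply: asboolP. Qed.

Lemma cauchy_subring : subring_closed cauchy_pred.
Proof.
split=> [|u v|u v].
- apply/cauchy_predP => n; have -> : (1 : nat -> A) n.+1 - (1 : nat -> A) n = 0 by exact: subrr.
  exact: submod0 (fil_ideal F n).
- move=> /cauchy_predP hu /cauchy_predP hv; apply/cauchy_predP => n.
  have -> : (u - v) n.+1 - (u - v) n = (u n.+1 - u n) - (v n.+1 - v n).
    by transitivity (u n.+1 - v n.+1 - (u n - v n)); [|ring].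
  exact: (submodB (fil_ideal F n)).
- move=> /cauchy_predP hu /cauchy_predP hv; apply/cauchy_predP => n.
  have -> : (u * v) n.+1 - (u * v) n =
      v n.+1 * (u n.+1 - u n) + u n * (v n.+1 - v n).
    by transitivity (u n.+1 * v n.+1 - u n * v n); [|ring].
  apply: (submodD (fil_ideal F n)); exact: (submodM _ (fil_ideal F n)).
Qed.

HB.instance Definition _ :=
  GRing.isSubringClosed.Build (nat -> A) cauchy_pred cauchy_subring.

Record cauchy_seq := CauchySeq { cauchy_val :> nat -> A; _ : cauchy_val \in cauchy_pred }.

HB.instance Definition _ := [isSub for cauchy_val].
HB.instance Definition _ := [Choice of cauchy_seq by <:].
HB.instance Definition _ := [SubChoice_isSubComNzRing of cauchy_seq by <:].

Definition null_pred : {pred cauchy_seq} :=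
  [pred u : cauchy_seq | `[< forall n, F n (u n) >]].

Lemma null_predP (u : cauchy_seq) : reflect (forall n, F n (u n)) (u \in null_pred).
Proof. by rewrite inE; apply: asboolP. Qed.

Lemma null_idealr : idealr_closed null_pred.
Proof.
split.
- by apply/null_predP => n; apply: submod0 (fil_ideal F n).
- by apply/null_predP => /(_ 1%N) /=; apply: fil_proper.
- move=> a u v /null_predP hu /null_predP hv; apply/null_predP => n.
  apply: (submodD (fil_ideal F n)) => //; exact: (submodM (a n) (fil_ideal F n)).
Qed.

HB.instance Definition _ := isIdealr.Build cauchy_seq null_pred null_idealr.

Definition completion : comNzRingType := {ideal_quot null_pred}.

Definition cls (u : cauchy_seq) : completion := \pi_({ideal_quot null_pred})%qT u.

Lemma cls_zmod : zmod_morphism cls.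
Proof. by move=> u v; rewrite /cls rmorphB. Qed.

Lemma cls_monoid : monoid_morphism cls.
Proof. by split=> [|u v]; rewrite /cls ?rmorph1 ?rmorphM. Qed.

HB.instance Definition _ := GRing.isZmodMorphism.Build cauchy_seq completion cls cls_zmod.
HB.instance Definition _ := GRing.isMonoidMorphism.Build cauchy_seq completion cls cls_monoid.

Lemma cls_eq (u v : cauchy_seq) : cls u = cls v <-> forall n, F n (u n - v n).
Proof.
split=> [/eqP h|h].
  by have /null_predP : (u - v) \in null_pred by rewrite Quotient.idealrBE; exact: h.
apply/eqP; have : (u - v) \in null_pred by exact/null_predP.
by rewrite Quotient.idealrBE => h'; exact: h'.
Qed.

Lemma const_cauchy (a : A) : (fun=> a) \in cauchy_pred.
Proof. by apply/cauchy_predP => n; rewrite subrr; apply: submod0 (fil_ideal F n). Qed.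

Definition to_completion (a : A) : completion := cls (CauchySeq (const_cauchy a)).

Lemma to_completion_zmod : zmod_morphism to_completion.
Proof.
move=> a b; rewrite /to_completion -[RHS](rmorphB cls).
by congr cls; apply: val_inj; apply/funext.
Qed.

Lemma to_completion_monoid : monoid_morphism to_completion.
Proof.
split=> [|a b].
  rewrite /to_completion -[RHS](rmorph1 cls).
  by congr cls; apply: val_inj; apply/funext.
rewrite /to_completion -[RHS](rmorphM cls).
by congr cls; apply: val_inj; apply/funext.
Qed.

HB.instance Definition _ := GRing.isZmodMorphism.Build A completion to_completion to_completion_zmod.
HB.instance Definition _ := GRing.isMonoidMorphism.Build A completion to_completion to_completion_monoid.

Definition completion_fil (n : nat) : set completion :=
  [set w | exists2 u, w = cls u & F n (u n)].

Lemma completion_fil_pi n u : completion_fil n (cls u) <-> F n (u n).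
Proof.
split=> [[v /cls_eq h Fv]|Fu]; last by exists u.
have -> : u n = (u n - v n) + v n by rewrite subrK.
exact: (submodD (fil_ideal F n)).
Qed.

Lemma cls_surj w : exists u, w = cls u.
Proof. by exists (repr w); rewrite /cls reprK. Qed.

End Completion.

(** One interface for two rings: the completion of [A] for the powers of its maximal ideal, and the
    power series ring as completion of the polynomials for the order. *)
Record is_completion (A Ah : comNzRingType) (F : filtration A) (i : {rmorphism A -> Ah})
    (FF : nat -> set Ah) : Prop := IsCompletion {
  compl_ideal : forall n, submod idfun (FF n);
  compl_mono : forall n, FF n.+1 `<=` FF n;
  compl_emb : forall n a, FF n (i a) <-> F n a;
  compl_dense : forall n w, exists a, FF n (w - i a);
  compl_sep : forall w, (forall n, FF n w) -> w = 0;
  compl_lim : forall u : nat -> Ah, (forall n, FF n (u n.+1 - u n)) ->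
    exists w, forall n, FF n (w - u n) }.

Lemma completion_exists (A : comNzRingType) (F : filtration A) :
  exists (Ah : comNzRingType) (i : {rmorphism A -> Ah}) FF, is_completion F i FF.
Proof.
exists (completion F), (to_completion F), (@completion_fil _ F).
have piB (u v : cauchy_seq F) : cls u -
    cls v = cls (u - v).
  by rewrite rmorphB.
have cau (u : cauchy_seq F) n : F n (u n.+1 - u n).
  by case: u => u /= /cauchy_predP.
have cau_le (u : cauchy_seq F) m n : (m <= n)%N -> F m (u n - u m).
  elim: n => [|n IH]; first by rewrite leqn0 => /eqP ->; rewrite subrr; apply: submod0 (fil_ideal F _).
  rewrite leq_eqVlt => /orP[/eqP ->|lt]; first by rewrite subrr; apply: submod0 (fil_ideal F _).
  have -> : u n.+1 - u m = (u n.+1 - u n) + (u n - u m) by ring.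
  by apply: (submodD (fil_ideal F m)); [apply: (@fil_le _ F m n)|apply: IH].
have dense n (u : cauchy_seq F) : completion_fil n
    ((cls u : completion F) - to_completion F (u n)).
  rewrite piB; apply/completion_fil_pi => /=; rewrite -[X in F n X]/(u n - u n) subrr.
  exact: submod0 (fil_ideal F n).
have ideal n : submod idfun (@completion_fil _ F n).
  split.
  - rewrite -(rmorph0 (@cls _ F)); apply/completion_fil_pi.
    exact: submod0 (fil_ideal F n).
  - move=> x y; have [u ->] := cls_surj x; have [v ->] := cls_surj y.
    move=> /completion_fil_pi Fu /completion_fil_pi Fv.
    rewrite -(rmorphD (@cls _ F)); apply/completion_fil_pi.
    exact: (submodD (fil_ideal F n)).
  - move=> x y; have [u ->] := cls_surj x; have [v ->] := cls_surj y.
    move=> /completion_fil_pi Fv; rewrite /= -(rmorphM (@cls _ F)).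
    by apply/completion_fil_pi; apply: (submodM (u n) (fil_ideal F n)).
split=> //.
- move=> n w; have [u ->] := cls_surj w => /completion_fil_pi Fu; apply/completion_fil_pi.
  have -> : u n = u n.+1 - (u n.+1 - u n) by ring.
  by apply: (submodB (fil_ideal F n)) => //; apply: fil_mono.
- by move=> n a; apply: completion_fil_pi.
- by move=> n w; have [u ->] := cls_surj w; exists (u n); apply: dense.
- move=> w; have [u ->] := cls_surj w => h.
  rewrite -(rmorph0 (@cls _ F)); apply/cls_eq => n.
  by rewrite -[X in F n X]/(u n - 0) subr0; apply/completion_fil_pi.
move=> u hu.
(* Approximating [u n] by a constant [a n] to precision [n] gives a Cauchy sequence of [A] whose
   class is the limit. *)
have /choice[a ha] : forall n, exists b, completion_fil n (u n - to_completion F b).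
  by move=> n; have [v ->] := cls_surj (u n); exists (v n); apply: dense.
have ca : a \in cauchy_pred F.
  apply/cauchy_predP => n.
  apply: (proj1 (completion_fil_pi n (CauchySeq (const_cauchy F (a n.+1 - a n))))).
  rewrite -[X in completion_fil n X]/(to_completion F (a n.+1 - a n)) rmorphB.
  have -> : to_completion F (a n.+1) - to_completion F (a n) =
    (u n.+1 - u n) - (u n.+1 - to_completion F (a n.+1)) + (u n - to_completion F (a n)) by ring.
  apply: (submodD (ideal n)) => //; apply: (submodB (ideal n)) => //.
  have [v [-> Fv]] : exists v, u n.+1 - to_completion F (a n.+1) = cls v /\ F n.+1 (v n.+1).
    by have [v -> Fv] := ha n.+1; exists v.
  apply/completion_fil_pi; have -> : v n = v n.+1 - (v n.+1 - v n) by ring.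
  by apply: (submodB (fil_ideal F n)) => //; apply: fil_mono.
exists (cls (CauchySeq ca)) => n.
have -> : (cls (CauchySeq ca) : completion F) - u n =
  (cls (CauchySeq ca) - to_completion F (a n))
   - (u n - to_completion F (a n)) by ring.
by apply: (submodB (ideal n)) => //; apply: dense.
Qed.

(** * Ideal powers, primes and dimension *)

Section IdealPowers.
Variable A : comNzRingType.
Implicit Types (I J W : set A).

Lemma ideal_genP (X : set A) : ideal (ideal_gen X).
Proof.
split=> [I [[] //]|x y hx hy I hI|a x hx I hI].
  by have [[_ ID _] _] := hI; apply: ID; [apply: hx|apply: hy].
by have [[_ _ IM] _] := hI; apply: IM; apply: hx.
Qed.

Lemma ideal_gen_sub (X : set A) : X `<=` ideal_gen X.
Proof. by move=> x Xx I [_]; apply. Qed.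

Lemma ideal_gen_min (X : set A) I : ideal I -> X `<=` I -> ideal_gen X `<=` I.
Proof. by move=> iI XI x; apply. Qed.

Lemma ideal_gen_mono (X Y : set A) : X `<=` Y -> ideal_gen X `<=` ideal_gen Y.
Proof.
by move=> XY; apply: ideal_gen_min (ideal_genP _) _; apply: subset_trans (@ideal_gen_sub _).
Qed.

Lemma ideal_lin (n : nat) (g : 'I_n -> A) : ideal [set x | exists c : 'I_n -> A, x = \sum_i c i * g i].
Proof.
split.
- by exists (fun=> 0); rewrite big1 // => i _; rewrite mul0r.
- move=> _ _ [c ->] [c' ->]; exists (fun i => c i + c' i).
  by rewrite -big_split; apply: eq_bigr => i _; rewrite mulrDl.
- move=> a _ [c ->]; exists (fun i => a * c i).
  by rewrite mulr_sumr; apply: eq_bigr => i _; rewrite mulrA.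
Qed.

Lemma ideal_gen_lin (n : nat) (g : 'I_n -> A) :
  ideal_gen (range g) = [set x | exists c : 'I_n -> A, x = \sum_i c i * g i].
Proof.
apply/seteqP; split.
  apply: ideal_gen_min (ideal_lin g) _ => _ [i _ <-].
  exists (fun j => (j == i)%:R); rewrite (bigD1 i) //= eqxx mul1r big1 ?addr0 // => j ne.
  by rewrite (negPf ne) mul0r.
move=> _ [c ->]; apply: (submod_sum (phi := idfun) (ideal_genP _)) => i _.
by apply: (submodM (phi := idfun) _ (ideal_genP _)); apply: ideal_gen_sub; exists i.
Qed.

Lemma ideal_gen_seq (s : seq A) : ideal_gen [set` s] = ideal_gen (range (tnth (in_tuple s))).
Proof.
congr ideal_gen; apply/seteqP; split=> x /=.
  by move=> /(nthP 0)[i lt <-]; exists (Ordinal lt) => //; rewrite (tnth_nth 0).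
by move=> [i _ <-]; exact: mem_tnth.
Qed.

Lemma pow_ideal I n : ideal (ideal_pow I n).
Proof. exact: ideal_genP. Qed.

Lemma pow_sub I n : submod idfun (ideal_pow I n).
Proof. exact: ideal_genP. Qed.

Lemma pow_prod I n (x : 'I_n -> A) : (forall i, I (x i)) -> ideal_pow I n (\prod_i x i).
Proof. by move=> h; apply: ideal_gen_sub; exists x. Qed.

Lemma pow0 I : ideal_pow I 0 = setT.
Proof.
apply/seteqP; split=> // a _; rewrite -[a]mulr1.
apply: (submodM (phi := idfun) a (pow_sub I 0)).
by have := @pow_prod I 0 (fun=> 0); rewrite big_ord0; apply; case.
Qed.

Lemma pow_exp I n x : I x -> ideal_pow I n (x ^+ n).
Proof. by move=> Ix; have := @pow_prod I n (fun=> x) (fun=> Ix); rewrite prodr_const card_ord. Qed.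

Lemma powM I m n x y : ideal_pow I m x -> ideal_pow I n y -> ideal_pow I (m + n) (x * y).
Proof.
move=> hx hy; pose J := [set x | ideal_pow I (m + n) (x * y)].
have [P0 PD PM] := pow_ideal I (m + n).
have iJ : ideal J.
  split; first by rewrite /J /= mul0r.
    by move=> a b; rewrite /J /= mulrDl; apply: PD.
  by move=> a b; rewrite /J /= -mulrA; apply: PM.
apply: (ideal_gen_min iJ) hx => _ [f [hf ->]]; rewrite /J /=.
pose J' := [set y | ideal_pow I (m + n) (\prod_i f i * y)].
have iJ' : ideal J'.
  split; first by rewrite /J' /= mulr0.
    by move=> a b; rewrite /J' /= mulrDr; apply: PD.
  by move=> a b; rewrite /J' /= mulrCA; apply: PM.
apply: (ideal_gen_min iJ') hy => _ [h [hh ->]]; rewrite /J' /=.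
have := @pow_prod I (m + n) (fun i => match fintype.split i with inl j => f j | inr j => h j end).
rewrite big_split_ord /=.
rewrite (eq_bigr f); last by move=> i _; rewrite (unsplitK (inl i : 'I_m + 'I_n)).
rewrite [X in _ * X](eq_bigr h); last by move=> i _; rewrite (unsplitK (inr i : 'I_m + 'I_n)).
by apply=> i; case: fintype.split.
Qed.

Lemma pow_split I m n W : ideal W ->
  (forall x y, ideal_pow I m x -> ideal_pow I n y -> W (x * y)) -> ideal_pow I (m + n) `<=` W.
Proof.
move=> iW hW; apply: ideal_gen_min iW _ => _ [f [hf ->]].
by rewrite big_split_ord; apply: hW; apply: pow_prod => i; apply: hf.
Qed.

Lemma pow1 I : ideal I -> ideal_pow I 1 = I.
Proof.
move=> iI; apply/seteqP; split=> [|x Ix]; last by have := @pow_exp I 1 x Ix; rewrite expr1.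
by apply: ideal_gen_min iI _ => _ [f [hf ->]]; rewrite big_ord1.
Qed.

Lemma pow_le I m n : (m <= n)%N -> ideal_pow I n `<=` ideal_pow I m.
Proof.
move=> /subnKC <-; apply: pow_split (pow_ideal _ _) _ => x y hx _.
by rewrite mulrC; apply: (submodM (phi := idfun) y (pow_sub I m)).
Qed.

Lemma pow_mono I J n : I `<=` J -> ideal_pow I n `<=` ideal_pow J n.
Proof.
by move=> IJ; apply: ideal_gen_mono => _ [f [hf ->]]; exists f; split=> // i; apply: IJ.
Qed.

Lemma pow_exp_pow I m n x : ideal_pow I m x -> ideal_pow I (m * n) (x ^+ n).
Proof.
move=> hx; elim: n => [|n IH]; first by rewrite muln0 pow0.
by rewrite mulnS exprS; apply: powM.
Qed.

Variables (mu : nat) (g : 'I_mu -> A) (I : set A).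
Hypothesis I_gen : I = ideal_gen (range g).

Definition mono (al : 'I_mu -> nat) : A := \prod_i g i ^+ al i.

Lemma mono_pow al : ideal_pow I (\sum_i al i) (mono al).
Proof.
rewrite /mono; elim/big_ind2: _ => [|m x n y hx hy|i _]; first by rewrite pow0.
  exact: powM.
by apply: pow_exp; rewrite I_gen; apply: ideal_gen_sub; exists i.
Qed.

Lemma pow_mono_gen n W : ideal W -> (forall al, (\sum_i al i = n)%N -> W (mono al)) ->
  ideal_pow I n `<=` W.
Proof.
elim: n W => [|n IH] W iW hW.
  move=> a _; rewrite -[a]mulr1; have [_ _ WM] := iW; apply: WM.
  have := hW (fun=> 0%N); rewrite big1 // /mono big1; first by apply.
  by move=> i _; rewrite expr0.
have [W0 WD WM] := iW.
rewrite -add1n; apply: pow_split => // x y; rewrite pow1; last by rewrite I_gen; apply: ideal_genP.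
move=> Ix hy; have : ideal_gen (range g) x by rewrite -I_gen.
rewrite ideal_gen_lin => -[c ->].
pose W' := [set y | W ((\sum_i c i * g i) * y)].
have iW' : ideal W'.
  split; first by rewrite /W' /= mulr0.
    by move=> a b; rewrite /W' /= mulrDr; apply: WD.
  by move=> a b; rewrite /W' /= mulrCA; apply: WM.
apply: (IH W' iW' _ _ hy) => al sal; rewrite /W' /= mulr_suml.
apply: (submod_sum (phi := idfun) (U := W) iW) => i _; rewrite -mulrA; apply: WM.
have -> : g i * mono al = mono (fun j => (j == i) + al j)%N.
  rewrite /mono (bigD1 i) //= [RHS](bigD1 i) //= eqxx add1n exprS -mulrA; congr (_ * (_ * _)).
  by apply: eq_bigr => j ne; rewrite (negPf ne).
apply: hW; rewrite big_split /= sal -[RHS]add1n; congr addn.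
by rewrite (bigD1 i) //= eqxx big1 // => j /negPf ->.
Qed.

(** A monomial of degree at least [mu * j] in [mu] generators has an exponent at least [j]. *)
Lemma pow_pigeon n j W : (0 < mu)%N -> (mu * j <= n)%N -> ideal W ->
  (forall i y, ideal_pow I (n - j) y -> W (g i ^+ j * y)) -> ideal_pow I n `<=` W.
Proof.
move=> mu0 le iW hW; apply: pow_mono_gen => // al sal.
have [i hi] : exists i, (j <= al i)%N.
  apply: contrapT => no; have lt i : (al i < j)%N by rewrite ltnNge; apply/negP => h; apply: no; exists i.
  have : (\sum_i al i < mu * j)%N.
    rewrite -[X in (X * j)%N]card_ord -sum_nat_const.
    rewrite (bigD1 (Ordinal mu0)) //= [X in (_ < X)%N](bigD1 (Ordinal mu0)) //=.
    by rewrite -addSn leq_add //; apply: leq_sum => i _; apply: ltnW.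
  by rewrite sal; lia.
pose be k := if k == i then (al i - j)%N else al k.
have -> : mono al = g i ^+ j * mono be.
  rewrite /mono (bigD1 i) //= [in RHS](bigD1 i) //= /be eqxx mulrA -exprD subnKC //.
  by congr (_ * _); apply: eq_bigr => k /negPf ->.
apply: hW; have := @mono_pow be; congr (ideal_pow _ _ _).
rewrite (bigD1 i) //= /be eqxx -sal [in RHS](bigD1 i) //= addnBAC //.
by congr (_ + _ - _)%N; apply: eq_bigr => k /negPf ->.
Qed.

(** Divide the exponents of a monomial by [q]: the quotients form a [q]-th power, and the [mu]
    remainders take away at most [mu * q] from the degree. *)
Lemma pow_frob n q W : (0 < q)%N -> ideal W ->
  (forall z y, ideal_pow I n z -> W (z ^+ q * y)) -> ideal_pow I (q * (n + mu)) `<=` W.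
Proof.
move=> q0 iW hW; apply: pow_mono_gen => // al sal.
have -> : mono al = mono (fun i => al i %/ q)%N ^+ q * mono (fun i => al i %% q)%N.
  rewrite /mono -prodrXl -big_split; apply: eq_bigr => i _ /=.
  by rewrite -exprM -exprD -divn_eq.
apply: hW; apply: (pow_le (n := \sum_i al i %/ q)); last exact: mono_pow.
have : (\sum_i al i <= (\sum_i al i %/ q) * q + mu * q)%N.
  rewrite big_distrl /= -[X in (_ <= _ + X * _)%N]card_ord -sum_nat_const -big_split /=.
  by apply: leq_sum => i _; rewrite {1}(divn_eq (al i) q) leq_add2l ltnW // ltn_pmod.
by rewrite sal -mulnDl [(q * _)%N]mulnC leq_pmul2r // leq_add2r.
Qed.

End IdealPowers.

(** * Prime products, prime avoidance and Artin-Rees *)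

Section Noetherian.
Variable A : comNzRingType.
Hypothesis nA : noetherian A.
Implicit Types (I J K L M P Q : set A) (s : seq (set A)).

Lemma total_chain_seq (F : set (set A)) (l : seq A) : F !=set0 -> total_on F subset ->
  [set` l] `<=` \bigcup_(X in F) X -> exists2 X, F X & [set` l] `<=` X.
Proof.
move=> [X0 FX0] Ft; elim: l => [|a l IH] h; first by exists X0.
have [|X FX lX] := IH; first by move=> y yl; apply: h; rewrite /= inE yl orbT.
have [|Y FY Ya] := h a; first by rewrite /= mem_head.
have [XY|YX] := Ft _ _ FX FY.
  by exists Y => // y; rewrite /= inE => /orP[/eqP ->//|/lX/XY].
by exists X => // y; rewrite /= inE => /orP[/eqP ->|/lX//]; apply: YX.
Qed.

Lemma noetherian_max (F : set (set A)) : F !=set0 -> (forall I, F I -> ideal I) ->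
  exists2 M, F M & forall J, F J -> M `<=` J -> J = M.
Proof.
move=> [I0 FI0] Fid.
have [F' F'P tot|M [PM maxM]] := @Zorn_bigcup A (fun X => X = set0 \/ F X); last first.
  have FM : F M.
    case: PM => // M0; exfalso; apply: (maxM I0); last by right.
    rewrite M0; split=> [//|/(_ 0)]; apply; by case: (Fid _ FI0).
  exists M => // J FJ MJ; apply: contrapT => ne; apply: (maxM J); last by right.
  by split=> // JM; apply: ne; apply/seteqP.
have [[X FX [x Xx]]|no] := pselect (exists2 X, F' X & X !=set0); last first.
  left; apply/seteqP; split=> // x [X FX Xx]; exfalso; apply: no; exists X => //.
  by exists x.
pose G := F' `&` [set X | X !=set0].
have GF Y : G Y -> F Y.
  by move=> [F'Y [y Yy]]; case: (F'P _ F'Y) => // Y0; rewrite Y0 in Yy.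
have Gtot : total_on G subset by move=> Y Z [FY _] [FZ _]; apply: tot.
have G0 : G !=set0 by exists X; split=> //; exists x.
have UG : \bigcup_(Y in F') Y = \bigcup_(Y in G) Y.
  apply/seteqP; split=> y [Y FY Yy]; last by case: FY => FY _; exists Y.
  by exists Y => //; split=> //; exists y.
right; rewrite UG.
have two a b : (\bigcup_(Y in G) Y) a -> (\bigcup_(Y in G) Y) b -> exists Y, [/\ G Y, Y a & Y b].
  move=> [Y GY Ya] [Z GZ Zb]; have [YZ|ZY] := Gtot _ _ GY GZ.
    by exists Z; split=> //; apply: YZ.
  by exists Y; split=> //; apply: ZY.
have Uid : ideal (\bigcup_(Y in G) Y).
  split.
  - have [Y GY] := G0; exists Y => //; by case: (Fid _ (GF _ GY)).
  - move=> a b ha hb; have [Y [GY Ya Yb]] := two _ _ ha hb.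
    by exists Y => //; case: (Fid _ (GF _ GY)) => _ YD _; apply: YD.
  - move=> a b [Y GY Yb]; exists Y => //.
    by case: (Fid _ (GF _ GY)) => _ _ YM; apply: YM.
have [l lE] := nA Uid.
have [|Y GY lY] := @total_chain_seq G l G0 Gtot.
  by rewrite lE; apply: ideal_gen_sub.
suff -> : \bigcup_(Y in G) Y = Y by apply: GF.
apply/seteqP; split; last by move=> y Yy; exists Y.
by rewrite lE; apply: ideal_gen_min => //; apply: Fid; apply: GF.
Qed.

Lemma noetherian_gens I : ideal I -> exists n (g : 'I_n -> A), (0 < n)%N /\ I = ideal_gen (range g).
Proof.
move=> iI; have [l lE] := nA iI; exists (size (0 :: l)), (tnth (in_tuple (0 :: l))); split=> //.
rewrite -ideal_gen_seq; apply/seteqP; split.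
  by rewrite {1}lE; apply: ideal_gen_mono => x /= xl; rewrite inE xl orbT.
apply: ideal_gen_min => // x; rewrite /= inE => /orP[/eqP ->|xl]; first by case: iI.
by rewrite lE; apply: ideal_gen_sub.
Qed.

(* [contains_prod [:: P1; ..; Pr] I] says that [P1 * .. * Pr] is contained in [I]. *)
Fixpoint contains_prod s I : Prop :=
  if s is P :: s' then forall x, P x -> contains_prod s' [set y | I (x * y)] else I 1.

Lemma contains_prod_mono s I J : I `<=` J -> contains_prod s I -> contains_prod s J.
Proof.
elim: s I J => [|P s IH] I J IJ /=; first exact: IJ.
by move=> h x Px; apply: (IH) (h x Px) => y; apply: IJ.
Qed.

Lemma contains_prod_cat s1 s2 I1 I2 I : contains_prod s1 I1 -> contains_prod s2 I2 ->
  (forall u v, I1 u -> I2 v -> I (u * v)) -> contains_prod (s1 ++ s2) I.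
Proof.
elim: s1 I1 I => [|P s1 IH] I1 I /= h1 h2 hI.
  by apply: contains_prod_mono h2 => v Iv; rewrite -[v]mul1r; apply: (hI).
move=> x Px; apply: (IH [set y | I1 (x * y)]) => //; first exact: h1.
by move=> u v /= Iu Iv; rewrite mulrA; apply: (hI).
Qed.

Lemma prime_contains s I Q : prime_ideal Q -> contains_prod s I -> I `<=` Q ->
  exists2 P, List.In P s & P `<=` Q.
Proof.
move=> [[iQ Q1] QM]; elim: s I => [|P s IH] I /=; first by move=> I1 /(_ _ I1).
move=> h IQ; have [PQ|/existsNP[x /not_implyP[Px nQx]]] := pselect (P `<=` Q).
  by exists P => //; left.
have [y /IQ/QM[]//|P' P's P'Q] := IH _ (h x Px).
by exists P' => //; right.
Qed.

(** A maximal counterexample [M] is not prime; if [x * y] lies in [M], the products found for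
    [M + (x)] and [M + (y)] multiply into [M]. *)
Lemma prime_product I : ideal I -> exists2 s, (forall P, List.In P s -> prime_ideal P /\ I `<=` P) &
  contains_prod s I.
Proof.
move=> iI; apply: contrapT => bad.
pose F := [set J | ideal J /\ ~ exists2 s, (forall P, List.In P s -> prime_ideal P /\ J `<=` P) &
  contains_prod s J].
have [||M [iM badM] maxM] := @noetherian_max F.
- by exists I.
- by move=> J [].
have M1 : ~ M 1 by move=> M1; apply: badM; exists [::].
apply: badM.
have [pM|npM] := pselect (prime_ideal M).
  exists [:: M] => /= [P [<-|//]|x Mx]; first by split.
  by rewrite mulr1.
have [x [y [Mxy [nMx nMy]]]] : exists x y, M (x * y) /\ ~ M x /\ ~ M y.
  apply: contrapT => no; apply: npM; split=> // x y Mxy.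
  have [Mx|nMx] := pselect (M x); first by left.
  by right; apply: contrapT => nMy; apply: no; exists x, y.
have good z : ~ M z -> exists2 s, (forall P, List.In P s -> prime_ideal P /\ M `<=` P) &
    contains_prod s (ideal_add M (cyc idfun z)).
  move=> nMz; have iz : ideal (ideal_add M (cyc idfun z)).
    by apply: (submod_add (phi := idfun)) => //; apply: submod_cyc.
  have Mz : M `<=` ideal_add M (cyc idfun z) by apply: sub_addl; apply: submod_cyc.
  apply: contrapT => nz; apply: nMz.
  rewrite -(maxM (ideal_add M (cyc idfun z))) //; first by apply: ideal_addr (cyc_id _ _); case: iM.
  split=> // -[s s1 s2]; apply: nz; exists s => // P /s1[pP zP]; split=> //.
  exact: subset_trans zP.
have [s1 h1 h1'] := good x nMx; have [s2 h2 h2'] := good y nMy.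
have [M0 MD MM] := iM.
exists (s1 ++ s2).
  by move=> P /List.in_app_iff[/h1|/h2].
apply: (contains_prod_cat h1' h2') => _ _ [u [_ [Mu [a _ <-] ->]]] [v [_ [Mv [b _ <-] ->]]].
have -> : (u + idfun a * x) * (v + idfun b * y) =
    (v + b * y) * u + (a * x) * v + (a * b) * (x * y) by rewrite /=; ring.
by apply: (MD); [apply: MD|]; apply: MM.
Qed.

Lemma prime_avoidance s J : ideal J ->
  (forall P, List.In P s -> prime_ideal P /\ ~ (J `<=` P)) ->
  exists2 y, J y & forall P, List.In P s -> ~ P y.
Proof.
move=> iJ; have [J0 JD JM] := iJ.
move: {2}(size s) (leqnn (size s)) => n; elim: n s => [|n IH] [|P s] // sz hs.
- by exists 0.
- by exists 0.
have [[P' P's P'P]|noP] := pselect (exists2 P', List.In P' s & P' `<=` P).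
  have [l1 [l2 sE]] := List.in_split _ _ P's.
  have [||y Jy hy] := IH (P :: l1 ++ l2).
  - by move: sz; rewrite sE /= !size_cat /= addnS.
  - move=> Q /= [<-|Ql]; apply: hs => /=; first by left.
    right; rewrite sE; apply/List.in_app_iff; move/List.in_app_iff: Ql => [|] h; first by left.
    by right; right.
  exists y => // Q /= [<-|]; first by apply: hy; left.
  rewrite sE => /List.in_app_iff [h|[<-|h]].
  - by apply: hy; right; apply/List.in_app_iff; left.
  - by move=> /P'P; apply: hy; left.
  - by apply: hy; right; apply/List.in_app_iff; right.
have [||y Jy hy] := IH s; first by [].
  by move=> Q Qs; apply: hs; right.
have [Py|nPy] := pselect (P y); last by exists y => // Q /= [<-|/hy].
have [pP nJP] := hs P (or_introl erefl).
have [[iP P1] PM] := pP; have [P0 PD PMM] := iP.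
have /existsNP[z /not_implyP[Jz nPz]] := nJP.
have [t [Jt nPt ht]] : exists t, [/\ J t, ~ P t & forall Q, List.In Q s -> Q t].
  have : forall Q, List.In Q s -> ideal Q /\ ~ (Q `<=` P).
    move=> Q Qs; have [[[iQ _] _] _] := hs Q (or_intror Qs); split=> // QP.
    by apply: noP; exists Q.
  elim: s {IH sz hs noP hy} => [|Q s IH] h; first by exists z.
  have [|t [Jt nPt ht]] := IH; first by move=> Q' h'; apply: h; right.
  have [[_ _ QM] /existsNP[w /not_implyP[Qw nPw]]] := h Q (or_introl erefl).
  exists (w * t); split; first exact: JM.
    by move/PM => [].
  move=> Q' /= [<-|Q's]; first by rewrite mulrC; apply: (QM).
  have [[_ _ Q'M] _] := h Q' (or_intror Q's); apply: Q'M; exact: ht.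
exists (y + t); first exact: JD.
move=> Q /= [<-|Qs] h.
  apply: nPt; have -> : t = (y + t) + (-1) * y by ring.
  by apply: (PD) => //; apply: (PMM).
apply: (hy Q Qs); have [[[_ QD QM] _] _] := (hs Q (or_intror Qs)).1.
have -> : y = (y + t) + (-1) * t by ring.
by apply: (QD) => //; apply: (QM); apply: ht.
Qed.

(** Among the ideals containing [I ^ j K] and meeting [K] inside it, take a maximal [L]. For [y] in
    [I] the colons of [L] by powers of [y] stabilize at some [n], and then adding [y ^+ n] to [L]
    keeps the property, so [y ^+ n] lies in [L]. Hence a power of [I] lies in [L]. *)
Lemma artin_rees I K j : ideal I -> ideal K -> exists N,
  ideal_pow I N `&` K `<=` ideal_gen [set z | exists x y, [/\ ideal_pow I j x, K y & z = x * y]].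
Proof.
move=> iI iK; set PK := ideal_gen _.
have [K0 KD KM] := iK.
have iPK : ideal PK by apply: ideal_genP.
have PKK : PK `<=` K by apply: ideal_gen_min iK _ => _ [x [y [_ Ky ->]]]; apply: KM.
pose F := [set L | [/\ ideal L, PK `<=` L & L `&` K `<=` PK]].
have [||L [iL PKL LK] maxL] := @noetherian_max F.
- by exists PK; split=> // x [].
- by move=> L [].
have [L0 LD LM] := iL.
have pow_in y : I y -> exists n, L (y ^+ n).
  move=> Iy; pose C n := [set a | L (a * y ^+ n)].
  have iC n : ideal (C n).
    split; first by rewrite /C /= mul0r.
      by move=> a b; rewrite /C /= mulrDl; apply: (LD).
    by move=> a b; rewrite /C /= -mulrA; apply: (LM).
  have [||_ [n _ <-] maxC] := @noetherian_max (range C).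
  - by exists (C 0%N), 0%N.
  - by move=> _ [n _ <-].
  exists n; pose L' := ideal_add L (cyc idfun (y ^+ n)).
  have sL' : submod idfun L' by apply: submod_add => //; apply: submod_cyc.
  have LL' : L `<=` L' by apply: sub_addl; apply: submod_cyc.
  rewrite -(maxL L') //; first by apply: ideal_addr => //; apply: cyc_id.
  split=> //; first exact: subset_trans LL'.
  move=> _ [[l [_ [Ll [a _ <-] ->]]] Kz]; apply: LK; split=> //; apply: (LD) => //=.
  suff : C n a by [].
  rewrite -(maxC (C (n + j)%N)); last first.
  - by move=> b; rewrite /C /= exprD mulrA => h; rewrite mulrC; apply: (LM).
  - by exists (n + j)%N.
  rewrite /C /= exprD mulrA.
  have -> : a * y ^+ n * y ^+ j = y ^+ j * (l + idfun a * y ^+ n) + (- y ^+ j) * l.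
    by rewrite /=; ring.
  apply: (LD); last exact: LM.
  apply: PKL; apply: ideal_gen_sub; exists (y ^+ j), (l + idfun a * y ^+ n); split=> //.
  exact: pow_exp.
have [mu [g [mu0 gE]]] := noetherian_gens iI.
have /choice[n hn] i : exists n, L (g i ^+ n).
  by apply: pow_in; rewrite gE; apply: ideal_gen_sub; exists i.
pose M := (\max_i n i)%N.
exists (mu * M)%N => z [hz Kz]; apply: LK; split=> //.
apply: (pow_pigeon gE mu0 (leqnn _) iL) hz => i y _; rewrite mulrC; apply: (LM).
by rewrite -(subnK (leq_bigmax i : n i <= M)%N) exprD; apply: (LM).
Qed.

End Noetherian.

(** * Chains of primes, local rings and parameters *)

Definition prime_chain (A : comNzRingType) (l : nat) : Prop := exists c : nat -> set A,
  (forall i, (i <= l)%N -> prime_ideal (c i)) /\ (forall i, (i < l)%N -> c i `<` c i.+1).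

(** A positive value cannot be the default [0] that the supremum takes on an unbounded set. *)
Lemma prime_chain_le (A : comNzRingType) : (0 < krull_dim A)%N ->
  forall l, prime_chain A l -> (l <= krull_dim A)%N.
Proof.
have -> : krull_dim A = supremum 0%N [set l | prime_chain A l] by [].
have [[N ubN]|no] := pselect (ubound [set l | prime_chain A l] !=set0); last first.
  rewrite supremum_out //; move=> -[_ ub]; apply: no; exact: ub.
move=> _ l hl; have [||_ h] := @supremum_natP [set l | prime_chain A l] N.
- by exists l.
- by move=> n /ubN; rewrite leEnat.
exact: h.
Qed.

Lemma krull_dim_eq (A : comNzRingType) d : prime_chain A d ->
  (forall l, prime_chain A l -> (l <= d)%N) -> krull_dim A = d.
Proof.
move=> cd hd; have -> : krull_dim A = supremum 0%N [set l | prime_chain A l] by [].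
have [||h1 h2] := @supremum_natP [set l | prime_chain A l] d.
- by exists d.
- exact: hd.
by apply/eqP; rewrite eqn_leq hd //= h2.
Qed.

Lemma krull_dim_attained (A : comNzRingType) N : (exists P : set A, prime_ideal P) ->
  (forall l, prime_chain A l -> (l <= N)%N) -> prime_chain A (krull_dim A) /\
  (forall l, prime_chain A l -> (l <= krull_dim A)%N).
Proof.
move=> [P pP] hN; apply: supremum_natP hN; exists 0%N; exists (fun=> P); by split.
Qed.

Section LocalRings.
Variable A : comNzRingType.
Hypothesis lA : noetherian_local A.
Local Notation m := (max_ideal A).
Implicit Types (I J P : set A).

Lemma local_noetherian : noetherian A. Proof. by case: lA. Qed.

Lemma max_idealP : maximal_ideal m.
Proof. by have [_ [M [hM _]]] := lA; rewrite /max_ideal; case: xgetP => // /(_ M). Qed.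

Lemma max_ideal_unique M : maximal_ideal M -> M = m.
Proof. by have [_ [M' [_ u]]] := lA => /u <-; apply: u; apply: max_idealP. Qed.

Lemma max_ideal_ideal : ideal m. Proof. by have [[]] := max_idealP. Qed.
Lemma max_ideal1 : ~ m 1. Proof. by have [[]] := max_idealP. Qed.

Lemma proper_sub_max I : ideal_proper I -> I `<=` m.
Proof.
move=> pI.
have [||M [pM IM] maxM] := @noetherian_max A local_noetherian [set J | ideal_proper J /\ I `<=` J].
- by exists I; split.
- by move=> J [[]].
suff <- : M = m by [].
apply: max_ideal_unique; split=> // J pJ MJ; apply: maxM => //.
by split=> //; apply: subset_trans MJ.
Qed.

Lemma max_ideal_unit t : ~ m t -> exists t', t' * t = 1.
Proof.
move=> mt; apply: contrapT => nt; apply: mt; apply: (@proper_sub_max (cyc idfun t)).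
  split; first exact: (submod_cyc idfun).
  by move=> [t' _ h]; apply: nt; exists t'.
exact: cyc_id.
Qed.

Lemma max_ideal_inv t : ~ m t -> exists t', m (1 - t' * t).
Proof.
move=> /max_ideal_unit[t' e]; exists t'.
by rewrite e subrr; case: max_ideal_ideal.
Qed.

Lemma max_ideal_prime : prime_ideal m.
Proof.
split; first by case: max_idealP.
move=> x y mxy; have [mx|/max_ideal_unit[t tx]] := pselect (m x); first by left.
right; rewrite -[y]mul1r -tx -mulrA; have [_ _ mM] := max_ideal_ideal; exact: mM.
Qed.

Lemma prime_sub_max P : prime_ideal P -> P `<=` m.
Proof. by case=> pP _; apply: proper_sub_max. Qed.

Lemma prime_over_max P : prime_ideal P -> m `<=` P -> P = m.
Proof. by move=> pP mP; apply/seteqP; split=> //; apply: prime_sub_max. Qed.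

Lemma len_le_pow n : exists C, forall I, ideal I -> ideal_pow m n `<=` I ->
  len_le idfun I setT C.
Proof.
have [mu [g [_ gE]]] := noetherian_gens local_noetherian max_ideal_ideal.
have mg t : m t -> exists c : 'I_mu -> A, exists r : seq 'I_mu, t = \sum_(s <- r) c s * g s.
  by rewrite gE ideal_gen_lin => -[b ->]; exists b, (index_enum _).
exists (n ^ mu)%N => I iI nI; have sI : submod idfun I := iI.
have [||l le tl] := @tower_cyc _ _ idfun m _ g n (enum 'I_mu) I 1 mg sI.
- by move=> t; rewrite mem_enum.
- move=> t _; rewrite mulr1; apply: nI; apply: pow_exp; rewrite gE.
  by apply: ideal_gen_sub; exists t.
have [_ _ ll] := tower_fin max_ideal_inv sI tl; rewrite size_enum_ord in le.
move=> j hj; apply: leq_trans le; apply: ll; apply: has_chain_widen hj => // a _.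
by apply: ideal_addr; [exact: submod0 sI|exists a => //; rewrite mulr1].
Qed.

Lemma len_fin_pow I n : ideal I -> ideal_pow m n `<=` I -> len_fin idfun I setT.
Proof. by move=> iI hn; have [C hC] := len_le_pow n; exists C; apply: hC. Qed.

Lemma contains_max_pow s I : ideal I -> contains_prod s I ->
  (forall P, List.In P s -> P = m) -> ideal_pow m (size s) `<=` I.
Proof.
elim: s I => [|P s IH] I iI /=.
  by have [_ _ IM] := iI; move=> I1 _ a _; rewrite -[a]mulr1; apply: IM.
move=> h hP; rewrite -add1n; apply: pow_split => // x y.
rewrite (pow1 max_ideal_ideal) => mx hy.
have iJ : ideal [set y | I (x * y)] by apply: (submod_colon (phi := idfun) x).
apply: (IH [set y | I (x * y)]) => //.
  by apply: h; rewrite (hP P) //; left.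
by move=> Q Qs; apply: hP; right.
Qed.

(** [I] contains the parameters chosen so far. Every prime over [I] contains one from a finite list
    with product inside [I]; an element [y] of [m] outside those listed primes that differ from [m]
    shortens every chain above [I + (y)]. *)
Lemma system_of_parameters n I : ideal I -> I `<=` m ->
  (forall l c, (forall i, (i <= l)%N -> prime_ideal (c i) /\ I `<=` c i) ->
     (forall i, (i < l)%N -> c i `<` c i.+1) -> (l <= n)%N) ->
  exists x : 'I_n -> A, (forall i, m (x i)) /\ exists c, forall J, ideal J ->
    I `<=` J -> (forall i, J (x i)) -> ideal_pow m c `<=` J.
Proof.
elim: n I => [|n IH] I iI Im hI; have [s sI sprod] := prime_product local_noetherian iI.
  exists (fun=> 0); split; first by case.
  exists (size s) => J iJ IJ _; apply: subset_trans IJ; apply: contains_max_pow => // P Ps.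
  have [pP IP] := sI P Ps; apply: contrapT => ne.
  suff : (1 <= 0)%N by [].
  apply: (hI 1%N (fun i => if i is 0%N then P else m)).
    by case=> [|i] _; split=> //; exact: max_ideal_prime.
  move=> [|//] _; split; first exact: prime_sub_max.
  by move=> mP; apply: ne; apply: prime_over_max.
pose s' := [seq P <- s | `[< ~ (m `<=` P) >]].
have s'P P : List.In P s' <-> List.In P s /\ ~ (m `<=` P).
  rewrite /s'; elim: (s) => [|Q r IHr] /=; first by split=> // -[].
  case: asboolP => h /=; split.
  - by move=> [<-|/IHr []]; split=> //; [left|right].
  - by move=> [[<-|h1] h2]; [left|right; apply/IHr].
  - by move/IHr => [h1 h2]; split=> //; right.
  - by move=> [[e|h1] h2]; [case: h; rewrite e|apply/IHr].
have [P /s'P[/sI[pP _] nP]|y my hy] := @prime_avoidance A s' m max_ideal_ideal; first by split.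
have iI' : ideal (ideal_add I (cyc idfun y)).
  by apply: (submod_add (phi := idfun)) => //; apply: submod_cyc.
have II' : I `<=` ideal_add I (cyc idfun y) by apply: (sub_addl (submod_cyc idfun y)).
have I'y : ideal_add I (cyc idfun y) y by apply: ideal_addr; [case: iI|exact: cyc_id].
have [||x [mx [c hc]]] := IH _ iI'.
- apply: (ideal_add_sub (phi := idfun)) => //; first exact: max_ideal_ideal.
  by apply: cyc_sub => //; exact: max_ideal_ideal.
- move=> l c hc1 hc2.
  have [p0 I0] := hc1 0%N isT.
  have [P Ps Pc] := prime_contains p0 sprod (subset_trans II' I0).
  have [mP|nmP] := pselect (m `<=` P).
    case: l hc1 hc2 => // l hc1 hc2; have [_ []] := hc2 0%N isT.
    have [p1 _] := hc1 1%N isT.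
    by apply: (subset_trans (prime_sub_max p1)); apply: subset_trans Pc.
  have [pP IP] := sI P Ps.
  rewrite -ltnS; apply: (hI l.+1 (fun i => if i is j.+1 then c j else P)).
    case=> [|i] ilt //; have [pc Ic] := hc1 i ilt; split=> //; exact: subset_trans Ic.
  case=> [_|i ilt]; last exact: hc2.
  split=> // cP; apply: (hy P); first exact/s'P.
  by apply: cP; apply: I0.
exists (fun i => oapp x y (unlift ord0 i)); split.
  by move=> i; case: unliftP => [j|] _ /=.
exists c => J iJ IJ hJ; apply: hc => //.
  apply: (ideal_add_sub (phi := idfun)) => //; apply: cyc_sub => //.
  by have := hJ ord0; rewrite unlift_none.
by move=> i; have := hJ (lift ord0 i); rewrite liftK.
Qed.

Lemma sop_dim d : (forall l, prime_chain A l -> (l <= d)%N) ->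
  exists x : 'I_d -> A, (forall i, m (x i)) /\
    exists c, ideal_pow m c `<=` ideal_gen (range x).
Proof.
move=> hd; have [|||x [mx [c hc]]] := @system_of_parameters d [set 0].
- by split=> [//|_ _ -> ->|a _ ->]; rewrite ?addr0 ?mulr0.
- by move=> _ ->; case: max_ideal_ideal.
- by move=> l c hc1 hc2; apply: hd; exists c; split=> // i /hc1[].
exists x; split=> //; exists c; apply: hc; first exact: ideal_genP.
  by move=> _ ->; case: (ideal_genP (range x)).
by move=> i; apply: ideal_gen_sub; exists i.
Qed.

End LocalRings.

(** * The completion as a finite algebra over a power series ring *)

Section PolynomialOrder.
Variables (d : nat) (k : fieldType).
Local Notation Q := (mpoly d k).
Local Notation X := (fun t : 'I_d => mpolyX k (mnm1 t)).

Definition mord (n : nat) : set Q := [set f | forall m, m \in msupp f -> (n <= mdeg m)%N].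

Lemma mord_ideal n : submod idfun (mord n).
Proof.
split.
- by move=> m; rewrite msupp0.
- by move=> f g hf hg m /msuppD_le; rewrite mem_cat => /orP[/hf|/hg].
- move=> f g hg m /msuppM_le /allpairsP[[m1 m2] [/= h1 h2 ->]].
  by rewrite mdegD; apply: leq_trans (hg _ h2) (leq_addl _ _).
Qed.

Lemma mordM a b f g : mord a f -> mord b g -> mord (a + b) (f * g).
Proof.
move=> hf hg m /msuppM_le /allpairsP[[m1 m2] [/= h1 h2 ->]].
by rewrite mdegD leq_add ?hf ?hg.
Qed.

Lemma mord_le a b : (a <= b)%N -> mord b `<=` mord a.
Proof. by move=> le f hf m /hf; apply: leq_trans. Qed.

Lemma mord_proper : ~ mord 1 1.
Proof. by move=> /(_ (@mnm0 d)); rewrite msupp1 mem_seq1 eqxx mdeg0; move/(_ isT). Qed.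

Definition mord_filtration : filtration Q :=
  Filtration mord_ideal (fun n => @mord_le n n.+1 (leqnSn n)) mord_proper.

Lemma mordX m : mord (mdeg m) (mpolyX k m).
Proof. by move=> m'; rewrite msuppX mem_seq1 => /eqP ->. Qed.

Lemma mord_const f : mord 1 (f - mpolyC d (mcoeff (@mnm0 d) f)).
Proof.
move=> m; rewrite mcoeff_msupp mcoeffB mcoeffC lt0n; apply: contraNneq => /eqP.
by rewrite mdeg_eq0 => /eqP ->; rewrite eqxx mulr1 subrr.
Qed.

(** Lowest homogeneous components multiply to a nonzero form, polynomials over [k] being a
    domain. *)
Lemma mord_val v w f g : mord v f -> ~ mord v.+1 f -> mord w g -> ~ mord w.+1 g ->
  ~ mord (v + w).+1 (f * g).
Proof.
have split_low u h : mord u h -> ~ mord u.+1 h -> exists h0,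
    [/\ h0 != 0, h0 \is ishomog1 u (@mdeg d) & mord u.+1 (h - h0)].
  move=> hu nu; pose h0 := pihomog (@mdeg d) u h.
  have hh : mord u.+1 (h - h0).
    have -> : h - h0 = \sum_(m <- msupp h | mdeg m != u) mcoeff m h *: mpolyX k m.
      rewrite {1}(mpolyE h) (bigID (fun m => mdeg m == u)) /= /h0 /pihomog /=.
      by rewrite addrC addrK.
    rewrite big_seq_cond; apply: (submod_sum (mord_ideal _)) => m /andP[mh mu].
    move=> m' /msuppZ_le; rewrite msuppX mem_seq1 => /eqP ->.
    by rewrite ltn_neqAle eq_sym mu hu.
  exists h0; split=> //; last exact: pihomogP.
  by apply/eqP => h00; apply: nu; move: hh; rewrite h00 subr0.
move=> hf nf hg ng hfg.
have [f0 [f00 hf0 hf1]] := split_low _ _ hf nf.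
have [g0 [g00 hg0 hg1]] := split_low _ _ hg ng.
have homog_ord u h : h \is ishomog1 u (@mdeg d) -> mord u h.
  by move/dhomogP => hh m /hh ->.
have h0 : mord (v + w).+1 (f0 * g0).
  have -> : f0 * g0 = f * g - (f - f0) * g - f0 * (g - g0) by ring.
  apply: (submodB (mord_ideal _)); last first.
    by rewrite -addnS; apply: mordM => //; apply: homog_ord.
  apply: (submodB (mord_ideal _)) => //.
  by rewrite -addSn; apply: mordM.
have /dhomogP hom := dhomogM hf0 hg0.
have [m hm] : exists m, m \in msupp (f0 * g0).
  have : msupp (f0 * g0) != [::] by rewrite msupp_eq0 mulf_neq0.
  by case: (msupp _) => // m l _; exists m; rewrite mem_head.
by have := h0 m hm; rewrite (hom m hm) ltnn.
Qed.

(** Two instances matter: [e = N = 1], which generates the maximal ideal by the variables, and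
    [N = d * e], where the hypothesis on multidegrees is the pigeonhole principle. *)
Lemma mord_gen e N j f : (e <= N)%N ->
  (forall m : multinom d, (N <= mdeg m)%N -> exists t : 'I_d, (e <= m t)%N) ->
  mord (N + j) f -> exists z : 'I_d -> Q, (forall t, mord j (z t)) /\
    f = \sum_t z t * X t ^+ e.
Proof.
move=> eN he hf.
rewrite (mpolyE f) big_seq; elim/big_ind: _ => [|g h [z [hz ->]] [z' [hz' ->]]|m mf].
- exists (fun=> 0); split=> [t|]; first exact: submod0 (mord_ideal _).
  by rewrite big1 // => t _; rewrite mul0r.
- exists (fun t => z t + z' t); split=> [t|]; first exact: (submodD (mord_ideal _)).
  by rewrite -big_split; apply: eq_bigr => t _; rewrite mulrDl.
have mN := hf m mf.
have [t te] := he m (leq_trans (leq_addr _ _) mN).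
have le : lem (mnm_muln (mnm1 t) e) m.
  apply/mnm_lepP => i; rewrite mulmnE mnm1E.
  by case: eqP => [<-|]; rewrite ?mul1n ?mul0n.
pose m' := mnm_sub m (mnm_muln (mnm1 t) e).
have mE : m = mnm_add m' (mnm_muln (mnm1 t) e) by rewrite submK.
exists (fun i => if i == t then mcoeff m f *: mpolyX k m' else 0); split=> [i|].
  case: eqP => _; last exact: submod0 (mord_ideal _).
  have : mord j (mpolyX k m').
    apply: mord_le (@mordX m'); move: mN; rewrite [in X in (_ <= X)%N]mE mdegD mdegMn mdeg1 mul1n.
    by lia.
  by move=> h a /msuppZ_le; apply: h.
rewrite (bigD1 t) //= eqxx big1 ?addr0; last by move=> i /negPf ->; rewrite mul0r.
by rewrite mpolyXn -scalerAl -mpolyXD -mE.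
Qed.

End PolynomialOrder.

Lemma dependent_seq (X : Type) (P : nat -> X -> Prop) (R : nat -> X -> X -> Prop) x0 :
  P 0%N x0 -> (forall n x, P n x -> exists y, P n.+1 y /\ R n x y) ->
  exists f : nat -> X, [/\ f 0%N = x0, forall n, P n (f n) & forall n, R n (f n) (f n.+1)].
Proof.
move=> P0 h; have /choice[s hs] (nx : nat * X) : exists y, P nx.1 nx.2 -> P nx.1.+1 y /\ R nx.1 nx.2 y.
  have [Px|nPx] := pselect (P nx.1 nx.2); last by exists x0.
  by have [y hy] := h _ _ Px; exists y.
pose f := fix f n := if n is n'.+1 then s (n', f n') else x0.
have Pf n : P n (f n) by elim: n => //= n IH; case: (hs (n, f n) IH).
by exists f; split=> // n; case: (hs (n, f n) (Pf n)).
Qed.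

Lemma spanP (B A : comNzRingType) (phi : {rmorphism B -> A}) (l : seq A) a :
  span phi l a <-> exists c : nat -> B, a = \sum_(t < size l) phi (c t) * l`_t.
Proof.
elim: l a => [|x l IH] a /=.
  split=> [->|[c ->]]; last by rewrite big_ord0.
  by exists (fun=> 0); rewrite big_ord0.
split=> [[_ [y [[t _ <-] /IH[c ->] ->]]]|[c ->]].
  by exists (fun n => if n is n'.+1 then c n' else t); rewrite big_ord_recl.
rewrite big_ord_recl; exists (phi (c 0%N) * x), (\sum_(t < size l) phi (c t.+1) * l`_t).
by split=> //; [exists (c 0%N)|apply/IH; exists (fun n => c n.+1)].
Qed.

Section CompletionProperties.
Variables (A Ah : comNzRingType) (F : filtration A) (i : {rmorphism A -> Ah}).
Variables (FF : nat -> set Ah) (C : is_completion F i FF).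

Lemma compl_le m n : (m <= n)%N -> FF n `<=` FF m.
Proof.
elim: n => [|n IH]; first by rewrite leqn0 => /eqP ->.
rewrite leq_eqVlt => /orP[/eqP ->//|lt]; apply: subset_trans (IH lt).
exact: compl_mono C n.
Qed.

Lemma compl_gen (r : nat) (g : 'I_r -> A) N w :
  (forall j a, F (N + j)%N a -> exists z : 'I_r -> A,
     (forall t, F j (z t)) /\ a = \sum_t z t * g t) ->
  FF N w -> exists z : 'I_r -> Ah, w = \sum_t z t * i (g t).
Proof.
move=> hg hw; have sF := compl_ideal C.
have [||f [_ Pf Rf]] := @dependent_seq ('I_r -> A)
    (fun j z => FF (N + j)%N (w - i (\sum_t z t * g t)))
    (fun j z z' => forall t, F j (z' t - z t)) (fun=> 0).
- by rewrite addn0 big1 ?rmorph0 ?subr0 // => t _; rewrite mul0r.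
- move=> j z hz; have [a ha] := compl_dense C (N + j.+1) (w - i (\sum_t z t * g t)).
  have Fa : F (N + j)%N a.
    apply/(compl_emb C).
    have -> : i a = (w - i (\sum_t z t * g t)) - (w - i (\sum_t z t * g t) - i a) by ring.
    by apply: (submodB (sF _)) => //; apply: compl_le ha; rewrite leq_add2l.
  have [z' [hz' aE]] := hg j a Fa.
  exists (fun t => z t + z' t); split=> [|t]; last by rewrite addrC addKr.
  have -> : w - i (\sum_t (z t + z' t) * g t) = w - i (\sum_t z t * g t) - i a.
    rewrite aE (eq_bigr _ (fun t _ => mulrDl (z t) (z' t) (g t))) big_split rmorphD.
    by rewrite opprD addrA.
  exact: ha.
have /choice[z hz] t : exists z, forall n, FF n (z - i (f n t)).
  by apply: (compl_lim C) => n; rewrite -rmorphB; apply/(compl_emb C).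
exists z; apply/eqP; rewrite -subr_eq0; apply/eqP; apply: (compl_sep C) => n.
have -> : w - \sum_t z t * i (g t) =
    (w - i (\sum_t f n t * g t)) - \sum_t i (g t) * (z t - i (f n t)).
  rewrite rmorph_sum.
  rewrite [X in _ = _ - X](_ : _ = \sum_t z t * i (g t) - \sum_t i (f n t * g t)).
    by ring.
  by rewrite -sumrB; apply: eq_bigr => t _; rewrite rmorphM; ring.
apply: (submodB (sF n)); first by apply: compl_le (Pf n); apply: leq_addl.
by apply: (submod_sum (sF n)) => t _; apply: (submodM _ (sF n)).
Qed.

(* A map into [Ah] known modulo each [FF n] by compatible data is a ring morphism. *)
Lemma compl_morphism (Q : comNzRingType) (app : nat -> Q -> Ah -> Prop) :
  (forall n w, exists z, app n w z) ->
  (forall n w z, app n.+1 w z -> app n w z) ->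
  (forall n w z z', app n w z -> app n w z' -> FF n (z - z')) ->
  (forall n, app n 1 1) ->
  (forall n w w' z z', app n w z -> app n w' z' -> app n (w - w') (z - z')) ->
  (forall n w w' z z', app n w z -> app n w' z' -> app n (w * w') (z * z')) ->
  exists phi : {rmorphism Q -> Ah}, forall n w z, app n w z -> FF n (phi w - z).
Proof.
move=> aex amono auniq a1 aB aM; have sF := compl_ideal C.
have /choice[s hs] (nw : nat * Q) : exists z, app nw.1 nw.2 z by apply: aex.
have /choice[phi hphi] w : exists z, forall n, FF n (z - s (n, w)).
  apply: (compl_lim C) => n; apply: (auniq n w) (hs (n, w)).
  by apply: amono; exact: (hs (n.+1, w)).
have key n w z : app n w z -> FF n (phi w - z).
  move=> az; have -> : phi w - z = (phi w - s (n, w)) + (s (n, w) - z) by ring.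
  by apply: (submodD (sF n)) => //; apply: auniq (hs (n, w)) az.
have uniq w z : (forall n, exists2 u, app n w u & FF n (z - u)) -> phi w = z.
  move=> h; apply/eqP; rewrite -subr_eq0; apply/eqP; apply: (compl_sep C) => n.
  have [u au zu] := h n; have -> : phi w - z = (phi w - u) - (z - u) by ring.
  by apply: (submodB (sF n)) => //; apply: key.
have pB : zmod_morphism phi.
  move=> w w'; apply: uniq => n; exists (s (n, w) - s (n, w')); first by apply: aB; exact: (hs (n, _)).
  have -> : phi w - phi w' - (s (n, w) - s (n, w')) =
    (phi w - s (n, w)) - (phi w' - s (n, w')) by ring.
  exact: (submodB (sF n)).
have pM : monoid_morphism phi.
  split.
    by apply: uniq => n; exists 1 => //; rewrite subrr; apply: submod0 (sF n).
  move=> w w'; apply: uniq => n; exists (s (n, w) * s (n, w')); first by apply: aM; exact: (hs (n, _)).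
  have -> : phi w * phi w' - s (n, w) * s (n, w') =
    phi w' * (phi w - s (n, w)) + s (n, w) * (phi w' - s (n, w')) by ring.
  by apply: (submodD (sF n)); apply: (submodM _ (sF n)).
pose phia := GRing.isZmodMorphism.Build Q Ah phi pB.
pose phim := GRing.isMonoidMorphism.Build Q Ah phi pM.
by exists (HB.pack_for {rmorphism Q -> Ah} phi phia phim).
Qed.

Lemma compl_extend (Q Qh : comNzRingType) (G : filtration Q) (j : {rmorphism Q -> Qh})
    (GG : nat -> set Qh) (phi0 : {rmorphism Q -> Ah}) :
  is_completion G j GG -> (forall n f, G n f -> FF n (phi0 f)) ->
  exists phi : {rmorphism Qh -> Ah}, (forall f, phi (j f) = phi0 f) /\
    forall n w, GG n w -> FF n (phi w).
Proof.
move=> C' h0; have sF := compl_ideal C; have sG := compl_ideal C'.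
pose app n (w : Qh) (z : Ah) := exists2 f, GG n (w - j f) & FF n (z - phi0 f).
have [|||||| phi hphi] := @compl_morphism Qh app.
- move=> n w; have [f hf] := compl_dense C' n w; exists (phi0 f), f => //.
  by rewrite subrr; apply: submod0 (sF n).
- move=> n w z [f hf hz]; exists f; first exact: (compl_mono C').
  exact: (compl_mono C).
- move=> n w z z' [f hf hz] [f' hf' hz'].
  have -> : z - z' = (z - phi0 f) - (z' - phi0 f') + phi0 (f - f') by rewrite rmorphB; ring.
  apply: (submodD (sF n)); first exact: (submodB (sF n)).
  apply: h0; apply/(compl_emb C'); rewrite rmorphB.
  have -> : j f - j f' = (w - j f') - (w - j f) by ring.
  exact: (submodB (sG n)).
- by move=> n; exists 1; rewrite rmorph1 subrr; [apply: submod0 (sG n)|apply: submod0 (sF n)].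
- move=> n w w' z z' [f hf hz] [f' hf' hz']; exists (f - f'); rewrite rmorphB.
    have -> : w - w' - (j f - j f') = (w - j f) - (w' - j f') by ring.
    exact: (submodB (sG n)).
  have -> : z - z' - (phi0 f - phi0 f') = (z - phi0 f) - (z' - phi0 f') by ring.
  exact: (submodB (sF n)).
- move=> n w w' z z' [f hf hz] [f' hf' hz']; exists (f * f'); rewrite rmorphM.
    have -> : w * w' - j f * j f' = w' * (w - j f) + j f * (w' - j f') by ring.
    by apply: (submodD (sG n)); apply: (submodM _ (sG n)).
  have -> : z * z' - phi0 f * phi0 f' = z' * (z - phi0 f) + phi0 f * (z' - phi0 f') by ring.
  by apply: (submodD (sF n)); apply: (submodM _ (sF n)).
exists phi; split=> [f|n w hw].
  apply/eqP; rewrite -subr_eq0; apply/eqP; apply: (compl_sep C) => n; apply: hphi.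
  by exists f; rewrite subrr; [apply: submod0 (sG n)|apply: submod0 (sF n)].
rewrite -[phi w]subr0; apply: hphi; exists 0; rewrite rmorph0 subr0 //.
exact: submod0 (sF n).
Qed.

(** Two lifts in [D n] of the same residue differ by an element of [F n.+1], so the lifts converge
    and [k] embeds in the completion as a coefficient field. *)
Lemma compl_section (k : fieldType) (pi : {rmorphism A -> k}) (D : nat -> set A) :
  (forall n, subring (D n)) -> (forall n, D n.+1 `<=` D n) -> (forall n, pi_onto pi (D n)) ->
  (forall n z, D n z -> pi z = 0 -> F n.+1 z) ->
  exists sigma : {rmorphism k -> Ah}, forall c a, pi a = c -> (forall z, pi z = 0 -> F 1%N z) ->
    FF 1%N (sigma c - i a).
Proof.
move=> sD dD oD hD; have sF := compl_ideal C.
pose app n (c : k) (z : Ah) := exists2 a, D n a /\ pi a = c & FF n (z - i a).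
have [||||||sigma hs] := @compl_morphism k app.
- move=> n c; have [a Da ac] := oD n c; exists (i a), a => //.
  by rewrite subrr; apply: submod0 (sF n).
- move=> n c z [a [Da ac] hz]; exists a; first by split=> //; apply: dD.
  exact: (compl_mono C).
- move=> n c z z' [a [Da ac] hz] [a' [Da' ac'] hz'].
  have -> : z - z' = (z - i a) - (z' - i a') + i (a - a') by rewrite rmorphB; ring.
  apply: (submodD (sF n)); first exact: (submodB (sF n)).
  apply/(compl_emb C); apply: fil_mono; apply: hD; last by rewrite rmorphB ac ac' subrr.
  by case: (sD n) => _ DB _; apply: DB.
- move=> n; exists 1; first by rewrite rmorph1; split=> //; case: (sD n).
  by rewrite rmorph1 subrr; apply: submod0 (sF n).
- move=> n c c' z z' [a [Da ac] hz] [a' [Da' ac'] hz']; exists (a - a').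
    by rewrite rmorphB ac ac'; split=> //; case: (sD n) => _ DB _; apply: DB.
  rewrite rmorphB; have -> : z - z' - (i a - i a') = (z - i a) - (z' - i a') by ring.
  exact: (submodB (sF n)).
- move=> n c c' z z' [a [Da ac] hz] [a' [Da' ac'] hz']; exists (a * a').
    by rewrite rmorphM ac ac'; split=> //; case: (sD n) => _ _ DM; apply: DM.
  rewrite rmorphM.
  have -> : z * z' - i a * i a' = z' * (z - i a) + i a * (z' - i a') by ring.
  by apply: (submodD (sF n)); apply: (submodM _ (sF n)).
exists sigma => c a ac hpi; have [b Db bc] := oD 1%N c.
have -> : sigma c - i a = (sigma c - i b) + i (b - a) by rewrite rmorphB; ring.
apply: (submodD (sF _)).
  by apply: hs; exists b => //; rewrite subrr; apply: submod0 (sF _).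
by apply/(compl_emb C); apply: hpi; rewrite rmorphB ac bc subrr.
Qed.

End CompletionProperties.

(* [cov_A] stands for the completion of [A], a finite algebra over the power series
   ring [cov_B]; [cov_F] and [cov_G] are the powers of their maximal ideals. *)
Record cover (A : comNzRingType) (m : set A) (d : nat) (x : 'I_d -> A) := Cover {
  cov_B : comNzRingType;
  cov_x : 'I_d -> cov_B;
  cov_G : nat -> set cov_B;
  cov_dom : forall a b : cov_B, a * b = 0 -> a = 0 \/ b = 0;
  cov_inv : forall t, ~ cov_G 1%N t -> exists t', cov_G 1%N (1 - t' * t);
  cov_gen : forall t, cov_G 1%N t -> exists c : 'I_d -> cov_B, exists r : seq 'I_d,
    t = \sum_(i <- r) c i * cov_x i;
  cov_G_ideal : forall n, submod idfun (cov_G n);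
  cov_G_mono : forall n n', (n <= n')%N -> cov_G n' `<=` cov_G n;
  cov_G_x : forall i n, cov_G n (cov_x i ^+ n);
  cov_G_val : forall b, b <> 0 -> exists v, forall n c, cov_G (n + v)%N (b * c) -> cov_G n c;
  cov_G_pig : forall n V, submod idfun V -> (forall i, V (cov_x i ^+ n)) ->
    cov_G (d * n)%N `<=` V;
  cov_A : comNzRingType;
  cov_i : {rmorphism A -> cov_A};
  cov_F : nat -> set cov_A;
  cov_F_ideal : forall n, submod idfun (cov_F n);
  cov_F_emb : forall n a, cov_F n (cov_i a) <-> ideal_pow m n a;
  cov_F_dense : forall n w, exists a, cov_F n (w - cov_i a);
  cov_F_sep : forall w, (forall n, cov_F n w) -> w = 0;
  cov_F_gen : forall n, cov_F n `<=` ideal_gen (cov_i @` ideal_pow m n);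
  cov_phi : {rmorphism cov_B -> cov_A};
  cov_phi_x : forall j, cov_phi (cov_x j) = cov_i (x j);
  cov_e : seq cov_A;
  cov_span : forall w, span cov_phi cov_e w;
  cov_len : forall I N, ideal I -> ideal_pow m N `<=` I ->
    let J := ideal_add (cov_i @` I) (cov_F N) in
    len_fin cov_phi J setT /\ len idfun I setT = len cov_phi J setT }.

Arguments cov_G {A m d x} c.
Arguments cov_x {A m d x} c.
Arguments cov_F {A m d x} c.
Arguments cov_i {A m d x} c.
Arguments cov_phi {A m d x} c.
Arguments cov_e {A m d x} c.
Arguments cov_span {A m d x} c.
Arguments cov_F_dense {A m d x} c.
Arguments cov_F_emb {A m d x} c.
Arguments cov_F_sep {A m d x} c.
Arguments cov_F_gen {A m d x} c.
Arguments cov_phi_x {A m d x} c.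
Arguments cov_dom {A m d x} c.
Arguments cov_inv {A m d x} c.
Arguments cov_gen {A m d x} c.
Arguments cov_G_ideal {A m d x} c.
Arguments cov_G_mono {A m d x} c.
Arguments cov_G_x {A m d x} c.
Arguments cov_G_val {A m d x} c.
Arguments cov_G_pig {A m d x} c.
Arguments cov_len {A m d x} c.

Section CoverExists.
Variables (A : comNzRingType) (k : fieldType) (pi : {rmorphism A -> k}) (p : nat).
Hypotheses (lA : noetherian_local A) (pA : p \in [pchar A]).
Local Notation m := (max_ideal A).
Hypothesis pi_onto : forall c, exists a, pi a = c.
Hypothesis pi_ker : forall a, pi a = 0 <-> m a.
Variables (d : nat) (x : 'I_d -> A) (c0 : nat).
Hypotheses (d_gt0 : (0 < d)%N) (mx : forall j, m (x j)).
Hypothesis m_x : ideal_pow m c0 `<=` ideal_gen (range x).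

Let mI : ideal m := max_ideal_ideal lA.
Let m1 : ideal_pow m 1 = m := pow1 mI.

Let powm_proper : ~ ideal_pow m 1 1.
Proof. by rewrite m1; apply: max_ideal1. Qed.

Let F : filtration A := Filtration (pow_sub m) (fun n => @pow_le _ m n n.+1 (leqnSn n)) powm_proper.

Let powm_gens n : exists r (g : 'I_r -> A), [/\ (0 < r)%N, ideal_pow m n = ideal_gen (range g) &
  forall j a, F (n + j)%N a -> exists z : 'I_r -> A,
     (forall t, F j (z t)) /\ a = \sum_t z t * g t].
Proof.
have [r [g [r0 gE]]] := noetherian_gens (local_noetherian lA) (pow_ideal m n).
exists r, g; split=> // j a.
pose W := [set a | exists z : 'I_r -> A, (forall t, F j (z t)) /\ a = \sum_t z t * g t].
suff : ideal_pow m (n + j) `<=` W by apply.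
apply: pow_split.
  split.
  - exists (fun=> 0); split=> [t|]; first exact: submod0 (pow_sub m j).
    by rewrite big1 // => t _; rewrite mul0r.
  - move=> _ _ [z [hz ->]] [z' [hz' ->]]; exists (fun t => z t + z' t); split=> [t|].
      exact: (submodD (pow_sub m j) (hz t) (hz' t)).
    by rewrite -big_split; apply: eq_bigr => t _; rewrite mulrDl.
  - move=> b _ [z [hz ->]]; exists (fun t => b * z t); split=> [t|].
      exact: (submodM b (pow_sub m j) (hz t)).
    by rewrite mulr_sumr; apply: eq_bigr => t _; rewrite mulrA.
move=> a1 y; rewrite gE ideal_gen_lin => -[z ->] hy.
exists (fun t => z t * y); split=> [t|]; first exact: (submodM (z t) (pow_sub m j)).
by rewrite mulr_suml; apply: eq_bigr => t _; rewrite mulrAC.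
Qed.

Section WithCompletion.
Variables (Ah : comNzRingType) (i : {rmorphism A -> Ah}) (FF : nat -> set Ah).
Variable C : is_completion F i FF.
Variable sigma : {rmorphism k -> Ah}.
Hypothesis sigmaP : forall c a, pi a = c -> FF 1%N (sigma c - i a).
Variables (B : comNzRingType) (j : {rmorphism mpoly d k -> B}) (GG : nat -> set B).
Variable C' : is_completion (mord_filtration d k) j GG.
Local Notation phi0 := (mmap sigma (fun t => i (x t))).
Variable phi : {rmorphism B -> Ah}.
Hypothesis phiE : forall f, phi (j f) = phi0 f.
Hypothesis phiG : forall n w, GG n w -> FF n (phi w).
Local Notation X := (fun t : 'I_d => mpolyX k (mnm1 t)).

Let sF := compl_ideal C.
Let sG := compl_ideal C'.

Lemma compl_fil0 w : FF 0 w.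
Proof.
have [a ha] := compl_dense C 0 w; rewrite -(subrK (i a) w); apply: (submodD (sF 0)) => //.
by apply/(compl_emb C); rewrite /= pow0.
Qed.

Lemma compl_fil_mul n z a : FF 1%N z -> F n a -> FF n.+1 (z * i a).
Proof.
move=> hz Fa; have [b hb] := compl_dense C n.+1 z.
have -> : z * i a = i a * (z - i b) + i (b * a) by rewrite rmorphM; ring.
apply: (submodD (sF _)); first exact: (submodM (i a) (sF n.+1)).
apply/(compl_emb C); rewrite /= -add1n; apply: powM => //.
have -> : b = b - 0 by rewrite subr0.
apply/(compl_emb C 1%N); rewrite subr0.
have -> : i b = z - (z - i b) by ring.
by apply: (submodB (sF _)) => //; apply: (compl_le C (n := n.+1)).
Qed.

Lemma compl_fil_gen n : FF n `<=` ideal_gen (i @` ideal_pow m n).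
Proof.
have [r [g [r0 gE hg]]] := powm_gens n.
move=> w /(compl_gen C hg)[z ->].
apply: (submod_sum (phi := idfun) (ideal_genP _)) => t _.
apply: (submodM (phi := idfun) _ (ideal_genP _)); apply: ideal_gen_sub; exists (g t) => //.
by rewrite gE; apply: ideal_gen_sub; exists t.
Qed.

Local Notation XX := (ideal_gen (range (fun t => i (x t)))).

Lemma mono_image al : mono (fun t => i (x t)) al = i (mono x al).
Proof. by rewrite /mono rmorph_prod; apply: eq_bigr => t _; rewrite rmorphXn. Qed.

Lemma mono_max al : ideal_pow m (\sum_t al t) (mono x al).
Proof.
apply: (pow_mono (I := ideal_gen (range x))); last exact: mono_pow.
by apply: ideal_gen_min => // _ [t _ <-].
Qed.

Lemma pow_param_fil n : ideal_pow XX n `<=` FF n.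
Proof.
apply: (pow_mono_gen (g := fun t => i (x t)) erefl (sF n)) => al <-.
by rewrite mono_image; apply/(compl_emb C); apply: mono_max.
Qed.

Lemma residue_span n : exists E : seq Ah, forall w, ideal_add (span sigma E) (FF n) w.
Proof.
elim: n => [|n [E hE]].
  by exists [::] => w; exists 0, w; rewrite add0r; split=> //; apply: compl_fil0.
have [r [g [r0 gE hg]]] := powm_gens n.
exists (E ++ [seq i (g t) | t <- enum 'I_r]) => w.
have [s [u [Es Fu ->]]] := hE w.
have [z uE] := compl_gen C hg Fu.
have /choice[b hb] t : exists a, FF 1%N (z t - i a) by apply: compl_dense C 1%N (z t).
exists (s + \sum_t sigma (pi (b t)) * i (g t)), (\sum_t (z t - sigma (pi (b t))) * i (g t)).
split.
- have sS := submod_span sigma (E ++ [seq i (g t) | t <- enum 'I_r]).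
  apply: (submodD sS).
    by apply: span_mono Es => y yE; rewrite mem_cat yE.
  apply: (submod_sum sS) => t _; apply: (submodM _ sS); apply: mem_span.
  by rewrite mem_cat; apply/orP; right; apply/mapP; exists t; rewrite ?mem_enum.
- apply: (submod_sum (sF _)) => t _; apply: compl_fil_mul; last first.
    by rewrite /= gE; apply: ideal_gen_sub; exists t.
  have -> : z t - sigma (pi (b t)) = (z t - i (b t)) - (sigma (pi (b t)) - i (b t)) by ring.
  by apply: (submodB (sF _)) => //; apply: sigmaP.
- rewrite uE -addrA -big_split; congr (_ + _); apply: eq_bigr => t _ /=; ring.
Qed.

Lemma residue_span_param : exists E : seq Ah, forall w, ideal_add (span sigma E) XX w.
Proof.
have [E hE] := residue_span c0; exists E => w; have [s [u [Es Fu ->]]] := hE w.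
exists s, u; split=> //; apply: (ideal_gen_min _ _ (compl_fil_gen Fu)); first exact: ideal_genP.
move=> _ [a /m_x ax <-]; move: ax; rewrite ideal_gen_lin => -[z ->].
rewrite rmorph_sum; apply: (submod_sum (phi := idfun) (ideal_genP _)) => t _.
rewrite rmorphM; apply: (submodM (phi := idfun) _ (ideal_genP _)).
by apply: ideal_gen_sub; exists t.
Qed.

(** Nakayama for a complete ring: [E] spans over [k] modulo the parameters. The error in
    [ideal_pow XX n] is written with coefficients of order at least [n], so the coefficients
    converge in the power series ring. *)
Lemma completion_finite : exists E : seq Ah, forall w, span phi E w.
Proof.
have [E hE] := residue_span_param; exists E => w; apply/spanP.
have sX n := pow_sub XX n.
have mordm (al : 'I_d -> nat) : @mord d k (\sum_t al t) (mono X al).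
  rewrite /mono; elim/big_ind2: _ => [|a f b g hf hg|t _].
  - by move=> a _; rewrite leq0n.
  - exact: mordM.
  by move=> a; rewrite mpolyXn msuppX mem_seq1 => /eqP ->; rewrite mdegMn mdeg1 mul1n.
have phi0m (al : 'I_d -> nat) : phi0 (mono X al) = mono (fun t => i (x t)) al.
  by rewrite /mono rmorph_prod; apply: eq_bigr => t _; rewrite rmorphXn /= mmapX mmap1U.
have step n r : ideal_pow XX n r -> exists h : nat -> mpoly d k, (forall t, @mord d k n (h t)) /\
    ideal_pow XX n.+1 (r - \sum_(t < size E) phi0 (h t) * E`_t).
  (* Quantifying over all multiples [a * r] makes [W] an ideal, so that monomials are enough. *)
  pose W := [set r | forall a, exists h : nat -> mpoly d k, (forall t, @mord d k n (h t)) /\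
    ideal_pow XX n.+1 (a * r - \sum_(t < size E) phi0 (h t) * E`_t)].
  suff hW : ideal_pow XX n `<=` W by move=> /hW /(_ 1); rewrite mul1r.
  apply: (pow_mono_gen (g := fun t => i (x t)) erefl).
    split.
    - move=> a; exists (fun=> 0); split=> [t|]; first exact: submod0 (mord_ideal _ _ n).
      rewrite mulr0 big1 ?subr0; first exact: submod0 (sX n.+1).
      by move=> t _; rewrite rmorph0 mul0r.
    - move=> y z hy hz a; have [h [hh hh']] := hy a; have [f [hf hf']] := hz a.
      exists (fun t => h t + f t); split=> [t|]; first exact: (submodD (mord_ideal _ _ n)).
      have -> : a * (y + z) - \sum_(t < size E) phi0 (h t + f t) * E`_t =
        (a * y - \sum_(t < size E) phi0 (h t) * E`_t) +
        (a * z - \sum_(t < size E) phi0 (f t) * E`_t).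
        rewrite (eq_bigr (fun t : 'I__ => phi0 (h t) * E`_t + phi0 (f t) * E`_t)).
          by rewrite big_split /=; ring.
        by move=> t _; rewrite rmorphD mulrDl.
      exact: (submodD (sX n.+1)).
    - move=> b y hy a; have [h hh] := hy (a * b).
      by exists h; rewrite mulrA.
  move=> al sal a; have [s [u [/spanP[c ->] Xu ->]]] := hE a.
  exists (fun t => mpolyC d (c t) * mono X al); split=> [t|].
    by apply: (submodM _ (mord_ideal _ _ n)); rewrite -sal.
  have -> : (\sum_(t < size E) sigma (c t) * E`_t + u) * mono (fun t => i (x t)) al -
      \sum_(t < size E) phi0 (mpolyC d (c t) * mono X al) * E`_t =
      u * mono (fun t => i (x t)) al.
    rewrite mulrDl mulr_suml addrAC -sumrB big1 ?add0r // => t _.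
    by rewrite rmorphM /= mmapC phi0m; ring.
  rewrite -add1n; apply: powM; first by rewrite pow1 //; apply: ideal_genP.
  by rewrite -sal; apply: mono_pow.
have [|n f hf|f [_ Pf Rf]] := @dependent_seq (nat -> mpoly d k)
    (fun n f => ideal_pow XX n (w - \sum_(t < size E) phi0 (f t) * E`_t))
    (fun n f f' => forall t, @mord d k n (f' t - f t)) (fun=> 0).
- by rewrite pow0.
- have [h [hh hh']] := step n _ hf; exists (fun t => f t + h t); split=> [|t].
    have -> : w - \sum_(t < size E) phi0 (f t + h t) * E`_t =
      w - \sum_(t < size E) phi0 (f t) * E`_t - \sum_(t < size E) phi0 (h t) * E`_t.
      rewrite (eq_bigr (fun t : 'I__ => phi0 (f t) * E`_t + phi0 (h t) * E`_t)).
        by rewrite big_split /=; ring.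
      by move=> t _; rewrite rmorphD mulrDl.
    exact: hh'.
  by rewrite addrC addKr.
have /choice[be hbe] t : exists b, forall n, GG n (b - j (f n t)).
  by apply: (compl_lim C') => n; rewrite -rmorphB; apply/(compl_emb C'); apply: Rf.
exists be; apply/eqP; rewrite -subr_eq0; apply/eqP; apply: (compl_sep C) => n.
have -> : w - \sum_(t < size E) phi (be t) * E`_t =
  (w - \sum_(t < size E) phi0 (f n t) * E`_t) -
  \sum_(t < size E) E`_t * phi (be t - j (f n t)).
  rewrite [X in _ = _ - X](_ : _ = \sum_(t < size E) phi (be t) * E`_t -
    \sum_(t < size E) phi0 (f n t) * E`_t); first by ring.
  by rewrite -sumrB; apply: eq_bigr => t _; rewrite rmorphB phiE; ring.
apply: (submodB (sF n)); first exact: pow_param_fil.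
by apply: (submod_sum (sF n)) => t _; apply: (submodM _ (sF n)); apply: phiG.
Qed.

Lemma series_inv t : ~ GG 1%N t -> exists t', GG 1%N (1 - t' * t).
Proof.
move=> nt; have [f hf] := compl_dense C' 1%N t.
pose c := mcoeff (@mnm0 d) f.
have hc : GG 1%N (t - j (mpolyC d c)).
  have -> : t - j (mpolyC d c) = (t - j f) + j (f - mpolyC d c) by rewrite rmorphB; ring.
  by apply: (submodD (sG _)) => //; apply/(compl_emb C'); apply: mord_const.
have c_0 : c != 0.
  by apply/eqP => c_0; apply: nt; move: hc; rewrite c_0 mpolyC0 rmorph0 subr0.
exists (j (mpolyC d c^-1)).
have -> : 1 - j (mpolyC d c^-1) * t = - j (mpolyC d c^-1) * (t - j (mpolyC d c)).
  have e : j (mpolyC d c^-1) * j (mpolyC d c) = 1.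
    by rewrite -rmorphM -mpolyCM mulVf // mpolyC1 rmorph1.
  by rewrite -{1}e; ring.
exact: (submodM _ (sG 1%N)).
Qed.

(** Two comparisons: from [B] to the completion as operator rings, which share the residue field
    [k], and from the completion to [A], since [A / I] maps bijectively onto the quotient by [J]. *)
Lemma completion_len I N : ideal I -> ideal_pow m N `<=` I ->
  let J := ideal_add (i @` I) (FF N) in
  len_fin phi J setT /\ len idfun I setT = len phi J setT.
Proof.
move=> iI mI' J.
have FJ : FF N `<=` J by apply: ideal_addr; exists 0; [case: iI|rewrite rmorph0].
have IJ a : I a -> J (i a).
  by move=> Ia; exists (i a), 0; rewrite addr0; split=> //; exact: submod0 (sF N).
have sJ : submod idfun J.
  split; first by apply: FJ; apply: submod0 (sF N).
    move=> _ _ [_ [u [[a Ia <-] Fu ->]]] [_ [v [[b Ib <-] Fv ->]]].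
    exists (i (a + b)), (u + v); rewrite rmorphD addrACA; split=> //.
      by exists (a + b); rewrite ?rmorphD //; case: iI => _ ID _; apply: ID.
    exact: (submodD (sF N)).
  move=> w _ [_ [u [[a Ia <-] Fu ->]]]; have [b hb] := compl_dense C N w.
  exists (i (b * a)), (i a * (w - i b) + w * u); split.
  - by exists (b * a) => //; case: iI => _ _ IM; apply: IM.
  - by apply: (submodD (sF N)); [apply: (submodM (i a) (sF N))|apply: (submodM w (sF N))].
  - by rewrite /= rmorphM; ring.
have JI a : J (i a) -> I a.
  move=> [_ [u [[b Ib <-] Fu e]]].
  have Fab : ideal_pow m N (a - b).
    by apply/(compl_emb C); rewrite rmorphB e addrC addKr.
  rewrite -(subrK b a); case: iI => _ ID _; apply: ID => //; exact: mI'.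
have [r [g [r0 gE hg]]] := powm_gens 1.
have hg' t : m (g t) by rewrite -m1 gE; apply: ideal_gen_sub; exists t.
have Jg t a : J (i (g t) ^+ N * a).
  by rewrite mulrC; apply: (submodM a sJ); rewrite -rmorphXn; apply: IJ; apply: mI'; apply: pow_exp.
have F_gen1 t : FF 1%N t -> exists c : 'I_r -> Ah, exists l : seq 'I_r,
    t = \sum_(s <- l) c s * i (g s).
  by move=> /(compl_gen C hg)[z ->]; exists z, (index_enum _).
have F_inv t : ~ FF 1%N t -> exists t', FF 1%N (1 - t' * t).
  move=> nt; have [a ha] := compl_dense C 1%N t.
  have nma : ~ m a.
    move=> ma; apply: nt; rewrite -(subrK (i a) t); apply: (submodD (sF _)) => //.
    by apply/(compl_emb C); rewrite /= m1.
  have [b ba] := max_ideal_unit lA nma; exists (i b).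
  have -> : 1 - i b * t = - i b * (t - i a) by rewrite -(rmorph1 i) -ba rmorphM; ring.
  exact: (submodM _ (sF 1%N)).
have [||l _ tl] := @tower_cyc _ _ idfun (FF 1%N) _ (fun t => i (g t)) N (enum 'I_r) J 1 F_gen1 sJ.
- by move=> t; rewrite mem_enum.
- by move=> t _; apply: Jg.
have eT : ideal_add J (cyc idfun 1) = setT.
  apply/seteqP; split=> // w _; apply: ideal_addr; first exact: submod0 sJ.
  by exists w => //; rewrite mulr1.
rewrite eT in tl.
have G_inv := series_inv.
have phi_psi t : exists t' t1, FF 1%N t1 /\ idfun t = phi t' + idfun t1.
  have [a ha] := compl_dense C 1%N t; exists (j (mpolyC d (pi a))), (t - sigma (pi a)).
  split; last by rewrite phiE mmapC /= addrC subrK.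
  have -> : t - sigma (pi a) = (t - i a) - (sigma (pi a) - i a) by ring.
  by apply: (submodB (sF _)) => //; apply: sigmaP.
have [_ _ fJ eJ] := @tower_len _ _ _ idfun phi (FF 1%N) (GG 1%N) F_inv G_inv
  (fun t => ex_intro _ (phi t) erefl) (fun t Gt => ex_intro2 _ _ (phi t) (phiG Gt) erefl)
  phi_psi J l setT sJ tl.
split=> //; rewrite -eJ.
have [_ _ lJ] := tower_fin F_inv sJ tl.
have sT := submodT (idfun : {rmorphism Ah -> Ah}).
have pull n : has_chain idfun J setT n -> has_chain idfun I setT n.
  apply: (has_chain_pull (f := i)) => //.
    move=> K sK; split; first by split=> //=; rewrite rmorph0; apply: submod0 sK.
      by move=> a b [_ Ka] [_ Kb]; split=> //=; rewrite rmorphD; apply: (submodD sK).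
    by move=> a b [_ Kb]; split=> //=; rewrite rmorphM; apply: (submodM (i a) sK).
  by move=> y _; have [a ha] := compl_dense C N y; exists a => //; apply: FJ.
have push n : has_chain idfun I setT n -> has_chain idfun J setT n.
  apply: (has_chain_push (f := i)) => //.
  - by move=> a b; rewrite rmorphB.
  - move=> K sK IK; split.
    + exists 0, 0; rewrite addr0; split=> //; last exact: submod0 sJ.
      by exists 0; [exact: submod0 sK|exact: rmorph0].
    + move=> _ _ [_ [u [[a Ka <-] Ju ->]]] [_ [v [[b Kb <-] Jv ->]]].
      exists (i (a + b)), (u + v); rewrite rmorphD addrACA; split=> //.
        by exists (a + b); rewrite ?rmorphD //; apply: (submodD sK).
      exact: (submodD sJ).
    + move=> w _ [_ [u [[a Ka <-] Ju ->]]]; have [b hb] := compl_dense C N w.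
      exists (i (b * a)), (i a * (w - i b) + w * u); split.
      * by exists (b * a) => //; apply: (submodM b sK).
      * apply: (submodD sJ); last exact: (submodM w sJ).
        by apply: (submodM (i a) sJ); apply: FJ.
      * by rewrite /= rmorphM; ring.
  - by move=> a _; apply: JI.
have sI : submod idfun I := iI.
have fI : len_fin idfun I setT by exists l => n /push; apply: lJ.
have fJ' : len_fin idfun J setT by exists l.
apply/eqP; rewrite eqn_leq; apply/andP; split.
  by apply/(len_spec sJ (@subsetT _ _) fJ'); apply: push; apply/(len_spec sI (@subsetT _ _) fI).
by apply/(len_spec sI (@subsetT _ _) fI); apply: pull; apply/(len_spec sJ (@subsetT _ _) fJ').
Qed.

End WithCompletion.

Lemma cover_exists : exists _ : cover m x, True.
Proof.
have [Ah [i [FF C]]] := completion_exists F.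
have [B [j [GG C']]] := completion_exists (mord_filtration d k).
have pk : p \in [pchar k] by exact: (rmorph_pchar pi).
have [||||D [sD dD oD hD]] := @coeff_rings A k pi p pA pk (ideal_pow m).
- by move=> z /pi_ker; rewrite m1.
- by move=> n; apply: pow_sub.
- move=> n z hz; apply: (@pow_le _ _ _ (n.+1 * p)); last exact: pow_exp_pow.
  by have := prime_gt1 (pcharf_prime pA); nia.
- by move=> c; have [a <-] := pi_onto c; exists a.
have [sigma hs] := compl_section C sD dD oD hD.
have sigmaP c a : pi a = c -> FF 1%N (sigma c - i a).
  by move=> e; apply: hs => // z /pi_ker; rewrite /= m1.
have sF := compl_ideal C; have sG := compl_ideal C'.
pose phi0 : {rmorphism mpoly d k -> Ah} := mmap sigma (fun t => i (x t)).
have [|phi [phiE phiG]] := @compl_extend _ _ _ _ _ C _ _ _ _ _ phi0 C'.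
  move=> n f hf; rewrite /phi0 (mpolyE f) rmorph_sum big_seq.
  apply: (submod_sum (sF n)) => a af /=; rewrite mmapZ mmapX.
  apply: (submodM _ (sF n)); rewrite /mmap1.
  have -> : \prod_t i (x t) ^+ a t = i (mono x a).
    by rewrite /mono rmorph_prod; apply: eq_bigr => t _; rewrite rmorphXn.
  apply/(compl_emb C); apply: (@pow_le _ _ _ (\sum_t a t)%N); last exact: mono_max.
  by rewrite -mdegE; apply: hf.
have [E hE] := completion_finite C sigmaP C' phiE phiG.
have ord_low n b : ~ GG n b -> exists v, [/\ (v < n)%N, GG v b & ~ GG v.+1 b].
  elim: n => [|n IH] nb.
    case: nb; have [a ha] := compl_dense C' 0 b; rewrite -(subrK (j a) b).
    by apply: (submodD (sG 0%N)) => //; apply/(compl_emb C').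
  have [Gn|/IH[v [lt h1 h2]]] := pselect (GG n b); first by exists n.
  by exists v; split=> //; apply: ltnW.
(* Here [v] is the order of [b]. Orders add because they do for polynomials that approximate both
   factors up to one degree beyond [v + w]. *)
have val b : b <> 0 -> exists v, forall n c, GG (n + v)%N (b * c) -> GG n c.
  move=> b0; have [N nN] : exists N, ~ GG N b.
    by apply: contrapT => no; apply: b0; apply: (compl_sep C') => n; apply: contrapT => h; apply: no; exists n.
  have [v [_ bv nbv]] := ord_low _ _ nN; exists v => n c bc; apply: contrapT => nc.
  have [w [lt cw ncw]] := ord_low _ _ nc.
  pose M := (v + w).+1.
  have [f hf] := compl_dense C' M b; have [g hg] := compl_dense C' M c.
  have tr u y h : (u <= M)%N -> GG M (y - j h) -> GG u y <-> @mord d k u h.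
    move=> le hy; have {}hy := compl_le C' le hy; split=> [Gy|/(compl_emb C') Gh].
      apply/(compl_emb C'); have -> : j h = y - (y - j h) by ring.
      exact: (submodB (sG u)).
    by rewrite -(subrK (j h) y); apply: (submodD (sG u)).
  have lv : (v.+1 <= M)%N by rewrite ltnS leq_addr.
  have lw : (w.+1 <= M)%N by rewrite ltnS leq_addl.
  apply: (@mord_val d k v w f g).
  - by apply/(tr _ _ _ (ltnW lv) hf).
  - by move/(tr _ _ _ lv hf).
  - by apply/(tr _ _ _ (ltnW lw) hg).
  - by move/(tr _ _ _ lw hg).
  have hfg : GG M (b * c - j (f * g)).
    have -> : b * c - j (f * g) = c * (b - j f) + j f * (c - j g) by rewrite rmorphM; ring.
    by apply: (submodD (sG M)); apply: (submodM _ (sG M)).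
  apply/(tr _ _ _ (leqnn M) hfg); apply: (compl_le C' _ bc).
  by rewrite /M -addnS addnC leq_add2r.
have Xexp t n : mpolyX k (mnm1 t) ^+ n = mpolyX k (mnm_muln (mnm1 t) n) :> mpoly d k.
  by rewrite mpolyXn.
have exp1 (a : multinom d) : (1 <= mdeg a)%N -> exists t : 'I_d, (1 <= a t)%N.
  move=> a1; apply: contrapT => no; move: a1; rewrite mdegE big1 // => t _.
  by apply/eqP; rewrite -leqn0 leqNgt; apply/negP => h; apply: no; exists t.
have exp_pig e (a : multinom d) : (d * e <= mdeg a)%N -> exists t : 'I_d, (e <= a t)%N.
  move=> le; apply: contrapT => no.
  have lt t : (a t < e)%N by rewrite ltnNge; apply/negP => h; apply: no; exists t.
  have : (mdeg a < d * e)%N.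
    rewrite mdegE -[X in (_ < X * _)%N]card_ord -sum_nat_const.
    rewrite (bigD1 (Ordinal d_gt0)) //= [X in (_ < X)%N](bigD1 (Ordinal d_gt0)) //=.
    by rewrite -addSn leq_add //; apply: leq_sum => t _; apply: ltnW.
  by rewrite ltnNge le.
have dom (a b : B) : a * b = 0 -> a = 0 \/ b = 0.
  move=> ab; have [|a0] := pselect (a = 0); [by left|right].
  have [v hv] := val a a0; apply: (compl_sep C') => n; apply: (hv n).
  by rewrite ab; apply: submod0 (sG _).
have gen t : GG 1%N t -> exists c : 'I_d -> B, exists r : seq 'I_d,
    t = \sum_(s <- r) c s * j (mpolyX k (mnm1 s)).
  have h1 n f : mord_filtration d k (1 + n)%N f -> exists z : 'I_d -> mpoly d k,
      (forall t, mord_filtration d k n (z t)) /\ f = \sum_t z t * mpolyX k (mnm1 t).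
    move=> hf; have [||z [hz ->]] := @mord_gen d k 1 1 n f _ _ hf => //.
    by exists z; split=> //; apply: eq_bigr => s _; rewrite expr1.
  by move=> /(compl_gen C' h1)[z ->]; exists z, (index_enum _).
have pig n (V : set B) : submod idfun V -> (forall t, V (j (mpolyX k (mnm1 t)) ^+ n)) ->
    GG (d * n)%N `<=` V.
  move=> sV hV w.
  have h1 l f : mord_filtration d k (d * n + l)%N f -> exists z : 'I_d -> mpoly d k,
      (forall t, mord_filtration d k l (z t)) /\ f = \sum_t z t * mpolyX k (mnm1 t) ^+ n.
    move=> hf; have [||z hz] := @mord_gen d k n (d * n) l f _ _ hf => //; last by exists z.
      by rewrite leq_pmull.
    by move=> a; apply: exp_pig.
  move=> /(compl_gen C' h1)[z ->]; apply: (submod_sum sV) => t _.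
  by apply: (submodM _ sV); rewrite rmorphXn.
have Gx t n : GG n (j (mpolyX k (mnm1 t)) ^+ n).
  rewrite -rmorphXn; apply/(compl_emb C'); rewrite Xexp.
  apply: (@mord_le _ _ n (mdeg (mnm_muln (mnm1 t) n))); last exact: mordX.
  by rewrite mdegMn mdeg1 mul1n.
have phix t : phi (j (mpolyX k (mnm1 t))) = i (x t).
  by rewrite phiE /phi0 /= mmapX mmap1U.
exists (@Cover A m d x B (fun t => j (mpolyX k (mnm1 t))) GG dom (series_inv C') gen sG
  (fun n n' le => compl_le C' le) Gx val pig Ah i FF sF (compl_emb C) (compl_dense C)
  (compl_sep C) (compl_fil_gen C) phi phix E hE (completion_len C sigmaP C' phiE phiG)) => //.
Qed.

End CoverExists.

(** * Hilbert-Kunz lengths *)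

Section LocalGrowth.
Variable A : comNzRingType.
Hypothesis lA : noetherian_local A.
Local Notation m := (max_ideal A).
Variables (d : nat) (x : 'I_d -> A).
Hypotheses (d_gt0 : (0 < d)%N) (mx : forall j, m (x j)).
Variable cv : cover m x.
Local Notation phi := (cov_phi cv).
Local Notation i := (cov_i cv).
Implicit Types (I K : set A).

(** When [I] contains [ideal_pow m n] this is the extension of [I] to the completion; the second
    summand makes it an ideal, by density of [A]. *)
Definition cext I n : set (cov_A cv) := ideal_add (i @` I) (cov_F cv n).

Let sF n := cov_F_ideal cv n.

Lemma cext_ideal I n : ideal I -> submod idfun (cext I n).
Proof.
move=> iI; have [I0 ID IM] := iI; split.
- by exists 0, 0; rewrite addr0; split=> //; [exists 0; rewrite ?rmorph0|exact: submod0 (sF n)].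
- move=> _ _ [_ [u [[a Ia <-] Fu ->]]] [_ [v [[b Ib <-] Fv ->]]].
  exists (i (a + b)), (u + v); rewrite rmorphD addrACA; split=> //.
    by exists (a + b); rewrite ?rmorphD //; apply: ID.
  exact: (submodD (sF n)).
- move=> w _ [_ [u [[a Ia <-] Fu ->]]]; have [b hb] := cov_F_dense cv n w.
  exists (i (b * a)), (i a * (w - i b) + w * u); split.
  + by exists (b * a) => //; apply: IM.
  + by apply: (submodD (sF n)); [apply: (submodM (i a) (sF n))|apply: (submodM w (sF n))].
  + by rewrite /= rmorphM; ring.
Qed.

Lemma cext_sub I n a : I a -> cext I n (i a).
Proof.
by move=> Ia; exists (i a), 0; rewrite addr0; split=> //; exact: submod0 (sF n).
Qed.

Lemma cext_x I n j a : ideal I -> ideal_pow m n `<=` I ->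
  cext I n (phi (cov_x cv j ^+ n) * a).
Proof.
move=> iI h; rewrite mulrC; apply: (submodM a (cext_ideal n iI)).
rewrite rmorphXn (cov_phi_x cv) -rmorphXn; apply: cext_sub; apply: h; exact: pow_exp.
Qed.

Lemma cext_min I n W : ideal I -> ideal_pow m n `<=` I -> submod phi W ->
  (forall z a, I z -> W (i z * a)) -> cext I n `<=` W.
Proof.
move=> iI hn sW h _ [_ [u [[a Ia <-] Fu ->]]]; apply: (submodD sW).
  by rewrite -[i a]mulr1; apply: h.
pose W' := [set w | forall a, W (w * a)].
suff /(_ _ Fu 1) : cov_F cv n `<=` W' by rewrite mulr1.
have iW' : ideal W'.
  split=> [b|y z hy hz b|b y hy c]; first by rewrite mul0r; apply: submod0 sW.
    by rewrite mulrDl; apply: (submodD sW); [apply: hy|apply: hz].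
  by rewrite [b * y]mulrC -mulrA; apply: hy.
apply: subset_trans (cov_F_gen cv n) _.
by apply: ideal_gen_min iW' _ => _ [z /hn Iz <-] b; apply: h.
Qed.

(** The [n]-th powers of the parameters lie in [I], so [cov_G cv (d * n)] kills the quotient, and
    each generator of the completion contributes at most [(d * n) ^ d]. *)
Lemma len_pow_le : exists C, forall I n, ideal I -> ideal_pow m n `<=` I ->
  len_le idfun I setT (C * n ^ d).
Proof.
exists (size (cov_e cv) * d ^ d)%N => I n iI hn.
have [fJ eJ] := cov_len cv _ _ iI hn.
have sJ := submod_id_phi phi (cext_ideal n iI).
have fI := len_fin_pow lA iI hn.
have sI : submod idfun I := iI.
apply/(len_leP _ sI (@subsetT _ _) fI); rewrite eJ.
apply: (len_le_len sJ) => // k hk.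
rewrite -mulnA -expnMn.
have lG := len_G (cov_inv cv) (cov_gen cv) (cov_G_ideal cv)
  (cov_G_x cv) (n := (d * n)%N).
apply: (span_kill (e := cov_e cv) sJ _ lG).
  move=> t y Gt; pose W := [set t | forall z, cext I n (phi t * z)].
  have sW : submod idfun W.
    split; first by move=> z; rewrite rmorph0 mul0r; apply: submod0 sJ.
      by move=> s s' hs hs' z; rewrite rmorphD mulrDl; apply: (submodD sJ).
    by move=> s s' hs z; rewrite /= rmorphM -mulrA; apply: (submodM _ sJ).
  by apply: (cov_G_pig cv n W sW) Gt y => j z; apply: cext_x.
apply: has_chain_widen hk => // a _; apply: sub_addr sJ _ (cov_span cv a).
Qed.

(** No layer [h n] is much larger than the preceding ones: [h n <= mu * h (n - j)] for [j] up to
    [n / mu]. Summing over these [j] bounds about [n / mu] times [h n] by the length of [A] modulo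
    [ideal_pow m n.+1]. *)
Lemma len_hilbert : exists C, forall n,
  (len idfun (ideal_pow m n.+1) (ideal_pow m n) <= C * n.+1 ^ d.-1)%N.
Proof.
have [C hC] := len_pow_le.
have [mu [g [mu0 gE]]] := noetherian_gens (local_noetherian lA) (max_ideal_ideal lA).
exists (mu * mu * C)%N => n.
have sP k := pow_sub m k.
have PP k : ideal_pow m k.+1 `<=` ideal_pow m k by apply: pow_le.
have fP k l : (l <= k)%N -> len_fin idfun (ideal_pow m k) (ideal_pow m l).
  by move=> _; apply: len_fin_sub (@subset_refl _ _) (@subsetT _ _) (len_fin_pow lA (pow_ideal m k) (@subset_refl _ _)).
pose h k := len idfun (ideal_pow m k.+1) (ideal_pow m k).
(* By the pigeonhole principle the [n]-th power is the sum of the [mu] multiples of the power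
   [n - j] by [g t ^+ j]. *)
have hstep j : (mu * j <= n)%N -> (h n <= mu * h (n - j))%N.
  move=> jn.
  pose M t : set A := [set g t ^+ j * y | y in ideal_pow m (n - j)].
  have jn' : (j <= n)%N by apply: leq_trans jn; rewrite leq_pmull.
  have sM t : submod idfun (M t).
    split; first by exists 0; [exact: submod0 (sP _)|rewrite mulr0].
      move=> _ _ [y hy <-] [z hz <-]; exists (y + z); first exact: (submodD (sP _)).
      by rewrite mulrDr.
    by move=> a _ [y hy <-]; exists (a * y); [exact: (submodM a (sP _))|rewrite mulrCA].
  pose V := fix V (l : seq 'I_mu) : set A :=
    if l is t :: l' then ideal_add (V l') (M t) else ideal_pow m n.+1.
  have sV l : submod idfun (V l) by elim: l => [|t l IH]; [exact: sP|exact: submod_add].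
  have V0 l : ideal_pow m n.+1 `<=` V l.
    by elim: l => [//|t l IH]; apply: (subset_trans IH); apply: sub_addl (sM t).
  have lV l : len_le idfun (ideal_pow m n.+1) (V l) (size l * h (n - j)%N)%N.
    elim: l => [|t l IH]; first by rewrite mul0n; apply: len_le0.
    rewrite /= mulSn addnC; apply: (len_le_add (sP _) (sV l) (sV (t :: l))) => //.
      exact: sub_addl (sM t).
    have := proj2 (len_leP (h (n - j)%N) (sP _) (PP (n - j)%N) (fP _ _ (leqnSn _))) (leqnn _).
    move=> hl k hk; apply: hl.
    apply: (has_chain_pull (f := fun y => g t ^+ j * y) _ _ _ _ hk) => //.
    - move=> J sJ; apply: (submod_setI (sP _)); exact: (submod_colon (phi := idfun) (g t ^+ j) sJ).
    - move=> y hy; apply: V0; rewrite -(subnK jn') -addSn addnC; apply: powM => //.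
      by apply: pow_exp; rewrite gE; apply: ideal_gen_sub; exists t.
    - by move=> _ [v [_ [Vv [y hy <-] ->]]]; exists y => //; rewrite addrK.
  have tot : ideal_pow m n `<=` V (enum 'I_mu).
    apply: (pow_pigeon gE mu0 jn (sV _)) => t y hy.
    have : t \in enum 'I_mu by rewrite mem_enum.
    elim: (enum _) => // s l IH; rewrite inE => /orP[/eqP ->|/IH Vy] /=.
      by apply: (sub_addr (sV l)); exists y.
    exact: (sub_addl (sM s)).
  apply/(len_leP _ (sP _) (PP n) (fP _ _ (leqnSn _))).
  by have := lV (enum 'I_mu); rewrite size_enum_ord; apply: len_le_sub.
have tele t : (t <= n)%N -> (\sum_(j < t.+1) h (n - j))%N = len idfun (ideal_pow m n.+1) (ideal_pow m (n - t)).
  elim: t => [_|t IH lt]; first by rewrite big_ord1 subn0.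
  rewrite big_ord_recr /= IH 1?ltnW //.
  rewrite [RHS](lenD (sP n.+1) (sP (n - t)%N) (sP (n - t.+1)%N)).
  - by congr addn; rewrite /h (_ : (n - t.+1).+1 = n - t)%N //; lia.
  - by apply: pow_le; lia.
  - by apply: pow_le; lia.
  - by apply: fP; lia.
pose t := (n %/ mu)%N.
have tn : (t <= n)%N by apply: leq_div.
have h1 : (t.+1 * h n <= mu * len idfun (ideal_pow m n.+1) (ideal_pow m (n - t)))%N.
  rewrite -tele // big_distrr /= -[X in (X * h n)%N]card_ord -sum_nat_const.
  apply: leq_sum => j _; apply: hstep; rewrite mulnC -leq_divRL //; exact: ltn_ord j.
have h2 : (len idfun (ideal_pow m n.+1) (ideal_pow m (n - t)) <= C * n.+1 ^ d)%N.
  apply/(len_leP _ (sP _) _ (fP _ _ _)); [by apply: pow_le; lia|by lia|].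
  exact: len_le_sub (@subset_refl _ _) (@subsetT _ _) (hC _ _ (pow_ideal m n.+1) (@subset_refl _ _)).
have h3 : (n.+1 <= t.+1 * mu)%N by rewrite ltn_ceil.
have h4 : (n.+1 * h n <= n.+1 * (mu * mu * C * n.+1 ^ d.-1))%N.
  apply: (leq_trans (leq_mul h3 (leqnn _))).
  rewrite mulnAC mulnC; apply: (leq_trans (leq_mul (leqnn mu) (leq_trans h1 (leq_mul (leqnn mu) h2)))).
  rewrite -[in (n.+1 ^ d)%N](prednK d_gt0) expnS.
  by rewrite (_ : mu * _ = n.+1 * (mu * mu * C * n.+1 ^ d.-1))%N //; ring.
by move: h4; rewrite leq_pmul2l.
Qed.

Lemma len_shift c : exists C, forall n,
  (len idfun (ideal_pow m (n + c)) (ideal_pow m n) <= C * (n + c).+1 ^ d.-1)%N.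
Proof.
have [C hC] := len_hilbert.
have sP k := pow_sub m k.
have fP k l : len_fin idfun (ideal_pow m k) (ideal_pow m l).
  exact: len_fin_sub (@subset_refl _ _) (@subsetT _ _) (len_fin_pow lA (pow_ideal m k) (@subset_refl _ _)).
exists (c * C)%N => n; elim: c => [|c IH]; first by rewrite addn0 len_eq0.
rewrite addnS (lenD (sP _) (sP (n + c)%N) (sP _)).
- rewrite mulSn mulnDl; apply: leq_add.
    apply: leq_trans (hC _) _; rewrite leq_mul2l; apply/orP; right.
    by case: (d.-1) => // e; rewrite leq_exp2r //; lia.
  apply: leq_trans IH _; rewrite leq_mul2l; apply/orP; right.
  by case: (d.-1) => // e; rewrite leq_exp2r //; lia.
- by apply: pow_le.
- by apply: pow_le; apply: leq_addr.
- exact: fP.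
Qed.

End LocalGrowth.

Arguments cext {A d x} cv I n _.

Section FrobeniusSequence.
Variables (A : comNzRingType) (p : nat).
Hypotheses (lA : noetherian_local A) (pA : p \in [pchar A]).
Local Notation m := (max_ideal A).
Variables (d : nat) (x : 'I_d -> A).
Hypotheses (d_gt0 : (0 < d)%N) (mx : forall j, m (x j)).
Variable cv : cover m x.
Local Notation phi := (cov_phi cv).
Local Notation i := (cov_i cv).
Implicit Types (I K : set A).
Variables (N : nat -> nat) (S : nat).
Hypothesis N_step : forall e, (N e.+1 <= p * N e)%N.
Hypothesis N_low : forall n e, (p ^ n * N e <= N (e + n) + p ^ n)%N.
Hypothesis N_lin : forall e, (N e <= S * p ^ e)%N.

Definition hk_ideal e : set A := ideal_add (ideal_pow m (N e)) (frob_pow m (p ^ e)).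

Let mI : ideal m := max_ideal_ideal lA.
Let p_gt0 : (0 < p)%N := pchar_gt0 pA.

Lemma frob_ideal q : ideal (frob_pow m q). Proof. exact: ideal_genP. Qed.

Lemma hk_ideal_ideal e : ideal (hk_ideal e).
Proof. by apply: (submod_add (phi := idfun)); [exact: pow_sub|exact: frob_ideal]. Qed.

Lemma hk_ideal_pow e : ideal_pow m (N e) `<=` hk_ideal e.
Proof. by apply: (sub_addl (phi := idfun)); exact: frob_ideal. Qed.

Lemma ideal_frob_pre I q n : q = (p ^ n)%N -> ideal I -> ideal [set z | I (z ^+ q)].
Proof.
move=> -> [I0 ID IM]; split=> [|y z|a z] /=.
- by rewrite expr0n expn_eq0 -leqn0 leqNgt p_gt0.
- by move=> hy hz; rewrite (expD_p pA); apply: ID.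
- by move=> hz; rewrite exprMn; apply: IM.
Qed.

Lemma N_up n e : (N (e + n) <= p ^ n * N e)%N.
Proof.
elim: n => [|n IH]; first by rewrite addn0 mul1n.
by rewrite addnS; apply: leq_trans (N_step _) _; rewrite expnS -mulnA leq_mul2l IH orbT.
Qed.

Lemma hk_ideal_frob n e z : hk_ideal e z -> hk_ideal (e + n) (z ^+ (p ^ n)).
Proof.
have iJ := ideal_frob_pre (erefl (p ^ n)%N) (hk_ideal_ideal (e + n)).
move=> [u [v [hu hv ->]]]; have [_ JD _] := iJ; apply: JD => /=.
  apply: hk_ideal_pow; apply: (@pow_le _ _ _ (N e * p ^ n)); last exact: pow_exp_pow.
  by rewrite mulnC; apply: N_up.
apply: (ideal_gen_min iJ _ hv) => _ [w mw <-] /=.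
apply: (sub_addr (pow_sub m (N (e + n)))); apply: ideal_gen_sub; exists w => //.
by rewrite -exprM -expnD.
Qed.

Variable n : nat.
Hypotheses (splits : generic_splitting phi (p ^ n)) (frob : generic_frobenius phi p (p ^ n)).
Variables (mu : nat) (g : 'I_mu -> A).
Hypothesis gE : m = ideal_gen (range g).
Local Notation q0 := (p ^ n)%N.

(* It agrees with [hk_ideal (e + n)] up to length of lower order, but is
   generated by [p ^ n]-th powers. *)
Definition hk_frob e : set A := frob_pow (hk_ideal e) (p ^ n).
(** [pow_frob] puts the power [p ^ n * (N e + mu)] of [m] into [hk_frob e], and [N_low] bounds that
    exponent by this one. *)
Definition hk_frob_exp e := (N (e + n) + (p ^ n + p ^ n * mu))%N.
Local Notation V := hk_frob.
Local Notation M := hk_frob_exp.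

Lemma hk_frob_ideal e : ideal (V e). Proof. exact: ideal_genP. Qed.

Lemma hk_frob_sub e : V e `<=` hk_ideal (e + n).
Proof.
by apply: ideal_gen_min (hk_ideal_ideal _) _ => _ [z hz <-]; apply: hk_ideal_frob.
Qed.

Lemma hk_sub_hk_frob e : hk_ideal (e + n) `<=` ideal_add (V e) (ideal_pow m (N (e + n))).
Proof.
have sW : submod idfun (ideal_add (V e) (ideal_pow m (N (e + n)))).
  by apply: submod_add; [exact: hk_frob_ideal|exact: pow_sub].
apply: (ideal_add_sub sW); first exact: sub_addr (hk_frob_ideal e : submod idfun _).
apply: ideal_gen_min => // _ [w mw <-]; apply: sub_addl; first exact: pow_sub.
rewrite expnD exprM; apply: ideal_gen_sub; exists (w ^+ (p ^ e)) => //.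
by apply: (sub_addr (pow_sub m (N e))); apply: ideal_gen_sub; exists w.
Qed.

Lemma pow_sub_hk_frob e : ideal_pow m (M e) `<=` V e.
Proof.
have q0_gt0 : (0 < q0)%N by rewrite expn_gt0 p_gt0.
have h := pow_frob (n := N e) gE q0_gt0 (hk_frob_ideal e).
apply: subset_trans (h _) => [|z y hz]; last first.
  have [_ _ VM] := hk_frob_ideal e; rewrite mulrC; apply: VM; apply: ideal_gen_sub.
  by exists z => //; apply: hk_ideal_pow.
apply: pow_le; rewrite /hk_frob_exp mulnDr addnA leq_add2r; exact: N_low.
Qed.

Lemma hk_frob_exp_lin : exists T, (0 < T)%N /\ forall e, ((M e).+1 <= T * p ^ e)%N.
Proof.
exists (S * q0 + (q0 + q0 * mu).+1)%N; split; first by rewrite addnS.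
move=> e; rewrite /hk_frob_exp -addnS mulnDl; apply: leq_add; last by rewrite leq_pmulr // expn_gt0 p_gt0.
by apply: leq_trans (N_lin _) _; rewrite -mulnA [(q0 * _)%N]mulnC -expnD.
Qed.

Lemma hk_frob_fin e : len_fin idfun (V e) setT.
Proof. exact: (len_fin_pow lA (hk_frob_ideal e) (@pow_sub_hk_frob e)). Qed.

(** Modulo [V e] the larger ideal comes from [ideal_pow m (N (e + n))], and raising that exponent by
    a constant already enters [V e]. Only boundedly many layers of the filtration by powers of [m]
    are involved. *)
Lemma len_hk_frob_hk : exists C, forall e,
  (len idfun (V e) (hk_ideal (e + n)) <= C * (p ^ e) ^ d.-1)%N.
Proof.
have [C hC] := len_shift lA d_gt0 mx cv (q0 + q0 * mu); have [T [T0 hT]] := hk_frob_exp_lin.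
exists (C * T ^ d.-1)%N => e.
have sV : submod idfun (V e) := hk_frob_ideal e.
have sI : submod idfun (hk_ideal (e + n)) := hk_ideal_ideal _.
have sP k := pow_sub m k.
apply: (@leq_trans (len idfun (ideal_pow m (M e)) (ideal_pow m (N (e + n))))).
  apply: (len_le_len sV (@hk_frob_sub e)).
  have fP : len_fin idfun (ideal_pow m (M e)) (ideal_pow m (N (e + n))).
    apply: len_fin_sub (@subset_refl _ _) (@subsetT _ _) _.
    exact: (len_fin_pow lA (pow_ideal m (M e)) (@subset_refl _ _)).
  have := proj2 (len_leP _ (sP _) (@pow_le _ m _ _ (leq_addr (q0 + q0 * mu) (N (e + n)))) fP) (leqnn _).
  move=> hl k hk; apply: hl; apply: (has_chain_pull (f := idfun) _ _ _ _ hk).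
  - by move=> J sJ; apply: (submod_setI (sP _) sJ).
  - by apply: pow_le; apply: leq_addr.
  - by move=> z; apply: pow_sub_hk_frob.
  - move=> y /hk_sub_hk_frob[v [u [Vv Pu ->]]]; exists u => //=; by rewrite addrK.
apply: (leq_trans (hC _)); rewrite -mulnA -expnMn leq_mul2l; apply/orP; right.
by case: (d.-1) => // f; rewrite leq_exp2r //; apply: hT.
Qed.

Lemma cext_hk_frob_min e W : submod phi W ->
  (forall z a, hk_ideal e z -> W (i z ^+ q0 * a)) -> cext cv (V e) (M e) `<=` W.
Proof.
move=> sW hW; apply: cext_min => //; [exact: hk_frob_ideal|exact: pow_sub_hk_frob|].
pose J := [set v | forall a, W (i v * a)].
suff h : V e `<=` J by move=> z a /h.
apply: ideal_gen_min; last by move=> _ [z hz <-] a; rewrite rmorphXn; apply: hW.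
split=> [a|y z hy hz a|b y hy a]; first by rewrite rmorph0 mul0r; apply: submod0 sW.
  by rewrite rmorphD mulrDl; apply: (submodD sW); [apply: hy|apply: hz].
by rewrite rmorphM [i b * _]mulrC -mulrA; apply: hy.
Qed.

Lemma cext_hk_frob_gen e z a : hk_ideal e z -> cext cv (V e) (M e) (i z ^+ q0 * a).
Proof.
move=> hz; rewrite mulrC; apply: (submodM a (cext_ideal cv (M e) (hk_frob_ideal e))).
by rewrite -rmorphXn; apply: cext_sub; apply: ideal_gen_sub; exists z.
Qed.

Lemma len_cext_scaled b : b <> 0 -> exists C, forall e,
  (len phi (ideal_add (cext cv (V e) (M e)) (scaled phi b)) setT <= C * (p ^ e) ^ d.-1)%N.
Proof.
move=> b0; have [T [T0 hT]] := hk_frob_exp_lin.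
have [C hC] := len_generic_torsion (cov_inv cv) (cov_gen cv) (cov_G_ideal cv) (cov_G_mono cv)
  (cov_G_x cv) (cov_G_val cv) (cov_G_pig cv) d_gt0 (cov_span cv) b0.
exists (C * T ^ d.-1)%N => e.
have sV := submod_id_phi phi (cext_ideal cv (M e) (hk_frob_ideal e)).
have sS := submod_scaled phi b; have sVS := submod_add sV sS.
have M0 : (0 < M e)%N by rewrite /hk_frob_exp !addn_gt0 expn_gt0 p_gt0 orbT.
apply: (len_le_len sVS (@subsetT _ _)) => k hk.
apply: (@leq_trans (C * M e ^ d.-1)%N); last first.
  rewrite -mulnA -expnMn leq_mul2l; apply/orP; right.
  by case: (d.-1) => // f; rewrite leq_exp2r //; apply: ltnW; apply: hT.
apply: (hC _ _ M0 sVS) hk => [a|j a].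
  by apply: sub_addr sV _ _; exists a.
by apply: (sub_addl sS); apply: cext_x => //; [exact: hk_frob_ideal|exact: pow_sub_hk_frob].
Qed.

(** [P] sends [z ^+ q0 * a] to [(z ^+ p) ^+ q0 * P a], and [z ^+ p] lies in the next [hk_ideal]; so
    [P] maps each extended [V e] into the following one and [len_frobenius] applies. *)
Lemma len_hk_frob_step : exists C, forall e,
  (len idfun (V e.+1) setT <= p ^ d * len idfun (V e) setT + C * (p ^ e) ^ d.-1)%N.
Proof.
have [b [P [b0 PD PM Pq Pgen]]] := frob.
have [C hC] := len_cext_scaled b0.
exists (C * p ^ d.-1)%N => e.
have sV f := submod_id_phi phi (cext_ideal cv (M f) (hk_frob_ideal f)).
have [fV eV] := cov_len cv _ _ (hk_frob_ideal e) (@pow_sub_hk_frob e).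
have [fV1 eV1] := cov_len cv _ _ (hk_frob_ideal e.+1) (@pow_sub_hk_frob e.+1).
rewrite eV eV1 -mulnA -expnMn -expnS.
apply: (leq_trans (len_frobenius (cov_inv cv) (cov_gen cv) d_gt0 (cov_span cv) PD PM Pgen
  (sV e) (sV e.+1) (n := M e) _ _ fV1)).
- by move=> j a; apply: cext_x => //; [exact: hk_frob_ideal|exact: pow_sub_hk_frob].
- move=> v; suff h : cext cv (V e) (M e) `<=` [set v | cext cv (V e.+1) (M e.+1) (P v)] by move/h.
  apply: cext_hk_frob_min.
    split=> [|y z hy hz|c y hy] /=.
    + have -> : P 0 = phi (0 ^+ p) * P 0 by rewrite -PM mulr0.
      by rewrite expr0n (gtn_eqF p_gt0) rmorph0 mul0r; apply: submod0 (sV _).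
    + by rewrite PD; apply: (submodD (sV _)).
    + by rewrite PM; apply: (submodM _ (sV _)).
  move=> z a hz /=; rewrite Pq -rmorphXn; apply: cext_hk_frob_gen.
  by have := hk_ideal_frob 1 hz; rewrite addn1 expn1.
by rewrite leq_add2l; apply: hC.
Qed.

Lemma hk_frob_additive K1 K2 : ideal K1 -> ideal K2 -> (forall z, K1 z -> K2 z -> z = 0) ->
  exists C, forall e,
  (len idfun (V e) setT + len idfun (ideal_add (V e) (ideal_add K1 K2)) setT <=
   len idfun (ideal_add (V e) K1) setT + len idfun (ideal_add (V e) K2) setT +
   C * (p ^ e) ^ d.-1)%N.
Proof.
move=> iK1 iK2 K12.
have sF f := cov_F_ideal cv f.
have F_le f f' : (f <= f')%N -> cov_F cv f' `<=` cov_F cv f.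
  move=> le; apply: subset_trans (cov_F_gen cv f') _; apply: ideal_gen_min (sF f) _.
  by move=> _ [z hz <-]; apply/cov_F_emb; apply: pow_le hz.
(* The splitting lives on the completion, so [K1] and [K2] are replaced by their closures, which
   must again meet in [0]. *)
pose Kh K := [set w | forall f, exists2 a, K a & cov_F cv f (w - i a)].
have sKh K : ideal K -> submod idfun (Kh K).
  move=> [K0 KD KM]; split.
  - by move=> f; exists 0 => //; rewrite rmorph0 subrr; apply: submod0 (sF f).
  - move=> y z hy hz f; have [a Ka ha] := hy f; have [b Kb hb] := hz f.
    exists (a + b); first exact: KD.
    have -> : y + z - i (a + b) = (y - i a) + (z - i b) by rewrite rmorphD; ring.
    exact: (submodD (sF f)).
  - move=> w y hy f; have [a Ka ha] := hy f; have [c hc] := cov_F_dense cv f w.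
    exists (c * a); first exact: KM.
    have -> : idfun w * y - i (c * a) = i a * (w - i c) + w * (y - i a).
      by rewrite rmorphM /=; ring.
    by apply: (submodD (sF f)); apply: (submodM _ (sF f)).
have Kh12 w : Kh K1 w -> Kh K2 w -> w = 0.
  move=> h1 h2; apply: (cov_F_sep cv) => f.
  have iK : ideal (ideal_add K1 K2) by apply: (submod_add (phi := idfun)).
  (* Applied to [K1 + K2]: a difference [a1 - a2] deep in the filtration splits into deep components
     [l1] and [l2]. Then [a1 - l1 = a2 + l2] lies in both ideals, hence vanishes, and [a1] is
     deep. *)
  have [L hL] := artin_rees (local_noetherian lA) f mI iK.
  have [a1 Ka1 ha1] := h1 (maxn L f); have [a2 Ka2 ha2] := h2 (maxn L f).
  have powL : ideal_pow m L (a1 - a2).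
    apply: (@pow_le _ m L (maxn L f)); first exact: leq_maxl.
    apply/(cov_F_emb cv); rewrite rmorphB.
    have -> : i a1 - i a2 = (w - i a2) - (w - i a1) by ring.
    exact: (submodB (sF _)).
  have Kd : ideal_add K1 K2 (a1 - a2).
    by exists a1, (- a2); split=> //; apply: (submodN (phi := idfun) iK2).
  have [l1 [l2 [hl1 hl2 le]]] : exists l1 l2, [/\ K1 l1 /\ ideal_pow m f l1,
      K2 l2 /\ ideal_pow m f l2 & a1 - a2 = l1 + l2].
    have s1 : submod idfun (K1 `&` ideal_pow m f) := submod_setI (phi := idfun) iK1 (pow_sub m f).
    have s2 : submod idfun (K2 `&` ideal_pow m f) := submod_setI (phi := idfun) iK2 (pow_sub m f).
    have [] : ideal_add (K1 `&` ideal_pow m f) (K2 `&` ideal_pow m f) (a1 - a2).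
      apply: (ideal_gen_min _ _ (hL _ (conj powL Kd))); first exact: submod_add s1 s2.
      move=> _ [y [_ [py [k1 [k2 [K1k K2k ->]]] ->]]]; exists (y * k1), (y * k2).
      by rewrite mulrDr; split=> //; split;
        [exact: (submodM (phi := idfun) y iK1)|rewrite mulrC; exact: (submodM _ (pow_sub m f))
        |exact: (submodM (phi := idfun) y iK2)|rewrite mulrC; exact: (submodM _ (pow_sub m f))].
    by move=> l1 [l2 [h h' e]]; exists l1, l2.
  have [Kl1 pl1] := hl1; have [Kl2 pl2] := hl2.
  have e1 : a1 - l1 = 0.
    apply: K12; first exact: (submodB (phi := idfun) iK1).
    have -> : a1 - l1 = a2 + l2 by rewrite -(subrK a2 a1) le; ring.
    exact: (submodD (phi := idfun) iK2).
  rewrite -(subrK (i a1) w); apply: (submodD (sF f)).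
    by apply: F_le ha1; apply: leq_maxr.
  by apply/cov_F_emb; move/eqP: e1; rewrite subr_eq0 => /eqP ->.
have iKh K f : K f -> Kh K (i f).
  by move=> Kf l; exists f => //; rewrite subrr; apply: submod0 (sF l).
have sK1 := sKh _ iK1; have sK2 := sKh _ iK2; have sK := submod_add sK1 sK2.
have [|b [r [b0 rD [rB rq] rN rE]]] := splits (submod_id_phi phi sK).
  by move=> a y hy; apply: (submodM (a ^+ q0) sK).
have [C hC] := len_cext_scaled b0; exists C => e.
have iV := hk_frob_ideal e; have pV := @pow_sub_hk_frob e.
have sV := cext_ideal cv (M e) iV.
have [fV eV] := cov_len cv _ _ iV pV.
have ext K (Kc : set (cov_A cv)) : ideal K -> submod idfun Kc -> Kc `<=` ideal_add (i @` K) (cov_F cv (M e)) ->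
    (forall a, K a -> Kc (i a)) -> len idfun (ideal_add (V e) K) setT =
    len phi (ideal_add (cext cv (V e) (M e)) Kc) setT.
  move=> iK sKc Kc1 Kc2; have sVK : submod idfun (ideal_add (V e) K) by apply: (submod_add (phi := idfun)).
  have VVK : V e `<=` ideal_add (V e) K by apply: (sub_addl (phi := idfun)).
  have [_ ->] := cov_len cv _ _ (sVK : ideal _) (subset_trans pV VVK).
  congr len; have sE := cext_ideal cv (M e) (sVK : ideal _).
  apply/seteqP; split.
    move=> _ [_ [u [[_ [v [a [Vv Ka ->]]] <-] Fu ->]]].
    exists (i v + u), (i a); rewrite rmorphD addrAC; split=> //; last exact: Kc2.
    by exists (i v), u; split=> //; exists v.
  apply: (ideal_add_sub sE).
    move=> _ [_ [u [[v Vv <-] Fu ->]]]; exists (i v), u; split=> //.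
    by exists v => //; apply: VVK.
  move=> w /Kc1[_ [u [[a Ka <-] Fu ->]]]; exists (i a), u; split=> //; exists a => //.
  exact: sub_addr (iV : submod idfun _) _ Ka.
have Kh_ext K : Kh K `<=` ideal_add (i @` K) (cov_F cv (M e)).
  move=> w /(_ (M e))[a Ka ha]; exists (i a), (w - i a); split=> //.
  by rewrite addrC subrK.
rewrite eV (ext K1 (Kh K1)) //; last exact: iKh.
rewrite (ext K2 (Kh K2)) //; last exact: iKh.
rewrite (ext (ideal_add K1 K2) (ideal_add (Kh K1) (Kh K2))) //; first last.
- move=> _ [a1 [a2 [Ka1 Ka2 ->]]]; rewrite rmorphD; exists (i a1), (i a2).
  by split=> //; apply: iKh.
- move=> _ [w1 [w2 [/Kh_ext[_ [u1 [[a1 Ka1 <-] Fu1 ->]]] /Kh_ext[_ [u2 [[a2 Ka2 <-] Fu2 ->]]] ->]]].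
  exists (i (a1 + a2)), (u1 + u2); rewrite rmorphD addrACA; split=> //.
    by exists (a1 + a2); rewrite ?rmorphD //; exists a1, a2.
  exact: (submodD (sF _)).
- exact: (submod_add (phi := idfun)).
apply: (leq_trans (@len_additive _ _ phi q0 (Kh K1) (Kh K2) (cext cv (V e) (M e))
  [set i z | z in hk_ideal e] b r sK1 sK2 Kh12 sV _ _ rD rB rq rN rE fV)).
- by move=> _ a [z hz <-]; apply: cext_hk_frob_gen.
- by move=> W sW hW; apply: cext_hk_frob_min => // z a hz; apply: hW; exists z.
by rewrite leq_add2l; apply: hC.
Qed.

End FrobeniusSequence.

Section HilbertKunz.
Variables (A : comNzRingType) (k : fieldType) (pi : {rmorphism A -> k}) (p : nat).
Hypotheses (lA : noetherian_local A) (pA : p \in [pchar A]).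
Hypothesis pi_res : residue_map pi.
Local Notation m := (max_ideal A).
Variables (N : nat -> nat) (S : nat).
Hypothesis N_step : forall e, (N e.+1 <= p * N e)%N.
Hypothesis N_low : forall n e, (p ^ n * N e <= N (e + n) + p ^ n)%N.
Hypothesis N_lin : forall e, (N e <= S * p ^ e)%N.
Local Notation hkI := (@hk_ideal A p N).
Local Notation VI_ n := (@hk_frob A p N n).

Let pi_onto' c : exists a, pi a = c.
Proof. by case: pi_res => /(_ c Logic.I)[a _ <-] _; exists a. Qed.

Let pi_ker a : pi a = 0 <-> m a.
Proof. by case: pi_res => _ <-. Qed.

Lemma quot_lengthE (J : set A) : quot_length J = len idfun J setT.
Proof.
rewrite /quot_length /len; congr chain_sup; apply/seteqP.
by split=> K /= => [[]|[]].
Qed.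

Variable d : nat.
Hypothesis dim_le : forall l, prime_chain A l -> (l <= d)%N.

Lemma cover_dim : (0 < d)%N -> exists2 x : 'I_d -> A, (forall j, m (x j)) & exists _ : cover m x, True.
Proof.
move=> d0; have [x [mx [c hc]]] := sop_dim lA dim_le; exists x => //.
exact: (cover_exists lA pA pi_onto' pi_ker d0 mx hc).
Qed.

Lemma hk_length_bound : exists C, forall e, (len idfun (hkI e) setT <= C * (p ^ e) ^ d)%N.
Proof.
(* In dimension [0] there are no parameters: a power of the maximal ideal vanishes and the lengths
   are bounded. *)
have [d0|d0] := posnP d.
  have [x [mx [c hc]]] := sop_dim lA dim_le.
  have m0 : ideal_pow m c `<=` [set 0].
    apply: (subset_trans hc); apply: ideal_gen_min.
      by split=> [//|_ _ -> ->|a _ ->]; rewrite ?addr0 ?mulr0.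
    by move=> t [[j jd] _ _]; exfalso; move: jd; rewrite d0.
  have [C hC] := len_le_pow lA c; exists C => e; rewrite d0 expn0 muln1.
  have sI : submod idfun (hkI e) := hk_ideal_ideal _ _ _ e.
  by apply: (len_le_len sI (@subsetT _ _)); apply: hC => // t /m0 ->; apply: submod0 sI.
have [x mx [cv _]] := cover_dim d0.
have [C hC] := len_pow_le lA mx cv; exists (C * S ^ d)%N => e.
have sI : submod idfun (hkI e) := hk_ideal_ideal _ _ _ e.
apply: (@leq_trans (C * N e ^ d)%N).
  exact: (len_le_len sI (@subsetT _ _) (hC _ _ (hk_ideal_ideal _ _ _ e) (@hk_ideal_pow _ p N e))).
by rewrite -mulnA -expnMn leq_mul2l leq_exp2r // N_lin orbT.
Qed.

Hypothesis d_gt0 : (0 < d)%N.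

Lemma hk_frobenius_bound : exists n C (b : nat -> nat), forall e,
  [/\ (b e.+1 <= p ^ d * b e + C * (p ^ e) ^ d.-1)%N,
      (len idfun (hkI (e + n)) setT <= b e)%N &
      (b e <= len idfun (hkI (e + n)) setT + C * (p ^ e) ^ d.-1)%N].
Proof.
have [x mx [cv _]] := cover_dim d_gt0.
have pC : p \in [pchar (cov_A cv)] := rmorph_pchar (cov_i cv) pA.
have [n splits frob] := generic_structure (cov_dom cv) (cov_span cv) pC.
have [mu [g [mu0 gE]]] := noetherian_gens (local_noetherian lA) (max_ideal_ideal lA).
have [C hC] := len_hk_frob_step pA d_gt0 mx N_step N_low N_lin frob gE.
have [C' hC'] := len_hk_frob_hk lA pA d_gt0 mx cv N_step N_low N_lin n gE.
exists n, (C + C')%N, (fun e => len idfun (VI_ n e) setT) => e.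
have sV : submod idfun (VI_ n e) := hk_frob_ideal _ _ _ _ e.
have sI : submod idfun (hkI (e + n)) := hk_ideal_ideal _ _ _ _.
have VI := @hk_frob_sub A p pA N N_step n e.
have fV := hk_frob_fin lA pA N_low n gE e.
have e1 := lenD sV sI (submodT _) VI (@subsetT _ _) fV.
split; first by apply: leq_trans (hC e) _; rewrite leq_add2l mulnDl leq_addr.
  by rewrite e1 leq_addl.
by rewrite e1 addnC leq_add2l mulnDl; apply: leq_trans (hC' e) (leq_addl _ _).
Qed.

(** The first half is the modular law with its error term dropped. The second is proved for
    [hk_frob] and transferred, each exchange of ideals costing at most [C' * (p ^ e) ^ d.-1]. *)
Lemma hk_additive (K1 K2 : set A) : ideal K1 -> ideal K2 ->
  (forall z, K1 z -> K2 z -> z = 0) ->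
  (forall e, len idfun (ideal_add (hkI e) K1) setT + len idfun (ideal_add (hkI e) K2) setT <=
    len idfun (hkI e) setT + len idfun (ideal_add (hkI e) (ideal_add K1 K2)) setT)%N /\
  exists n C, forall e,
  (len idfun (hkI (e + n)) setT + len idfun (ideal_add (hkI (e + n)) (ideal_add K1 K2)) setT <=
   len idfun (ideal_add (hkI (e + n)) K1) setT + len idfun (ideal_add (hkI (e + n)) K2) setT +
   C * (p ^ e) ^ d.-1)%N.
Proof.
move=> iK1 iK2 K12.
have [x mx [cv _]] := cover_dim d_gt0.
have sI e : submod idfun (hkI e) := hk_ideal_ideal _ _ _ e.
have fI e : len_fin idfun (hkI e) setT.
  exact: (len_fin_pow lA (hk_ideal_ideal _ _ _ e) (@hk_ideal_pow _ p N e)).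
split=> [e|].
  by have := len_modular (sI e) iK1 iK2 (fI e) => /= ->; apply: leq_addr.
have pC : p \in [pchar (cov_A cv)] := rmorph_pchar (cov_i cv) pA.
have [n splits frob] := generic_structure (cov_dom cv) (cov_span cv) pC.
have [mu [g [mu0 gE]]] := noetherian_gens (local_noetherian lA) (max_ideal_ideal lA).
have [C hC] := hk_frob_additive lA pA d_gt0 mx N_low N_lin splits gE iK1 iK2 K12.
have [C' hC'] := len_hk_frob_hk lA pA d_gt0 mx cv N_step N_low N_lin n gE.
exists n, (C + C' + C')%N => e.
have sV : submod idfun (VI_ n e) := hk_frob_ideal _ _ _ _ e.
have VI := @hk_frob_sub A p pA N N_step n e.
have fV := hk_frob_fin lA pA N_low n gE e.
have sT := submodT (idfun : {rmorphism A -> A}).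
have iK12 : submod idfun (ideal_add K1 K2) := submod_add (phi := idfun) iK1 iK2.
have mono K : submod idfun K ->
    (len idfun (ideal_add (hkI (e + n)) K) setT <= len idfun (ideal_add (VI_ n e) K) setT <=
     len idfun (ideal_add (hkI (e + n)) K) setT + C' * (p ^ e) ^ d.-1)%N.
  move=> sK.
  have sVK := submod_add sV sK; have sIK := submod_add (sI (e + n)%N) sK.
  have sub : ideal_add (VI_ n e) K `<=` ideal_add (hkI (e + n)) K.
    by move=> _ [y [z [/VI Iy Kz ->]]]; exists y, z.
  have fVK : len_fin idfun (ideal_add (VI_ n e) K) setT.
    by apply: len_fin_sub fV => //; apply: sub_addl sK.
  rewrite (lenD sVK sIK sT sub (@subsetT _ _) fVK) leq_addl /= addnC leq_add2l.
  apply: leq_trans (hC' e); apply: (len_le_len sVK sub) => j hj.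
  have fVI : len_fin idfun (VI_ n e) (hkI (e + n)) by apply: len_fin_sub fV.
  apply: (proj2 (len_leP _ sV VI fVI) (leqnn _)).
  apply: (has_chain_pull (f := idfun) _ _ _ _ hj).
  - by move=> J sJ; apply: (submod_setI (sI _) sJ).
  - exact: VI.
  - by move=> v Vv; apply: sub_addl sK _ Vv.
  - move=> _ [y [z [Iy Kz ->]]]; exists y => //=; rewrite addrC addKr.
    exact: sub_addr sV _ Kz.
have /andP[_ h1] := mono K1 iK1; have /andP[_ h2] := mono K2 iK2.
have /andP[h3 _] := mono _ iK12.
have h4 : (len idfun (hkI (e + n)) setT <= len idfun (VI_ n e) setT)%N.
  by rewrite (lenD sV (sI _) sT VI (@subsetT _ _) fV) leq_addl.
have := hC e; rewrite !mulnDl; lia.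
Qed.

End HilbertKunz.

(** * Limits *)

Section CeilingExponents.
Variables (K : realType) (p : nat) (s : K).
Hypothesis s_gt0 : 0 < s.

Definition ceil_exp e : nat := `|Num.ceil (s * p%:R ^+ e)|%N.

Let scale_ge0 e : 0 <= s * p%:R ^+ e.
Proof. by rewrite mulr_ge0 ?exprn_ge0 // ltW. Qed.

Let ceil_expE e : (ceil_exp e)%:R = (Num.ceil (s * p%:R ^+ e))%:~R :> K.
Proof.
by rewrite natr_absz ger0_norm // ceil_ge0; apply: lt_le_trans (scale_ge0 e); rewrite ltrN10.
Qed.

Lemma ceil_exp_ge e : s * p%:R ^+ e <= (ceil_exp e)%:R.
Proof. by rewrite ceil_expE ceil_ge. Qed.

Lemma ceil_exp_le e n : s * p%:R ^+ e <= n%:R -> (ceil_exp e <= n)%N.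
Proof.
move=> h; rewrite -(ler_nat K) ceil_expE -[n%:R]/((n%:Z)%:~R) ler_int ceil_le_int.
exact: h.
Qed.

Lemma ceil_exp_step e : (ceil_exp e.+1 <= p * ceil_exp e)%N.
Proof.
apply: ceil_exp_le; rewrite exprS mulrCA natrM.
by apply: ler_wpM2l => //; apply: ceil_exp_ge.
Qed.

Lemma ceil_exp_low n e : (p ^ n * ceil_exp e <= ceil_exp (e + n) + p ^ n)%N.
Proof.
rewrite -(ler_nat K) natrM natrD natrX.
apply: (@le_trans _ _ (p%:R ^+ n * (s * p%:R ^+ e + 1))).
  apply: ler_wpM2l; first exact: exprn_ge0.
  by rewrite ceil_expE -lerBlDr; have := ltW (ceilB1_lt (s * p%:R ^+ e)); rewrite intrB.
by rewrite mulrDr mulr1 lerD2r mulrCA -exprD addnC; apply: ceil_exp_ge.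
Qed.

Lemma ceil_exp_lin e : (ceil_exp e <= ceil_exp 0 * p ^ e)%N.
Proof.
apply: ceil_exp_le; rewrite natrM natrX; apply: ler_wpM2r; first exact: exprn_ge0.
by have := ceil_exp_ge 0; rewrite expr0 mulr1.
Qed.

End CeilingExponents.

(** Adding the remaining sum of errors, [C / (1 - z) * z ^+ e], makes the sequence nonincreasing. *)
Lemma almost_nonincreasing_cvg (K : realType) (u : K^nat) (C z : K) :
  0 <= C -> 0 <= z < 1 -> (forall e, 0 <= u e) ->
  (forall e, u e.+1 <= u e + C * z ^+ e) -> cvgn u.
Proof.
move=> C0 /andP[z0 z1] u0 hu.
have z1' : 0 < 1 - z by rewrite subr_gt0.
pose g e := C / (1 - z) * z ^+ e.
have g0 e : 0 <= g e by rewrite /g mulr_ge0 ?exprn_ge0 // divr_ge0 // ltW.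
have cg : g @ \oo --> (0 : K) by apply: cvg_geometric; rewrite ger0_norm.
have cu : cvgn (u + g).
  apply: nonincreasing_is_cvgn.
    apply/nonincreasing_seqP => e; rewrite /= /GRing.add /=.
    have -> : g e = C * z ^+ e + g e.+1.
      by rewrite /g exprS; field; apply: lt0r_neq0.
    by rewrite addrA lerD2r.
  by exists 0 => _ [e _ <-]; rewrite /= addr_ge0.
have -> : u = (u + g) - g by apply/funext => e; rewrite /= addrK.
by apply: is_cvgB => //; apply: cvgP cg.
Qed.

Section Density.
Variables (K : realType) (p : nat) (d : nat).
Hypotheses (p_prime : prime p) (d_gt0 : (0 < d)%N).
Let z : K := p%:R^-1.

(** The exponent [d] is independent of any ring, since rings of smaller dimension are also
    normalized by the dimension of [R]. *)
Definition density (a : nat -> nat) (e : nat) : K := (a e)%:R / p%:R ^+ (e * d).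

Let p_gt0 : (0 : K) < p%:R. Proof. by rewrite ltr0n prime_gt0. Qed.
Let z01 : 0 <= z < 1.
Proof.
by rewrite /z invr_ge0 (ltW p_gt0) /= invf_lt1 // ltr1n prime_gt1.
Qed.

Lemma density_ge0 a e : 0 <= density a e.
Proof. by rewrite divr_ge0 ?ler0n ?exprn_ge0 // ltW. Qed.

Lemma densityD a b e : density (fun e => a e + b e)%N e = density a e + density b e.
Proof. by rewrite /density natrD mulrDl. Qed.

Lemma density_mono a b e : (a e <= b e)%N -> density a e <= density b e.
Proof.
move=> h; rewrite /density; apply: ler_wpM2r; last by rewrite ler_nat.
by rewrite invr_ge0 exprn_ge0 // ltW.
Qed.

Lemma density_low C e : density (fun e => C * (p ^ e) ^ d.-1)%N e = C%:R * z ^+ e.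
Proof.
have y0 : (p%:R ^+ e : K) != 0 by rewrite lt0r_neq0 // exprn_gt0.
have e1 : (e * d = e * d.-1 + e)%N by rewrite -{1}(prednK d_gt0) mulnS addnC.
rewrite /density e1 natrM !natrX exprD exprM exprVn mulrC invfM mulrA [_^-1 * _ * _]mulrC.
by field; rewrite y0 expf_neq0.
Qed.

Lemma density_low_cvg0 C : (fun e => C%:R * z ^+ e) @ \oo --> (0 : K).
Proof. by apply: cvg_geometric; case/andP: z01 => z0 z1; rewrite ger0_norm. Qed.

Lemma density_shift a n e : density (fun e => a (e + n)%N) e = p%:R ^+ (n * d) * density a (e + n)%N.
Proof.
rewrite /density mulnDl exprD.
have y0 : (p%:R ^+ (n * d) : K) != 0 by rewrite lt0r_neq0 // exprn_gt0.
by field; rewrite y0 lt0r_neq0 // exprn_gt0.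
Qed.

Lemma density_cvg0 a C n : (forall e, (a (e + n) <= C * (p ^ e) ^ d.-1)%N) ->
  density a @ \oo --> (0 : K).
Proof.
move=> h; rewrite -(cvg_shiftn n).
have y0 : 0 < (p%:R ^+ (n * d) : K) by rewrite exprn_gt0.
apply: (@squeeze_cvgr _ _ _ _ (cst 0) (fun e => C%:R * z ^+ e * (p%:R ^+ (n * d))^-1)).
- apply: nearW => e; rewrite /= density_ge0 /= ler_pdivlMr // mulrC -density_shift -density_low.
  exact: density_mono.
- exact: cvg_cst.
- by rewrite -[0](mul0r (p%:R ^+ (n * d))^-1); apply: cvgMl; apply: density_low_cvg0.
Qed.

Lemma density_cvg a b C n :
  (forall e, [/\ (b e.+1 <= p ^ d * b e + C * (p ^ e) ^ d.-1)%N, (a (e + n) <= b e)%N &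
     (b e <= a (e + n) + C * (p ^ e) ^ d.-1)%N]) -> cvgn (density a).
Proof.
move=> h; have y0 : 0 < (p%:R ^+ (n * d) : K) by rewrite exprn_gt0.
have cb : cvgn (density b).
  apply: (@almost_nonincreasing_cvg _ _ C%:R z) => // [e|e]; first exact: density_ge0.
  have [h1 _ _] := h e; rewrite -density_low.
  have pd0 : 0 < (p%:R ^+ d : K) by rewrite exprn_gt0.
  have -> : density b e + density (fun e => C * (p ^ e) ^ d.-1)%N e =
            p%:R ^+ d * (b e)%:R / p%:R ^+ (e.+1 * d) + density (fun e => C * (p ^ e) ^ d.-1)%N e.
    rewrite /density mulSn exprD; congr (_ + _); field.
    by rewrite !lt0r_neq0 // exprn_gt0.
  rewrite -natrX -natrM; apply: (@le_trans _ _ ((p ^ d * b e + C * (p ^ e) ^ d.-1)%:R / p%:R ^+ (e.+1 * d))).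
    apply: ler_wpM2r; last by rewrite ler_nat.
    by rewrite invr_ge0 exprn_ge0 // ltW.
  rewrite natrD mulrDl lerD2l /density; apply: ler_wpM2l; first exact: ler0n.
  by rewrite lef_pV2 ?posrE ?exprn_gt0 // ler_eXn2l ?ltr1n ?prime_gt1 // leq_mul2r leqnSn orbT.
have ca : density (fun e => a (e + n)%N) @ \oo --> lim (density b @ \oo).
  apply: (@squeeze_cvgr _ _ _ _ (density b - (fun e => C%:R * z ^+ e)) (density b)) => //.
    apply: nearW => e; have [_ h1 h2] := h e; rewrite (density_mono h1) andbT.
    by rewrite /= /GRing.add /= lerBlDr -density_low -densityD; apply: density_mono.
  by rewrite -[lim _]subr0; apply: cvgB => //; apply: density_low_cvg0.
apply: cvgP; rewrite -(cvg_shiftn n).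
have -> : [sequence density a (e + n)%N]_e = (fun e => (p%:R ^+ (n * d))^-1 * density (fun e => a (e + n)%N) e).
  by apply/funext => e /=; rewrite density_shift mulKf // lt0r_neq0.
by apply: cvgMr; exact: ca.
Qed.

End Density.

(** * Surjections and fiber products *)

Section HkLength.
Variables (K : realType) (p : nat) (s : K).
Hypothesis s_gt0 : 0 < s.
Variables (A : comNzRingType) (k : fieldType) (pi : {rmorphism A -> k}).
Hypotheses (lA : noetherian_local A) (pA : p \in [pchar A]) (pi_res : residue_map pi).

Definition hk_length (A : comNzRingType) e := len idfun (@hk_ideal A p (ceil_exp p s) e) setT.

Lemma h_seqE : h_seq p s A = density K p (krull_dim A) (hk_length A).
Proof. by apply/funext => e; rewrite /h_seq quot_lengthE. Qed.

Lemma hk_density_cvg d : (0 < d)%N -> (forall l, prime_chain A l -> (l <= d)%N) ->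
  cvgn (density K p d (hk_length A)).
Proof.
move=> d0 hd.
have [n [C [b h]]] := hk_frobenius_bound lA pA pi_res (ceil_exp_step p s_gt0)
  (ceil_exp_low p s_gt0) (ceil_exp_lin p s_gt0) hd d0.
exact: (density_cvg (pcharf_prime pA) d0 h).
Qed.

Lemma hk_density_cvg0 d d' : (d' < d)%N -> (forall l, prime_chain A l -> (l <= d')%N) ->
  density K p d (hk_length A) @ \oo --> (0 : K).
Proof.
move=> lt hd; have d0 : (0 < d)%N by apply: leq_ltn_trans lt.
have [C h] := hk_length_bound lA pA pi_res (ceil_exp_lin p s_gt0) hd.
apply: (@density_cvg0 K p d (pcharf_prime pA) d0 _ C 0) => e; rewrite addn0.
apply: leq_trans (h e) _; rewrite leq_mul2l; apply/orP; right.
by apply: leq_pexp2l; [rewrite expn_gt0 (pchar_gt0 pA)|rewrite -ltnS prednK].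
Qed.

End HkLength.

Section Surjections.
Variables (A B : comNzRingType) (f : {rmorphism A -> B}).
Hypothesis f_onto : forall b, exists a, f a = b.
Implicit Types (I J P : set A).

Lemma image_ideal I : ideal I -> ideal (f @` I).
Proof.
move=> [I0 ID IM]; split; first by exists 0; rewrite ?rmorph0.
  by move=> _ _ [x Ix <-] [y Iy <-]; exists (x + y); rewrite ?rmorphD //; apply: ID.
move=> b _ [x Ix <-]; have [a <-] := f_onto b.
by exists (a * x); rewrite ?rmorphM //; apply: IM.
Qed.

Lemma preimage_ideal (J : set B) : ideal J -> ideal (f @^-1` J).
Proof.
move=> [J0 JD JM]; split=> [|x y|a x]; rewrite /preimage /= ?rmorph0 ?rmorphD ?rmorphM //.
  exact: JD.
exact: JM.
Qed.

Lemma image_gen (X : set A) : f @` ideal_gen X = ideal_gen (f @` X).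
Proof.
apply/seteqP; split.
  move=> _ [x hx <-]; apply: (ideal_gen_min (preimage_ideal (ideal_genP _)) _ hx).
  by move=> y Xy; apply: ideal_gen_sub; exists y.
apply: ideal_gen_min; first by apply: image_ideal; exact: ideal_genP.
by move=> _ [x Xx <-]; exists x => //; apply: ideal_gen_sub.
Qed.

Lemma image_pow I n : f @` ideal_pow I n = ideal_pow (f @` I) n.
Proof.
rewrite /ideal_pow image_gen; congr ideal_gen; apply/seteqP; split.
  by move=> _ [_ [x [Ix ->]] <-]; exists (f \o x); rewrite rmorph_prod; split=> // i; exists (x i).
move=> _ [y [Iy ->]].
have /choice[x hx] i : exists a, I a /\ f a = y i by have [a] := Iy i; exists a.
exists (\prod_i x i); last by rewrite rmorph_prod; apply: eq_bigr => i _; case: (hx i).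
by exists x; split=> // i; case: (hx i).
Qed.

Lemma image_frob I q : f @` frob_pow I q = frob_pow (f @` I) q.
Proof.
rewrite /frob_pow image_gen; congr ideal_gen; apply/seteqP; split.
  by move=> _ [_ [x Ix <-] <-]; exists (f x); [exists x|rewrite rmorphXn].
by move=> _ [_ [x Ix <-] <-]; exists (x ^+ q); [exists x|rewrite rmorphXn].
Qed.

Lemma image_add I J : f @` ideal_add I J = ideal_add (f @` I) (f @` J).
Proof.
apply/seteqP; split.
  move=> _ [_ [x [y [Ix Jy ->]]] <-]; rewrite rmorphD.
  by exists (f x), (f y).
move=> _ [_ [_ [[x Ix <-] [y Jy <-] ->]]]; exists (x + y); last by rewrite rmorphD.
by exists x, y.
Qed.

Lemma len_image I : ideal I ->
  len idfun (ideal_add I (f @^-1` [set 0])) setT = len idfun (f @` I) setT.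
Proof.
move=> iI; have iK : ideal (f @^-1` [set 0]).
  by apply: preimage_ideal; split=> [//|_ _ -> ->|a _ ->]; rewrite ?addr0 ?mulr0.
have sIK : submod idfun (ideal_add I (f @^-1` [set 0])) by apply: (submod_add (phi := idfun)).
congr supremum; apply/seteqP; split=> n.
  apply: (has_chain_push (f := f)) => //.
  - exact: rmorphB.
  - by move=> J sJ _; apply: (submod_add (phi := idfun)); apply: image_ideal.
  - exact: image_ideal.
  - move=> u _ [x Ix e]; exists x, (u - x); split=> //; last by rewrite addrC subrK.
    by rewrite /preimage /= rmorphB e subrr.
apply: (has_chain_pull (f := f)) => //.
- by move=> J sJ; apply: (submod_setI (phi := idfun) (submodT _)); apply: preimage_ideal.
- move=> _ [x [y [Ix Ky ->]]]; rewrite rmorphD Ky addr0; by exists x.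
- move=> y _; have [x <-] := f_onto y; exists x => //.
  by rewrite subrr; case: (image_ideal iI).
Qed.

Lemma preimage_prime (Q : set B) : prime_ideal Q -> prime_ideal (f @^-1` Q).
Proof.
move=> [[iQ Q1] QM]; split; first split; first exact: preimage_ideal.
  by rewrite /preimage /= rmorph1.
by move=> x y; rewrite /preimage /= rmorphM; apply: QM.
Qed.

Lemma prime_chain_preimage l : prime_chain B l -> prime_chain A l.
Proof.
move=> [c [c1 c2]]; exists (fun i => f @^-1` (c i)); split=> i h.
  by apply: preimage_prime; apply: c1.
have [s ns] := c2 _ h; split; first by move=> x; apply: s.
by move=> h'; apply: ns => y; have [x <-] := f_onto y; apply: h'.
Qed.

Lemma prime_chain_image l (c : nat -> set A) :
  (forall i, (i <= l)%N -> prime_ideal (c i)) -> (forall i, (i < l)%N -> c i `<` c i.+1) ->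
  f @^-1` [set 0] `<=` c 0%N -> prime_chain B l.
Proof.
move=> c1 c2 c0.
have Kc i : (i <= l)%N -> f @^-1` [set 0] `<=` c i.
  elim: i => [//|i IH] h; have [s _] := c2 _ h.
  by apply: subset_trans (IH (ltnW h)) s.
have in_c i x : (i <= l)%N -> (f @` c i) (f x) -> c i x.
  move=> h [y cy e]; have [[ic _] _] := c1 _ h.
  rewrite -(subrK y x); have [_ cD _] := ic; apply: cD => //; apply: Kc => //.
  by rewrite /preimage /= rmorphB e subrr.
exists (fun i => f @` c i); split=> i h.
  have [[ic n1] cM] := c1 _ h; split; first split; first exact: image_ideal.
    by rewrite -(rmorph1 f) => /(in_c _ _ h).
  move=> y z; have [x <-] := f_onto y; have [x' <-] := f_onto z.
  by rewrite -rmorphM => /(in_c _ _ h) /cM[]; [left; exists x|right; exists x'].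
have [s ns] := c2 _ h; split; first by move=> _ [x cx <-]; exists x => //; apply: s.
move=> h'; apply: ns => x cx; apply: (in_c _ _ (ltnW h)); apply: h'.
by exists x.
Qed.

Hypotheses (lA : noetherian_local A) (lB : noetherian_local B).

Lemma max_ideal_preimage : f @^-1` max_ideal B = max_ideal A.
Proof.
apply/seteqP; split=> a ha.
  apply: contrapT => /(max_ideal_unit lA)[t e]; apply: (max_ideal1 lB).
  by rewrite -(rmorph1 f) -e rmorphM; case: (max_ideal_ideal lB) => _ _; apply.
apply: contrapT => /(max_ideal_unit lB)[t' e]; have [t et] := f_onto t'; rewrite -et in e.
have K1 : (f @^-1` max_ideal B) (1 - t * a).
  rewrite /preimage /= rmorphB rmorph1 rmorphM e subrr.
  by case: (max_ideal_ideal lB).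
have pB : ideal_proper (f @^-1` max_ideal B).
  by have [] := preimage_prime (max_ideal_prime lB).
have := proper_sub_max lA pB K1; have [_ mD mM] := max_ideal_ideal lA.
by move=> /mD /(_ (mM t _ ha)); rewrite subrK; apply: max_ideal1.
Qed.

Lemma max_ideal_image : f @` max_ideal A = max_ideal B.
Proof.
rewrite -max_ideal_preimage; apply/seteqP; split=> [_ [x hx <-]//|y hy].
by have [x e] := f_onto y; exists x; rewrite // /preimage /= e.
Qed.

Lemma image_hk_ideal p N e : f @` (@hk_ideal A p N e) = @hk_ideal B p N e.
Proof. by rewrite /hk_ideal image_add image_pow image_frob max_ideal_image. Qed.

End Surjections.

(** Lifted generators of the image under [f] account for [I] modulo the kernel of [f]. The rest of
    [I] lies in that kernel, where [g] is injective, so generators lifted from its image under [g]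
    suffice. *)
Lemma noetherian_subdirect (A R S : comNzRingType) (f : {rmorphism A -> R}) (g : {rmorphism A -> S}) :
  (forall r, exists a, f a = r) -> (forall r, exists a, g a = r) ->
  (forall a, f a = 0 -> g a = 0 -> a = 0) -> noetherian R -> noetherian S -> noetherian A.
Proof.
move=> f_onto g_onto fg0 nR nS I iI.
have lift (B : comNzRingType) (h : {rmorphism A -> B}) J : (forall b, exists a, h a = b) ->
    noetherian B -> ideal J -> exists2 t : seq A, (forall x, x \in t -> J x) &
      forall x, J x -> exists2 y, ideal_gen [set` t] y & h y = h x.
  move=> h_onto nB iJ; have [l el] := nB _ (image_ideal h_onto iJ).
  have /choice[r hr] b : exists a, b \in l -> J a /\ h a = b.
    have [bl|nb] := boolP (b \in l); last by exists 0.
    have : (h @` J) b by rewrite el; apply: ideal_gen_sub.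
    by move=> [a Ja e]; exists a.
  exists (map r l) => [_ /mapP[b bl ->]|x Jx]; first by case: (hr b bl).
  have : (h @` ideal_gen [set` map r l]) (h x).
    rewrite image_gen //.
    have : ideal_gen [set` l] (h x) by rewrite -el; exists x.
    apply: ideal_gen_mono => b bl; exists (r b); last by case: (hr b bl).
    by rewrite /= map_f.
  by move=> [y]; exists y.
have iIK : ideal (I `&` f @^-1` [set 0]).
  apply: (submod_setI (phi := idfun)) => //; apply: preimage_ideal.
  by split=> [//|_ _ -> ->|a _ ->]; rewrite ?addr0 ?mulr0.
have [t1 It1 ht1] := lift _ f I f_onto nR iI.
have [t2 It2 ht2] := lift _ g _ g_onto nS iIK.
exists (t1 ++ t2); apply/seteqP; split; last first.
  apply: ideal_gen_min => // x /=; rewrite mem_cat => /orP[/It1//|/It2[]//].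
move=> x Ix; have [y gy ey] := ht1 x Ix.
have Iy : I y by apply: (ideal_gen_min iI _ gy) => z; apply: It1.
have [|w gw ew] := ht2 (x - y).
  split; first exact: (submodB (phi := idfun) iI).
  by rewrite /preimage /= rmorphB ey subrr.
have [_ fw] : (I `&` f @^-1` [set 0]) w by apply: (ideal_gen_min iIK _ gw) => z; apply: It2.
have -> : x = y + w.
  apply/eqP; rewrite -subr_eq0 opprD addrA; apply/eqP; apply: fg0.
    by rewrite !rmorphB ey subrr fw subr0.
  by rewrite rmorphB ew subrr.
have [_ D _] := ideal_genP [set` t1 ++ t2]; apply: D.
  by apply: ideal_gen_mono gy => z /= zt; rewrite mem_cat zt.
by apply: ideal_gen_mono gw => z /= zt; rewrite mem_cat zt orbT.
Qed.

Lemma local_of_units (A : comNzRingType) (N : set A) : ideal_proper N ->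
  (forall x, ~ N x -> exists y, y * x = 1) -> noetherian A ->
  noetherian_local A /\ max_ideal A = N.
Proof.
move=> pN hN nA.
have sub J : ideal_proper J -> J `<=` N.
  move=> [[_ _ JM] J1] x Jx; apply: contrapT => /hN[y e]; apply: J1.
  by rewrite -e; apply: JM.
have mN : maximal_ideal N.
  by split=> // J pJ NJ; apply/seteqP; split=> //; apply: sub.
have lA : noetherian_local A.
  split=> //; exists N; split=> // M [pM hM]; symmetry.
  by rewrite -(hM N) //; apply: sub.
by split=> //; rewrite (max_ideal_unique lA mN).
Qed.

Section FiberProducts.
Variables (R S T : comNzRingType) (eR : {rmorphism R -> T}) (eS : {rmorphism S -> T}).
Hypotheses (R_local : noetherian_local R) (S_local : noetherian_local S)
  (T_local : noetherian_local T).
Hypotheses (eR_onto : forall t, exists r, eR r = t) (eS_onto : forall t, exists s, eS s = t).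
Local Notation P := (fiber_prod eR eS).

Definition fib_fst : {rmorphism P -> R} := fst \o (val : P -> R * S)%type.
Definition fib_snd : {rmorphism P -> S} := snd \o (val : P -> R * S)%type.
Definition fib_base : {rmorphism P -> T} := eR \o fib_fst.

Lemma fib_ext (x y : P) : fib_fst x = fib_fst y -> fib_snd x = fib_snd y -> x = y.
Proof.
by move=> h1 h2; apply: val_inj; apply/eqP/andP; split; apply/eqP.
Qed.

Lemma fib_eq (x : P) : eR (fib_fst x) = eS (fib_snd x).
Proof. by case: x => v hv; apply/eqP. Qed.

Lemma fib_mk r s : eR r = eS s -> exists x : P, fib_fst x = r /\ fib_snd x = s.
Proof. by move/eqP => h; exists (@FiberProd _ _ _ eR eS (r, s) h). Qed.

Lemma fib_fst_onto r : exists x, fib_fst x = r.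
Proof. by have [s /esym/fib_mk[x []]] := eS_onto (eR r); exists x. Qed.

Lemma fib_snd_onto s : exists x, fib_snd x = s.
Proof. by have [r /fib_mk[x []]] := eR_onto (eS s); exists x. Qed.

Lemma fib_base_onto t : exists x, fib_base x = t.
Proof. by have [r <-] := eR_onto t; have [x <-] := fib_fst_onto r; exists x. Qed.

Lemma fib_local : noetherian_local P /\ max_ideal P = fib_base @^-1` max_ideal T.
Proof.
have [pN _] := preimage_prime fib_base (max_ideal_prime T_local).
apply: local_of_units pN _ _ => [x hx|].
  have [r er] : exists r, r * fib_fst x = 1.
    by apply: (max_ideal_unit R_local); rewrite -(max_ideal_preimage eR_onto R_local T_local).
  have [s es] : exists s, s * fib_snd x = 1.
    apply: (max_ideal_unit S_local); rewrite -(max_ideal_preimage eS_onto S_local T_local).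
    by rewrite /preimage /= -fib_eq.
  (* Both inverses map to the inverse of the same element of [T], so they glue. *)
  have [|y [y1 y2]] := @fib_mk r s.
    rewrite -[LHS]mulr1 -(rmorph1 eS) -es rmorphM -fib_eq mulrCA mulrC -rmorphM er.
    by rewrite rmorph1 mul1r.
  by exists y; apply: fib_ext; rewrite rmorphM rmorph1 ?y1 ?y2.
apply: (noetherian_subdirect fib_fst_onto fib_snd_onto) (local_noetherian R_local)
  (local_noetherian S_local) => a h1 h2.
by apply: fib_ext; rewrite ?h1 ?h2 rmorph0.
Qed.

Lemma fib_residue (k : fieldType) (pT : {rmorphism T -> k}) :
  residue_map pT -> residue_map (pT \o fib_base).
Proof.
move=> [s e]; split.
  by move=> c /s[t _ <-]; have [x <-] := fib_base_onto t; exists x.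
by have [_ ->] := fib_local; rewrite -e.
Qed.

Lemma fib_pchar p : p \in [pchar R] -> p \in [pchar S] -> p \in [pchar P].
Proof.
rewrite !inE => /andP[-> /eqP hR] /andP[_ /eqP hS] /=; apply/eqP.
by apply: fib_ext; rewrite rmorph_nat rmorph0.
Qed.

(** The kernels of the two projections multiply to zero, so the smallest prime of the chain contains
    one of them. *)
Lemma fib_prime_chain l : prime_chain P l -> prime_chain R l \/ prime_chain S l.
Proof.
move=> [c [c1 c2]]; have [[[c00 cD cM] _] cP] := c1 0%N isT.
have [h|/existsNP[x /not_implyP[Kx ncx]]] := pselect (fib_fst @^-1` [set 0] `<=` c 0%N).
  by left; apply: (prime_chain_image fib_fst_onto c1 c2 h).
right; apply: (prime_chain_image fib_snd_onto c1 c2) => y Ky.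
have : c 0%N (x * y).
  suff -> : x * y = 0 by [].
  by apply: fib_ext; rewrite rmorphM rmorph0 ?Kx ?Ky ?mul0r ?mulr0.
by move/cP => -[].
Qed.

Lemma fib_kernel : ideal_add (fib_fst @^-1` [set 0]) (fib_snd @^-1` [set 0]) = fib_base @^-1` [set 0].
Proof.
apply/seteqP; split.
  move=> _ [x [y [Kx Ky ->]]]; change (eR (fib_fst (x + y)) = 0).
  have -> : fib_fst (x + y) = fib_fst y by rewrite -[RHS]add0r -[in RHS]Kx; apply: rmorphD.
  by rewrite fib_eq [fib_snd y]Ky rmorph0.
move=> x Kx; have [|y [y1 y2]] := @fib_mk (fib_fst x) 0; first by rewrite rmorph0.
exists (x - y), y; rewrite subrK; split=> //.
have e : fib_fst (x - y) = fib_fst x - fib_fst y by apply: rmorphB.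
by change (fib_fst (x - y) = 0); rewrite e y1 subrr.
Qed.

Lemma krull_dim_fib : (0 < krull_dim R)%N -> (krull_dim S <= krull_dim R)%N ->
  (forall l, prime_chain S l -> (l <= krull_dim S)%N) ->
  krull_dim P = krull_dim R /\ (forall l, prime_chain P l -> (l <= krull_dim R)%N).
Proof.
move=> dR le hS; have hR := prime_chain_le dR.
have hP l : prime_chain P l -> (l <= krull_dim R)%N.
  by move/fib_prime_chain => [/hR|/hS h] //; apply: leq_trans h le.
split=> //; apply: krull_dim_eq hP; apply: (prime_chain_preimage fib_fst_onto).
apply: (proj1 (krull_dim_attained _ hR)); exists (max_ideal R); exact: max_ideal_prime.
Qed.

Variables (K : realType) (p : nat) (s : K) (k : fieldType) (pT : {rmorphism T -> k}).
Hypotheses (s_gt0 : 0 < s) (pT_res : residue_map pT) (pR : p \in [pchar R]) (pS : p \in [pchar S]).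
Local Notation hkl := (hk_length p s).

Lemma hk_density_fib d : (0 < d)%N -> (forall l, prime_chain P l -> (l <= d)%N) ->
  (fun e => density K p d (hkl P) e + density K p d (hkl T) e -
     density K p d (hkl R) e - density K p d (hkl S) e) @ \oo --> (0 : K).
Proof.
move=> d0 hd; have [lP _] := fib_local; have pP := fib_pchar pR pS.
pose K1 := fib_fst @^-1` [set 0]; pose K2 := fib_snd @^-1` [set 0].
have i0 (A : comNzRingType) : ideal [set (0 : A)].
  by split=> [//|_ _ -> ->|a _ ->]; rewrite ?addr0 ?mulr0.
have iK1 : ideal K1 by apply: preimage_ideal; exact: i0.
have iK2 : ideal K2 by apply: preimage_ideal; exact: i0.
have K12 z : K1 z -> K2 z -> z = 0.
  by move=> h1 h2; apply: fib_ext; rewrite ?h1 ?h2 rmorph0.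
have [le [n [C ge]]] := hk_additive lP pP (fib_residue pT_res) (ceil_exp_step p s_gt0)
  (ceil_exp_low p s_gt0) (ceil_exp_lin p s_gt0) hd d0 iK1 iK2 K12.
have quot (B : comNzRingType) (f : {rmorphism P -> B}) e : (forall b, exists a, f a = b) ->
    noetherian_local B -> len idfun (ideal_add (@hk_ideal P p (ceil_exp p s) e) (f @^-1` [set 0])) setT = hkl B e.
  move=> f_onto lB; rewrite len_image //; last exact: hk_ideal_ideal.
  by rewrite image_hk_ideal.
have e1 e := quot _ fib_fst e fib_fst_onto R_local.
have e2 e := quot _ fib_snd e fib_snd_onto S_local.
have e3 e := quot _ fib_base e fib_base_onto T_local.
pose a e := (hkl P e + hkl T e - (hkl R e + hkl S e))%N.
have le' e : (hkl R e + hkl S e <= hkl P e + hkl T e)%N.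
  by have := le e; rewrite fib_kernel e1 e2 e3.
have -> : (fun e => density K p d (hkl P) e + density K p d (hkl T) e -
     density K p d (hkl R) e - density K p d (hkl S) e) = density K p d a.
  apply/funext => e; rewrite -addrA -opprD -!densityD /density -mulrBl /a.
  by rewrite natrB.
apply: (@density_cvg0 K p d (pcharf_prime pP) d0 _ C n) => e; rewrite /a leq_subLR.
by have := ge e; rewrite fib_kernel e1 e2 e3.
Qed.

End FiberProducts.

Unset Implicit Arguments.

Theorem lemma3p4 (K : realType) (p : nat) (s : K)
  (R S T : comNzRingType) (k : fieldType)
  (pR : {rmorphism R -> k}) (pS : {rmorphism S -> k}) (pT : {rmorphism T -> k})
  (eR : {rmorphism R -> T}) (eS : {rmorphism S -> T})
  (R_local : noetherian_local R) (S_local : noetherian_local S) (T_local : noetherian_local T)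
  (pR_res : residue_map pR) (pS_res : residue_map pS) (pT_res : residue_map pT)
  (R_char : p \in [pchar R]) (S_char : p \in [pchar S]) (T_char : p \in [pchar T])
  (eR_surj : set_surj setT setT eR) (eS_surj : set_surj setT setT eS)
  (dimR_gt0 : (0 < krull_dim R)%N) (s_gt0 : 0 < s) :
  [/\ krull_dim R = krull_dim S /\ krull_dim S = krull_dim T ->
        h_fun p s (fiber_prod eR eS) = h_fun p s R + h_fun p s S - h_fun p s T,
      krull_dim R = krull_dim S /\ (krull_dim T < krull_dim S)%N ->
        h_fun p s (fiber_prod eR eS) = h_fun p s R + h_fun p s S
    & (krull_dim S < krull_dim R)%N /\ (krull_dim T < krull_dim S)%N ->
        h_fun p s (fiber_prod eR eS) = h_fun p s R].
Proof.
have eR_onto t : exists r, eR r = t by have [r _ <-] := eR_surj t Logic.I; exists r.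
have eS_onto t : exists r, eS r = t by have [r _ <-] := eS_surj t Logic.I; exists r.
set d := krull_dim R.
(* The fiber product also has dimension [d], so one normalization serves all four rings; the cases
   differ only in which of [lS] and [lT] are [0]. *)
have cvg_fib (lR lS lT : K) :
    (krull_dim S <= d)%N -> (forall l, prime_chain S l -> (l <= krull_dim S)%N) ->
    density K p d (hk_length p s R) @ \oo --> lR ->
    density K p d (hk_length p s S) @ \oo --> lS ->
    density K p d (hk_length p s T) @ \oo --> lT ->
    h_fun p s (fiber_prod eR eS) = lR + lS - lT.
  move=> dS hS cR cS cT.
  have [dP hP] := krull_dim_fib R_local eR_onto eS_onto dimR_gt0 dS hS.
  rewrite /h_fun h_seqE dP; apply: cvg_lim => //.
  have c0 := hk_density_fib R_local S_local T_local eR_onto eS_onto s_gt0 pT_res R_char S_char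
    dimR_gt0 hP.
  have -> : density K p d (hk_length p s (fiber_prod eR eS)) = (fun e =>
      density K p d (hk_length p s (fiber_prod eR eS)) e + density K p d (hk_length p s T) e -
      density K p d (hk_length p s R) e - density K p d (hk_length p s S) e)
      + density K p d (hk_length p s S) + density K p d (hk_length p s R)
      - density K p d (hk_length p s T).
    by apply/funext => e; rewrite /= /GRing.add /= !subrK addrK.
  by rewrite [lR + lS]addrC -[lS]add0r; apply: cvgB => //; do 2 apply: cvgD => //.
have h_cvg (A : comNzRingType) (k' : fieldType) (pA : {rmorphism A -> k'}) : noetherian_local A -> residue_map pA ->
    p \in [pchar A] -> krull_dim A = d -> density K p d (hk_length p s A) @ \oo --> h_fun p s A.
  move=> lA pA_res A_char dA; rewrite /h_fun h_seqE dA.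
  apply: (hk_density_cvg s_gt0 lA A_char pA_res dimR_gt0) => l; rewrite -/d -dA.
  by apply: prime_chain_le; rewrite dA.
(* [krull_dim T] may be [0], which is also the default value, so boundedness of chains in [T] is
   drawn from [S]. *)
have dim_T : (0 < krull_dim S)%N -> forall l, prime_chain T l -> (l <= krull_dim T)%N.
  move=> dS; apply: (proj2 (@krull_dim_attained T (krull_dim S) _ _)).
    by exists (max_ideal T); exact: max_ideal_prime.
  by move=> l /(prime_chain_preimage eS_onto); apply: prime_chain_le.
have cR := h_cvg _ _ _ R_local pR_res R_char erefl.
split=> -[dS dT].
- apply: cvg_fib => //.
  + by rewrite -dS.
  + by apply: prime_chain_le; rewrite -dS.
  + exact: (h_cvg _ _ _ S_local pS_res).
  + by apply: (h_cvg _ _ _ T_local pT_res) => //; rewrite -dT.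
- rewrite -[RHS]subr0; apply: cvg_fib => //.
  + by rewrite -dS.
  + by apply: prime_chain_le; rewrite -dS.
  + exact: (h_cvg _ _ _ S_local pS_res).
  + apply: (hk_density_cvg0 s_gt0 T_local T_char pT_res) (dim_T _); first by rewrite dS.
    by rewrite -dS.
- have S0 : (0 < krull_dim S)%N by apply: leq_ltn_trans dT.
  have -> : h_fun p s R = h_fun p s R + 0 - 0 by rewrite subr0 addr0.
  apply: cvg_fib => //.
  + exact: ltnW.
  + exact: prime_chain_le.
  + exact: (hk_density_cvg0 s_gt0 S_local S_char pS_res dS (prime_chain_le S0)).
  + exact: (hk_density_cvg0 s_gt0 T_local T_char pT_res (ltn_trans dT dS) (dim_T S0)).
Qed.
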